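(* There is a constant $c>0$ such that, for every sufficiently small $\varepsilon>0$: $$T_{m,\varepsilon}\le c(1/\rho)^{n-1}\big(mn\log\tfrac1\varepsilon\big)^m;$$ $$T^{\mathrm{REV}}_{m,\varepsilon}\le c\big(\tfrac{n^2}{\rho}\log\tfrac1\varepsilon\big)^m;$$ $$T^{\mathrm{EXP}}_{m,\varepsilon}\le c\big(\tfrac{d^3mn}{h^2}\log\tfrac1\varepsilon\big)^m\quad\text{and}\quad T^{\mathrm{EXP}}_{1,\varepsilon}\le \tfrac{cd^3}{h^2}\log\tfrac1\varepsilon;$$ and $\mathbb{E}\,T^{\mathrm{RAN}}_{1,\varepsilon}\le c\log\tfrac1\varepsilon$.
   Context: Averaging systems are considered on $[n]$ with weight threshold $\rho\in(0,1/2]$. There are graphs $G_t$ on $[n]$ with self-loops and row-stochastic $P_t$ whose positive entries are exactly the edges of $G_t$ and are all $\ge\rho$; the dynamics is $x(t+1)=P_tx(t)$. The special classes are: - REV: $P_t=\mathrm{diag}(q)^{-1}M_t$ with $M_t$ symmetric, nonzero entries $\ge1$ exactly on the edges, $M_t\mathbf 1=q$ fixed, $q\le\mathbf 1/\rho$. - EXP: REV with $M_t$ a $0/1$ matrix, $q=d\mathbf1$, and every connected component of $G_t$ having Cheeger constant at least $h$. - RAN: each $G_t$ is an independent uniformly random simple $(d-1)$-regular graph on $[n]$ with self-loops added, $P_t=M_t/d$, with fixed $d>3$. $T_\varepsilon$ is the number of times $t$ at which $G_t$ has an edge $\{i,j\}$ with $|x_i(t)-x_j(t)|\ge\varepsilon$.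 $T_{m,\varepsilon}$ is the maximum of $T_\varepsilon$ over all $n$-vertex graph sequences whose graphs have at most $m$ connected components. The superscripts restrict to the corresponding classes. The initial conditions are: - $x(0)\in[0,1]^n$ in the general case; - $\sum_iq_i(x_i(0)-\mu)^2\le1$ with $\mu=\sum_iq_ix_i(0)/\sum_iq_i$ in the REV, EXP and RAN cases. *)

(* Defs.v *)
From HB Require Import structures.
From mathcomp Require Import all_boot all_order all_algebra.
From mathcomp Require Import boolp reals exp.
Set Implicit Arguments. Unset Strict Implicit. Unset Printing Implicit Defensive.
Import Order.TTheory GRing.Theory Num.Theory.
Local Open Scope ring_scope.

Section Averaging.
Variables (R : realType) (n : nat).

Definition adj (P : 'M[R]_n) : rel 'I_n := fun i j => P i j != 0.

Definition admissible (rho : R) (P : 'M[R]_n) : Prop :=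
  [/\ forall i j, 0 <= P i j,
      forall i, \sum_j P i j = 1,
      forall i j, P i j != 0 -> rho <= P i j,
      forall i, P i i != 0
    & forall i j, (P i j != 0) = (P j i != 0)].

Definition ncomp (P : 'M[R]_n) : nat := n_comp (adj P) predT.

Fixpoint traj (P : nat -> 'M[R]_n) (x0 : 'cV[R]_n) (t : nat) : 'cV[R]_n :=
  match t with
  | 0 => x0
  | t'.+1 => P t' *m traj P x0 t'
  end.

Definition active (eps : R) (P : nat -> 'M[R]_n) (x0 : 'cV[R]_n) (t : nat) : bool :=
  [exists i : 'I_n, exists j : 'I_n,
     (P t i j != 0) && (eps <= `|traj P x0 t i 0 - traj P x0 t j 0|)].

(* number of active times t < N; T_eps is the supremum over N of this *)
Definition count_active (eps : R) (P : nat -> 'M[R]_n) (x0 : 'cV[R]_n) (N : nat) : nat :=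
  \sum_(t < N) active eps P x0 t.

Definition rev_mat (rho : R) (q : 'I_n -> R) (M P : 'M[R]_n) : Prop :=
  [/\ M^T = M,
      forall i j, M i j = 0 \/ 1 <= M i j,
      forall i, \sum_j M i j = q i,
      forall i, q i <= rho^-1
    & forall i j, P i j = M i j / q i].

Definition wmean (q : 'I_n -> R) (x : 'cV[R]_n) : R :=
  (\sum_i q i * x i 0) / (\sum_i q i).

Definition wvar_le1 (q : 'I_n -> R) (x : 'cV[R]_n) : Prop :=
  \sum_i q i * (x i 0 - wmean q x) ^+ 2 <= 1.

Definition comp (P : 'M[R]_n) (v : 'I_n) : {set 'I_n} :=
  [set j | connect (adj P) v j].

Definition cheeger_ge (h : R) (P : 'M[R]_n) : Prop :=
  forall (v : 'I_n) (S : {set 'I_n}),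
    S \subset comp P v -> (0 < #|S|)%N -> (2 * #|S| <= #|comp P v|)%N ->
    h * (#|S|)%:R <=
      (#|[set e : 'I_n * 'I_n | [&& e.1 \in S, e.2 \in comp P v :\: S
                                  & adj P e.1 e.2]]|)%:R.

Definition reg_graphs (d : nat) : {set {set 'I_n * 'I_n}} :=
  [set E : {set 'I_n * 'I_n} |
     [forall i : 'I_n, ((i, i) \notin E) && (#|[set j | (i, j) \in E]| == d.-1)]
     && [forall i : 'I_n, forall j : 'I_n, ((i, j) \in E) == ((j, i) \in E)]].

Definition ran_mat (d : nat) (E : {set 'I_n * 'I_n}) : 'M[R]_n :=
  \matrix_(i, j) (if (i == j) || ((i, j) \in E) then (d%:R)^-1 else 0).

Definition ran_seq (d N : nat) (g : {ffun 'I_N -> {set 'I_n * 'I_n}}) (t : nat)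
  : 'M[R]_n :=
  match insub t with
  | Some t' => ran_mat d (g t')
  | None => ran_mat d set0
  end.

(* max over admissible initial conditions of the number of active times < N,
   for the first N graphs given by g (the value is in 0..N) *)
Definition ran_Tmax (d : nat) (eps : R) (N : nat)
  (g : {ffun 'I_N -> {set 'I_n * 'I_n}}) : nat :=
  \max_(k < N.+1 | `[< exists x0 : 'cV[R]_n,
        wvar_le1 (fun _ => d%:R) x0 /\
        count_active eps (ran_seq d g) x0 N = k >]) k.

(* E over N i.i.d. uniform graphs from reg_graphs d *)
Definition ran_expect (d : nat) (eps : R) (N : nat) : R :=
  (\sum_(g in family (fun _ : 'I_N => mem (reg_graphs d))) (ran_Tmax d eps g)%:R)
  / (#|reg_graphs d| ^ N)%:R.

End Averaging.

(* Main.v *)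
(** The number of active times is bounded by [b * (V / eps ^+ 2) `^ s], where [V] is a
    Lyapunov function and [s] is of order [1 / ln eps^-1], so that the last factor is a
    constant and [b] is the claimed bound.  Sort the agents of a set closed under the
    current graph.  Either the gaps crossed by edges make up half of the diameter, and
    [V] drops at once by a definite factor; or a large gap is crossed by no edge.  In
    that case the two sides evolve independently, with fewer components each, until an
    edge crosses the gap, and that crossing makes [V] drop.  Induction on the number of
    components and on time gives the bound.

    In the reversible case [V] is the weighted variance and the drop is the sum of the
    variances of the averaged neighbourhoods; under expansion, Cheeger's inequality
    bounds it from below on every component.  In the general case [V] is the sum of the
    order statistics with weights decreasing geometrically from both ends: crossing the
    gap of rank [k] among [p] agents lowers it by [rho ^+ k + rho ^+ (p - k)] times the
    gap, which exactly balances the costs [rho ^- k.-1] and [rho ^- (p - k).-1] of the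
    two sides.

    The law of a random regular graph is invariant under relabeling.  A set of size [a]
    therefore has a small cut with probability (number of sets of size [a] with a small
    cut) / ['C(n, a)], which for any regular graph is at most a power of
    [1 / 'C(n, a)].  Hence the union of boundedly many independent graphs is an expander
    with probability at least [1/2], the variance contracts geometrically along such
    blocks for all initial conditions at once, and the expected number of active times
    is [O(ln eps^-1)]. *)

Require Import Defs.
From HB Require Import structures.
From mathcomp Require Import all_boot all_order all_algebra perm.
From mathcomp Require Import boolp reals sequences exp.
From mathcomp Require Import ring lra zify.
Import Order.TTheory GRing.Theory Num.Theory.
Local Open Scope ring_scope.
Set Implicit Arguments. Unset Strict Implicit. Unset Printing Implicit Defensive.

(** * Counting active times through splittings *)

(** A power of the Lyapunov function is used instead of its logarithm because [V / eps ^+ 2] may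
    fall below [1], where a logarithm turns negative. The induction needs an energy that is
    nonnegative, at least [1] at active times, and that loses a fixed fraction at each drop. By
    [powR_drop], a drop of [V] by the factor [1 - delta] becomes a drop by [1 - s * delta / 2]; the
    lost factor [s] is what puts [ln eps^-1] into the price of each component. The parts of a split
    start with energies at most a constant times that of the whole, so their cost is a lower power
    of the coefficient times the same energy. The single drop at the first crossing pays for all of
    it and for the crossing time itself. That drop can be estimated by the gap seen at the time of
    the split, because closed parts stay inside their initial intervals until then. Vertex sets are
    kept fixed and never follow the components of the changing graphs: a set only has to be closed
    while its active times are counted. *)

Lemma ord_predS_lt p (j : 'I_p.-1) : (j.+1 < p)%N.
Proof. by case: j => j /=; case: p. Qed.

Ltac nat_lia :=
  repeat match goal with H : ?t |- _ =>
    lazymatch t with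
    | is_true (leq _ _) => fail
    | is_true (andb _ _) => fail
    | @eq nat _ _ => fail
    | nat => fail
    | _ => clear H
    end
  end; lia.

Section SplitCounting.
Variables (R : realType) (T : finType) (e : nat -> rel T).
Variables (x : nat -> T -> R) (eps : R).

Definition sactive (S : {set T}) t : bool :=
  [exists i in S, exists j in S, e t i j && (eps <= `|x t i - x t j|)].

Definition sclosed (S : {set T}) t : bool :=
  [forall i in S, forall j, e t i j ==> (j \in S)].

(** On a closed set this is the number of components inside it, since the chosen root of each of
    them lies in the set. *)
Definition scomp (S : {set T}) t : nat := #|[set i in S | roots (e t) i]|.

Definition scount (S : {set T}) t N : nat := (\sum_(t <= u < t + N) sactive S u)%N.

Definition lpart (L : eqType) (f : T -> L) (S : {set T}) a := [set i in S | f i == a].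

Definition monochrome (L : eqType) (f : T -> L) (S : {set T}) t : bool :=
  [forall i in S, forall j in S, e t i j ==> (f i == f j)].

Implicit Types (S A : {set T}).
Hypothesis e_sym : forall t, symmetric (e t).

Lemma sclosedP S t :
  reflect (forall i j, i \in S -> e t i j -> j \in S) (sclosed S t).
Proof.
apply: (iffP forall_inP) => [h i j iS eij|h i iS].
  by have /forallP/(_ j)/implyP := h i iS; apply.
by apply/forallP=> j; apply/implyP; apply: h.
Qed.

Lemma monochromeP (L : eqType) (f : T -> L) S t :
  reflect (forall i j, i \in S -> j \in S -> e t i j -> f i = f j)
          (monochrome f S t).
Proof.
apply: (iffP forall_inP) => [h i j iS jS eij|h i iS].
  by have /forall_inP/(_ j jS)/implyP := h i iS; move/(_ eij)/eqP.
by apply/forall_inP=> j jS; apply/implyP=> eij; apply/eqP; apply: h.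
Qed.

Lemma sactiveP S t :
  reflect (exists i j, [/\ i \in S, j \in S, e t i j & eps <= `|x t i - x t j|])
          (sactive S t).
Proof.
apply: (iffP exists_inP) => [[i iS /exists_inP[j jS /andP[eij h]]]|].
  by exists i, j.
move=> [i [j [iS jS eij h]]]; exists i => //; apply/exists_inP; exists j => //.
by rewrite eij.
Qed.

Lemma connect_symr t : connect_sym (e t).
Proof. exact: sym_connect_sym (e_sym t). Qed.

Lemma sclosed_connect S t i j :
  sclosed S t -> i \in S -> connect (e t) i j -> j \in S.
Proof.
move=> /sclosedP cS iS /connectP[p]; elim: p i iS => [|k p IH] i iS /=.
  by move=> _ ->.
by move=> /andP[eik pk] jE; apply: (IH k) => //; apply: cS eik.
Qed.

Lemma scomp_gt0 S t : sclosed S t -> S != set0 -> (0 < scomp S t)%N.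
Proof.
move=> cS /set0Pn[i iS]; apply/card_gt0P; exists (fingraph.root (e t) i).
rewrite inE roots_root ?andbT; last exact: connect_symr.
exact: sclosed_connect cS iS (connect_root _ _).
Qed.

Lemma sclosed_lpart (L : eqType) (f : T -> L) S t a :
  sclosed S t -> monochrome f S t -> sclosed (lpart f S a) t.
Proof.
move=> /sclosedP cS /monochromeP mf; apply/sclosedP => i j.
rewrite !inE => /andP[iS /eqP <-] eij; have jS := cS _ _ iS eij.
by rewrite jS (mf _ _ iS jS eij) eqxx.
Qed.

Lemma scomp_lpart (L : finType) (f : T -> L) S t :
  scomp S t = (\sum_a scomp (lpart f S a) t)%N.
Proof.
rewrite /scomp -sum1_card (partition_big f predT) //=.
apply: eq_bigr => a _; rewrite -sum1_card; apply: eq_bigl => i.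
by rewrite !inE andbAC.
Qed.

Lemma sactive_lpart (L : finType) (f : T -> L) S t :
  monochrome f S t -> (sactive S t <= \sum_a sactive (lpart f S a) t)%N.
Proof.
move=> /monochromeP mf; case: sactiveP => // -[i [j [iS jS eij h]]].
rewrite (bigD1 (f i)) //=; case: sactiveP => // -[]; exists i, j.
by rewrite !inE iS jS eqxx (mf _ _ iS jS eij) eqxx.
Qed.

Lemma scountD S t N1 N2 :
  scount S t (N1 + N2) = (scount S t N1 + scount S (t + N1) N2)%N.
Proof. by rewrite /scount addnA (big_cat_nat (n := t + N1)) ?leq_addr. Qed.

Variables (U : {set T} -> nat -> R) (b : nat -> nat -> R) (M : nat).
Hypothesis U_ge0 : forall S t, 0 <= U S t.
Hypothesis b_ge0 : forall p m, 0 <= b p m.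
Hypothesis U_noninc : forall S t, sclosed S t -> U S t.+1 <= U S t.
Hypothesis U_active : forall S t, sclosed S t -> sactive S t -> 1 <= U S t.

(** The term [U S t] pays for the active time [t], being at least [1] there. *)
Definition drops_at_once S t m :=
  U S t + b #|S| m * U S t.+1 <= b #|S| m * U S t.

Definition split_cost r (f : T -> 'I_r.+2) (S : {set T}) t m :=
  \sum_a b #|lpart f S a| (m - r.+1) * U (lpart f S a) t.

(** ['I_r.+2] forces at least two parts. In the last clause [t1] is the first time at which an edge
    joins two parts, and the separate [U S t] pays for a possible activity at that time. *)
Definition drops_after_split S t m :=
  exists r (f : T -> 'I_r.+2),
  [/\ forall a, lpart f S a != set0,
      split_cost f S t m <= b #|S| m * U S t
    & forall t1, (t <= t1)%N ->
      (forall u, (t <= u <= t1)%N -> sclosed S u) ->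
      (forall u, (t <= u < t1)%N -> monochrome f S u) ->
      ~~ monochrome f S t1 ->
      split_cost f S t m + U S t + b #|S| m * U S t1.+1 <= b #|S| m * U S t].

Hypothesis drops : forall S t m, sclosed S t -> (scomp S t <= m)%N -> (m <= M)%N ->
  sactive S t -> drops_at_once S t m \/ drops_after_split S t m.

Lemma U_noninc_iter S t N :
  (forall u, (t <= u < t + N)%N -> sclosed S u) -> U S (t + N) <= U S t.
Proof.
elim: N => [|N IH] cS; first by rewrite addn0.
rewrite addnS; apply: le_trans (IH _).
  by apply: U_noninc; apply: cS; rewrite leq_addr /= ltn_add2l.
by move=> u /andP[tu ut]; apply: cS; rewrite tu addnS ltnS ltnW.
Qed.

(** Without edges between parts, an active edge lies within one part. Each of the [r.+1] other parts
    is closed and nonempty and so takes at least one component, which leaves [m - r.+1] for the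
    given part. *)
Lemma scount_split (r : nat) (f : T -> 'I_r.+2) S t N m :
  (forall a, lpart f S a != set0) ->
  (forall u, (t <= u < t + N)%N -> sclosed S u) ->
  (forall u, (t <= u < t + N)%N -> (scomp S u <= m)%N) ->
  (forall u, (t <= u < t + N)%N -> monochrome f S u) ->
  (forall A, (forall u, (t <= u < t + N)%N -> sclosed A u) ->
     (forall u, (t <= u < t + N)%N -> (scomp A u <= m - r.+1)%N) ->
     (scount A t N)%:R <= b #|A| (m - r.+1) * U A t) ->
  (scount S t N)%:R <= split_cost f S t m.
Proof.
move=> f0 cS sS mS bnd.
apply: (@le_trans _ _ (\sum_a scount (lpart f S a) t N)%N%:R).
  rewrite ler_nat /scount exchange_big /= big_nat [leqRHS]big_nat.
  by apply: leq_sum => u ut; apply: sactive_lpart; apply: mS.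
rewrite natr_sum; apply: ler_sum => a _; apply: bnd => u ut.
  by apply: sclosed_lpart; [apply: cS | apply: mS].
have := sS u ut; rewrite (scomp_lpart f) (bigD1 a) //=.
set rest := (\sum_(i | _) _)%N => le_m; suff le_r : (r.+1 <= rest)%N.
  by apply: leq_trans (leq_sub2l m le_r); rewrite leq_subRL ?(leq_trans _ le_m) ?leq_addl // addnC.
have -> : r.+1 = (\sum_(i : 'I_r.+2 | i != a) 1)%N.
  by rewrite sum1_card cardC1 card_ord.
apply: leq_sum => i _; apply: scomp_gt0 => //.
by apply: sclosed_lpart; [apply: cS | apply: mS].
Qed.

(** The induction is nested: the parts of a split fall under the outer induction on [m], with
    windows of any length, while the times after a drop keep [m] and fall under the inner induction
    on [N]. *)
Theorem scount_le m N S t : (m <= M)%N ->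
  (forall u, (t <= u < t + N)%N -> sclosed S u) ->
  (forall u, (t <= u < t + N)%N -> (scomp S u <= m)%N) ->
  (scount S t N)%:R <= b #|S| m * U S t.
Proof.
elim/ltn_ind: m N S t => m IHm; elim/ltn_ind => N IHN S t mM cS sS.
case: N IHN cS sS => [|N] IHN cS sS.
  by rewrite /scount addn0 big_geq // mulr_ge0.
have tail k : (k <= N)%N ->
    (scount S (t + k.+1) (N - k))%:R <= b #|S| m * U S (t + k).+1.
  move=> kN; rewrite -addnS; apply: IHN => //; first by lia.
    by move=> u ut; apply: cS; lia.
  by move=> u ut; apply: sS; lia.
have ct : sclosed S t by apply: cS; lia.
have st : (scomp S t <= m)%N by apply: sS; lia.
have one u : scount S u 1 = sactive S u by rewrite /scount addn1 big_nat1.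
case: (boolP (sactive S t)) => [at_|nat_]; last first.
  rewrite -add1n scountD natrD one (negbTE nat_) add0r.
  have := tail 0%N isT; rewrite subn0 addn0 => h; apply: le_trans h _.
  by apply: ler_wpM2l => //; apply: U_noninc.
have m1 : (0 < m)%N.
  apply: leq_trans st; apply: scomp_gt0 => //.
  by have /sactiveP[i [j [iS _ _ _]]] := at_; apply/set0Pn; exists i.
case: (drops ct st mM at_) => [hd|[r [f [f0 cost hd]]]].
  rewrite -add1n scountD natrD one at_; apply: le_trans hd; apply: lerD.
    exact: U_active.
  by have := tail 0%N isT; rewrite subn0 addn0.
have part k : (k <= N.+1)%N ->
    (forall u, (t <= u < t + k)%N -> monochrome f S u) ->
    (scount S t k)%:R <= split_cost f S t m.
  move=> kN mono; apply: scount_split => //.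
  - by move=> u ut; apply: cS; lia.
  - by move=> u ut; apply: sS; lia.
  - by move=> A cA sA; apply: IHm => //; lia.
have [/existsP[k0 k0P]|nex] := boolP [exists k : 'I_N.+1, ~~ monochrome f S (t + k)].
  have ex : exists k, (k <= N)%N && ~~ monochrome f S (t + k).
    by exists k0; rewrite k0P andbT -ltnS ltn_ord.
  case: (ex_minnP ex) => k /andP[kN nk] kmin.
  have -> : N.+1 = (k + (1 + (N - k)))%N by lia.
  rewrite !scountD !natrD one addrA.
  apply: le_trans (hd (t + k)%N _ _ _ nk); last 3 first.
  - by rewrite leq_addr.
  - by move=> u ut; apply: cS; lia.
  - move=> u ut; apply/negPn/negP => nu.
    have := kmin (u - t)%N; rewrite subnKC; last by lia.
    by rewrite nu andbT => /(_ _); lia.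
  apply: lerD; [apply: lerD|].
  - apply: part; first by lia.
    move=> u ut; apply/negPn/negP => nu.
    have := kmin (u - t)%N; rewrite subnKC; last by lia.
    by rewrite nu andbT => /(_ _); lia.
  - have : sclosed S (t + k) by apply: cS; lia.
    case: (boolP (sactive S (t + k))) => [ak ck|_ _]; last exact: U_ge0.
    apply: le_trans (U_active ck ak) _; apply: U_noninc_iter.
    by move=> u ut; apply: cS; lia.
  - by rewrite -addnA addn1; apply: tail.
apply: le_trans cost; apply: part => // u ut.
move: nex; rewrite negb_exists => /forallP nex.
have uN : (u - t < N.+1)%N by lia.
by have := nex (Ordinal uN); rewrite negbK /= subnKC //; lia.
Qed.

End SplitCounting.

(** * Order statistics, gaps and crossings *)

Section OrderStatistics.
Variables (R : realType) (T : finType).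
Implicit Types (S : {set T}) (x : T -> R).

Definition ostat x S j : R := nth 0 (sort <=%R [seq x i | i <- enum S]) j.

Let vals x S := sort <=%R [seq x i | i <- enum S].

Let vals_sorted x S : sorted <=%R (vals x S).
Proof. exact: sort_le_sorted. Qed.

Let size_vals x S : size (vals x S) = #|S|.
Proof. by rewrite size_sort size_map -cardE. Qed.

Let count_vals x S (a : pred R) : count a (vals x S) = #|[set i in S | a (x i)]|.
Proof.
rewrite count_sort count_map cardE -size_filter; congr size.
by rewrite /enum_mem -filter_predI; apply: eq_filter => i; rewrite !inE andbC.
Qed.

Lemma ostat_le x S j c : (j < #|S|)%N ->
  (ostat x S j <= c) = (j < #|[set i in S | (x i <= c)%R]|)%N.
Proof.
move=> jS; rewrite -(count_vals x S (fun z => z <= c)).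
apply/idP/idP => [|h]; last exact: (nth_count_le 0 (vals_sorted x S)).
rewrite ltnNge; apply: contraTN => h; rewrite -ltNge.
by apply: (nth_count_gt 0 (vals_sorted x S)); rewrite h size_vals.
Qed.

Lemma ostat_ge x S j c : (j < #|S|)%N ->
  (c <= ostat x S j) = (#|[set i in S | (x i < c)%R]| <= j)%N.
Proof.
move=> jS; rewrite -(count_vals x S (fun z => z < c)).
apply/idP/idP => [|h]; last first.
  by apply: (nth_count_ge 0 (vals_sorted x S)); rewrite h size_vals.
by rewrite leqNgt; apply: contraTN => h; rewrite -ltNge; exact: (nth_count_lt 0 (vals_sorted x S)).
Qed.

Lemma ostat_homo x S i j : (i <= j)%N -> (j < #|S|)%N -> ostat x S i <= ostat x S j.
Proof.
move=> ij jS; rewrite (le_sorted_leq_nth _ (vals_sorted x S)) //.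
- by rewrite inE size_vals (leq_ltn_trans ij).
- by rewrite inE size_vals.
Qed.

Lemma ostat_mem x S j : (j < #|S|)%N -> exists2 i, i \in S & x i = ostat x S j.
Proof.
move=> jS; have : ostat x S j \in vals x S by rewrite mem_nth // size_vals.
by rewrite mem_sort => /mapP[i]; rewrite mem_enum => iS ->; exists i.
Qed.

Lemma ostat_first x S i : i \in S -> ostat x S 0 <= x i.
Proof.
move=> iS; have S0 : (0 < #|S|)%N by apply/card_gt0P; exists i.
by rewrite ostat_le //; apply/card_gt0P; exists i; rewrite inE iS lexx.
Qed.

Lemma ostat_last x S i : i \in S -> x i <= ostat x S #|S|.-1.
Proof.
move=> iS; have S0 : (0 < #|S|)%N by apply/card_gt0P; exists i.
rewrite ostat_ge ?prednK // -ltnS prednK //; apply: proper_card.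
apply/properP; split; first by apply/subsetP => k; rewrite inE => /andP[].
by exists i => //; rewrite inE ltxx andbF.
Qed.

Lemma ostat_opp x S j : (j < #|S|)%N ->
  ostat (fun i => - x i) S j = - ostat x S (#|S|.-1 - j).
Proof.
move=> jS; have -> : ostat (fun i => - x i) S j = nth 0 (rev (map -%R (vals x S))) j.
  congr nth; apply: le_sorted_eq; first exact: sort_le_sorted.
  - rewrite rev_sorted sorted_map; move: (vals_sorted x S); apply: sub_sorted.
    by move=> a b /=; rewrite /relpre /= lerN2.
  - rewrite perm_sort perm_sym perm_rev (perm_trans (perm_map _ (permEl (perm_sort _ _)))) //.
    by rewrite -map_comp.
rewrite nth_rev ?size_map ?size_vals // (nth_map 0) ?size_vals; last by lia.
by congr (- nth _ _ _); lia.
Qed.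

Lemma ostat_dichotomy x S i j : i \in S -> (j.+1 < #|S|)%N ->
  (x i <= ostat x S j) || (ostat x S j.+1 <= x i).
Proof.
move=> iS jS; rewrite ostat_ge ?ostat_le //; last exact: ltnW.
rewrite -implyNb; apply/implyP; rewrite -ltnNge => h.
apply: leq_ltn_trans h _; apply: proper_card; apply/properP; split.
  by apply/subsetP => k; rewrite !inE => /andP[-> /ltW].
by exists i; rewrite !inE iS ?lexx ?ltxx.
Qed.

Definition gap x S j : R := ostat x S j.+1 - ostat x S j.

Definition diam x S : R := ostat x S #|S|.-1 - ostat x S 0.

Lemma gap_ge0 x S j : (j.+1 < #|S|)%N -> 0 <= gap x S j.
Proof. by move=> jS; rewrite subr_ge0 ostat_homo. Qed.

Lemma diam_sum_gap x S : diam x S = \sum_(j < #|S|.-1) gap x S j.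
Proof.
rewrite -(big_mkord xpredT (gap x S)) /diam /gap.
by rewrite telescope_sumr.
Qed.

Lemma diam_ge0 x S : 0 <= diam x S.
Proof.
rewrite diam_sum_gap; apply: sumr_ge0 => j _; apply: gap_ge0.
exact: ord_predS_lt.
Qed.

Lemma dist_le_diam x S i j : i \in S -> j \in S -> `|x i - x j| <= diam x S.
Proof.
move=> iS jS; rewrite /diam ler_norml.
have := ostat_first x iS; have := ostat_first x jS.
have := ostat_last x iS; have := ostat_last x jS.
by move=> *; apply/andP; split; lra.
Qed.

Lemma diam_attained x S : S != set0 ->
  exists i j, [/\ i \in S, j \in S & diam x S = x j - x i].
Proof.
rewrite -card_gt0 => S0; have [i iS xi] := ostat_mem x S0.
have S1 : (#|S|.-1 < #|S|)%N by rewrite prednK.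
by have [j jS xj] := ostat_mem x S1; exists i, j; rewrite xi xj.
Qed.

Lemma diamS x S (A : {set T}) : A \subset S -> diam x A <= diam x S.
Proof.
move=> AS; have [->|A0] := eqVneq A set0.
  rewrite {1}/diam cards0 subrr; exact: diam_ge0.
have [i [j [iA jA ->]]] := diam_attained x A0.
by apply: le_trans (ler_norm _) (dist_le_diam _ _ _); apply: (subsetP AS).
Qed.

Definition crossed (e : rel T) x S j : bool :=
  [exists i in S, exists k in S,
     [&& e i k, x i <= ostat x S j & ostat x S j.+1 <= x k]].

Lemma crossedP (e : rel T) x S j :
  reflect (exists i k, [/\ i \in S, k \in S, e i k,
                         x i <= ostat x S j & ostat x S j.+1 <= x k])
          (crossed e x S j).
Proof.
apply: (iffP exists_inP) => [[i iS /exists_inP[k kS /and3P[]]]|].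
  by exists i, k.
move=> [i [k [iS kS eik hi hk]]]; exists i => //; apply/exists_inP; exists k => //.
by rewrite eik hi hk.
Qed.

Variable e : rel T.
Hypotheses (e_refl : reflexive e) (e_sym : symmetric e).

(** A zero gap counts as crossed, by the loop at an agent holding the tied value. *)
Lemma uncrossed_gap_gt0 x S j : (j.+1 < #|S|)%N -> ~~ crossed e x S j -> 0 < gap x S j.
Proof.
move=> jS; apply: contraR; rewrite -leNgt subr_le0 => h.
have [i iS xi] := ostat_mem x (ltnW jS).
by apply/crossedP; exists i, i; rewrite iS e_refl xi h lexx.
Qed.

Lemma uncrossed_monochrome x S j : (j.+1 < #|S|)%N -> ~~ crossed e x S j ->
  monochrome (fun=> e) (fun i => x i <= ostat x S j) S 0.
Proof.
move=> jS nc; apply/monochromeP.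
have H i k : i \in S -> k \in S -> e i k -> x i <= ostat x S j -> x k <= ostat x S j.
  move=> iS kS eik xi; have /orP[//|xk] := ostat_dichotomy x kS jS.
  by case/negP: nc; apply/crossedP; exists i, k.
move=> i k iS kS eik; apply/idP/idP; first exact: H.
by apply: H => //; rewrite e_sym.
Qed.

(** Agents at the lower ends of the uncrossed gaps, together with one of maximal value, lie in
    pairwise different components: any two of them are separated by the gap above the lower one. *)
Lemma card_uncrossed x S : sclosed (fun=> e) S 0 -> S != set0 ->
  (#|[set j : 'I_#|S|.-1 | ~~ crossed e x S j]| < scomp (fun=> e) S 0)%N.
Proof.
move=> cS S0; have S1 : (0 < #|S|)%N by rewrite card_gt0.
have [i0 i0S] := set0Pn _ S0.
have wit j : exists i, (j < #|S|)%N ==> (i \in S) && (x i == ostat x S j).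
  case: (ltnP j #|S|) => [/(ostat_mem x)[i iS /eqP xi]|_]; last by exists i0.
  by exists i; rewrite iS.
pose w j := xchoose (wit j).
have wP j : (j < #|S|)%N -> w j \in S /\ x (w j) = ostat x S j.
  by move=> jS; have /implyP/(_ jS)/andP[? /eqP] := xchooseP (wit j).
have csym := sym_connect_sym e_sym.
have sep j k : (j < k)%N -> (k < #|S|)%N -> ~~ crossed e x S j ->
    fingraph.root e (w j) != fingraph.root e (w k).
  move=> jk kS nc; rewrite root_connect //; apply/negP => con.
  have jS : (j.+1 < #|S|)%N by apply: leq_ltn_trans kS.
  have [wjS xj] := wP j (ltnW jS); have [wkS xk] := wP k kS.
  have cA := sclosed_lpart true cS (uncrossed_monochrome jS nc).
  have wA : w j \in lpart (fun i => x i <= ostat x S j) S true.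
    by rewrite inE wjS xj lexx.
  have := sclosed_connect cA wA con; rewrite inE wkS /= eqb_id xk leNgt.
  move/negP; apply; apply: lt_le_trans (ostat_homo x jk kS).
  by rewrite -subr_gt0; apply: uncrossed_gap_gt0.
pose U := [set j : 'I_#|S|.-1 | ~~ crossed e x S j].
pose rt (j : 'I_#|S|.-1) := fingraph.root e (w j).
have ltS (j : 'I_#|S|.-1) : (j.+1 < #|S|)%N by exact: ord_predS_lt.
have inj : {in U &, injective rt}.
  move=> j k; rewrite !inE => nj nk eqr; apply/val_inj => /=.
  case: (ltngtP j k) => // lt.
    by have := sep _ _ lt (ltnW (ltS k)) nj; rewrite -/(rt j) eqr eqxx.
  by have := sep _ _ lt (ltnW (ltS j)) nk; rewrite -/(rt k) -eqr eqxx.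
have notin : fingraph.root e (w #|S|.-1) \notin rt @: U.
  apply/negP => /imsetP[j]; rewrite inE => nj /esym/eqP; apply/negP.
  by apply: sep => //; rewrite prednK.
have -> : #|[set j : 'I_#|S|.-1 | ~~ crossed e x S j]| = #|rt @: U|.
  by rewrite card_in_imset.
have -> : (#|rt @: U|.+1 = #|fingraph.root e (w #|S|.-1) |: (rt @: U)|)%N.
  by rewrite cardsU1 notin.
have rS j : (j < #|S|)%N ->
    fingraph.root e (w j) \in [set i in S | roots e i].
  move=> jS; rewrite inE roots_root // andbT.
  by have [wS _] := wP j jS; apply: (sclosed_connect cS wS); apply: connect_root.
apply: subset_leq_card; apply/subsetP => i /setU1P[->|/imsetP[j _ ->]]; apply: rS.
  by rewrite prednK.
exact: ltnW (ltS j).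
Qed.

(* The gaps inside [lo, hi] telescope once the order statistics are clamped to it. *)
Lemma sum_gap_inside x S lo hi : lo <= hi ->
  \sum_(j < #|S|.-1 | (lo <= ostat x S j) && (ostat x S j.+1 <= hi)) gap x S j
    <= hi - lo.
Proof.
move=> lohi; pose cl j := Num.max lo (Num.min hi (ostat x S j)).
have cl_in j : lo <= cl j <= hi.
  by rewrite /cl le_max lexx /= ge_max lohi ge_min lexx.
apply: (@le_trans _ _ (\sum_(j < #|S|.-1) (cl j.+1 - cl j))).
  rewrite big_mkcond; apply: ler_sum => j _.
  have jS : (j.+1 < #|S|)%N by exact: ord_predS_lt.
  have le := ostat_homo x (leqnSn j) jS.
  case: ifP => [/andP[h1 h2]|_].
    rewrite /cl /gap (min_idPr h2) (min_idPr (le_trans le h2)).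
    by rewrite (max_idPr h1) (max_idPr (le_trans h1 le)).
  by rewrite subr_ge0 /cl le_max2 // le_min2.
rewrite -(big_mkord xpredT (fun j => cl j.+1 - cl j)) telescope_sumr //.
by have /andP[? ?] := cl_in #|S|.-1; have /andP[? ?] := cl_in 0%N; lra.
Qed.

(** Each crossed gap is charged to an interval covering it, and the sums are exchanged. The
    intervals will be the ranges of neighbourhoods or of whole components. *)
Lemma sum_gap_crossed x S (K : finType) (A : pred K) (lo hi : K -> R) :
  (forall k, A k -> lo k <= hi k) ->
  (forall j, (j.+1 < #|S|)%N -> crossed e x S j ->
     exists2 k, A k & (lo k <= ostat x S j) && (ostat x S j.+1 <= hi k)) ->
  \sum_(j < #|S|.-1 | crossed e x S j) gap x S j <= \sum_(k | A k) (hi k - lo k).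
Proof.
move=> lohi cov.
have jS (j : 'I_#|S|.-1) : (j.+1 < #|S|)%N by exact: ord_predS_lt.
apply: (@le_trans _ _ (\sum_(j < #|S|.-1 | crossed e x S j) \sum_(k | A k)
    if (lo k <= ostat x S j) && (ostat x S j.+1 <= hi k) then gap x S j else 0)).
  apply: ler_sum => j cj; have [k Ak hk] := cov j (jS j) cj.
  rewrite (bigD1 k) //= hk lerDl; apply: sumr_ge0 => i _.
  by case: ifP => // _; apply: gap_ge0.
rewrite exchange_big; apply: ler_sum => k Ak.
apply: le_trans (sum_gap_inside x S (lohi k Ak)).
rewrite -big_mkcondr /= [leRHS]big_mkcond [leLHS]big_mkcond.
apply: ler_sum => j _; case: (crossed e x S j) => //=.
by case: ifP => // _; apply: gap_ge0.
Qed.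

End OrderStatistics.

Lemma exists_ge_average (R : realType) (I : finType) (U : {set I}) (a : I -> R) c mu :
  0 < c -> c <= \sum_(j in U) a j -> (#|U| <= mu)%N ->
  exists2 j, j \in U & c <= mu%:R * a j.
Proof.
move=> c0 cs Umu; have [j1 j1U] : exists j, j \in U.
  apply/set0Pn; apply/negP => /eqP U0.
  by move: cs; rewrite U0 big_set0 leNgt c0.
case: (arg_maxP a j1U) => j jU jmax; exists j => //.
have le : c <= #|U|%:R * a j.
  apply: le_trans cs _; rewrite mulr_natl -sumr_const; apply: ler_sum => k kU.
  exact: jmax.
(* Replacing [#|U|] by the larger [mu] requires [0 <= a j], which follows from [0 < c]. *)
have pos := lt_le_trans c0 le; apply: le_trans le _; apply: ler_wpM2r; last by rewrite ler_nat.
rewrite leNgt; apply/negP => aj; move: pos.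
by rewrite ltNge mulr_ge0_le0 // ltW.
Qed.

(** * Averaging and weighted variance *)

Section Hull.
Variables (R : realType) (T : finType) (P : nat -> T -> T -> R) (x : nat -> T -> R).
Hypothesis P_ge0 : forall t i j, 0 <= P t i j.
Hypothesis P_sum1 : forall t i, \sum_j P t i j = 1.
Hypothesis x_step : forall t i, x t.+1 i = \sum_j P t i j * x t j.

Let e t : rel T := fun i j => P t i j != 0.

Lemma average_le t i c : (forall j, e t i j -> x t j <= c) -> x t.+1 i <= c.
Proof.
move=> h; rewrite x_step -[c]mul1r -(P_sum1 t i) mulr_suml; apply: ler_sum => j _.
have [->|nz] := eqVneq (P t i j) 0; first by rewrite !mul0r.
by apply: ler_wpM2l => //; apply: h.
Qed.

Lemma average_ge t i c : (forall j, e t i j -> c <= x t j) -> c <= x t.+1 i.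
Proof.
move=> h; rewrite x_step -[c]mul1r -(P_sum1 t i) mulr_suml; apply: ler_sum => j _.
have [->|nz] := eqVneq (P t i j) 0; first by rewrite !mul0r.
by apply: ler_wpM2l => //; apply: h.
Qed.

Lemma hull_iter A lo hi t u : (t <= u)%N ->
  (forall v, (t <= v < u)%N -> sclosed e A v) ->
  (forall i, i \in A -> lo <= x t i <= hi) ->
  forall i, i \in A -> lo <= x u i <= hi.
Proof.
move=> /subnKC <-; elim: (u - t)%N => [|k IH] cA h0; first by rewrite addn0.
move=> i iA; have /sclosedP cl : sclosed e A (t + k) by apply: cA; lia.
have h : forall j, e (t + k) i j -> lo <= x (t + k)%N j <= hi.
  move=> j /(cl _ _ iA) jA; apply: IH => // v tv; apply: cA; lia.
by rewrite addnS average_ge ?average_le // => j /h/andP[].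
Qed.

(** As long as no edge joins two parts, every part is closed and averaging keeps it in its initial
    interval. A gap chosen at the split is therefore still present at the first crossing. *)
Lemma split_separated (L : finType) (f : T -> L) (lo hi : L -> R) S t u i :
  (t <= u)%N -> (forall v, (t <= v < u)%N -> sclosed e S v) ->
  (forall v, (t <= v < u)%N -> monochrome e f S v) ->
  (forall i, i \in S -> lo (f i) <= x t i <= hi (f i)) ->
  i \in S -> lo (f i) <= x u i <= hi (f i).
Proof.
move=> tu cS mS h0 iS; apply: (@hull_iter (lpart f S (f i))) tu _ _ _ _.
- by move=> v tv; apply: sclosed_lpart; [apply: cS | apply: mS].
- by move=> k; rewrite inE => /andP[kS /eqP <-]; apply: h0.
- by rewrite inE iS eqxx.
Qed.

End Hull.

Section Variance.
Variables (R : realType) (T : finType) (q : T -> R).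
Hypothesis q_ge1 : forall i, 1 <= q i.
Implicit Types (S A : {set T}) (x y : T -> R).

Let q_gt0 i : 0 < q i. Proof. exact: lt_le_trans ltr01 (q_ge1 i). Qed.

Definition moment S x c : R := \sum_(i in S) q i * (x i - c) ^+ 2.

Definition var S x : R := moment S x ((\sum_(i in S) q i * x i) / \sum_(i in S) q i).

Lemma var_le_moment S x c : var S x <= moment S x c.
Proof.
rewrite /var; set Q := \sum_(i in S) q i; set A := \sum_(i in S) q i * x i.
have expand d : moment S x d = \sum_(i in S) q i * x i ^+ 2 - 2 * d * A + d ^+ 2 * Q.
  rewrite /A /Q !mulr_sumr -sumrB -big_split; apply: eq_bigr => i _ /=; ring.
rewrite !expand -subr_ge0; have [S0|S0] := eqVneq S set0.
  by rewrite /A /Q S0 !big_set0 !(mulr0, mul0r, subr0, addr0).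
have Q0 : 0 < Q.
  have [i iS] := set0Pn _ S0; rewrite /Q (bigD1 i) //=.
  by apply: ltr_pwDl => //; apply: sumr_ge0 => j _; apply: ltW.
set B := \sum_(i in S) _.
have -> : B - 2 * c * A + c ^+ 2 * Q -
  (B - 2 * (A / Q) * A + (A / Q) ^+ 2 * Q) = Q * (c - A / Q) ^+ 2.
  by field; rewrite gt_eqF.
by rewrite mulr_ge0 ?sqr_ge0 ?ltW.
Qed.

Lemma moment_ge0 S x c : 0 <= moment S x c.
Proof. by apply: sumr_ge0 => i _; rewrite mulr_ge0 ?sqr_ge0 ?ltW. Qed.

Lemma var_ge0 S x : 0 <= var S x. Proof. exact: moment_ge0. Qed.

Lemma momentS S A x c : A \subset S -> moment A x c <= moment S x c.
Proof.
move=> AS; rewrite /moment [leRHS](big_setID A) /= (setIidPr AS) lerDl.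
by apply: sumr_ge0 => i _; rewrite mulr_ge0 ?sqr_ge0 ?ltW.
Qed.

Lemma varS S A x : A \subset S -> var A x <= var S x.
Proof. by move=> AS; apply: le_trans (var_le_moment _ _ _) (momentS _ _ AS). Qed.

Lemma moment_ge_pair (w : T -> R) c z i j : (forall k, 0 <= w k) -> 1 <= w i ->
  1 <= w j -> (z i - z j) ^+ 2 / 2 <= \sum_k w k * (z k - c) ^+ 2.
Proof.
move=> w0 wi wj; have [->|ij] := eqVneq i j.
  by rewrite subrr expr0n mul0r; apply: sumr_ge0 => k _; rewrite mulr_ge0 ?sqr_ge0.
rewrite (bigD1 i) //= (bigD1 j) 1?eq_sym //=.
set rest := \sum_(_ | _) _; have r0 : 0 <= rest.
  by apply: sumr_ge0 => k _; rewrite mulr_ge0 ?sqr_ge0.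
have : (z i - c) ^+ 2 <= w i * (z i - c) ^+ 2 by rewrite ler_peMl ?sqr_ge0.
have : (z j - c) ^+ 2 <= w j * (z j - c) ^+ 2 by rewrite ler_peMl ?sqr_ge0.
have : 0 <= (z i - c + (z j - c)) ^+ 2 by exact: sqr_ge0.
move: r0; set a := z i - c; set b := z j - c; have -> : z i - z j = a - b by rewrite /a /b; ring.
by move: (w i * _) (w j * _) => u v; nra.
Qed.

Lemma var_ge_pair S x i j : i \in S -> j \in S -> (x i - x j) ^+ 2 / 2 <= var S x.
Proof.
move=> iS jS; rewrite /var; set c := (X in moment S x X).
rewrite /moment big_mkcond /=.
have -> : \sum_k (if k \in S then q k * (x k - c) ^+ 2 else 0)
   = \sum_k (if k \in S then q k else 0) * (x k - c) ^+ 2.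
  by apply: eq_bigr => k _; case: ifP; rewrite ?mul0r.
apply: moment_ge_pair; rewrite ?iS ?jS // => k.
by case: ifP => // _; apply: ltW.
Qed.

Lemma var_le_diam S x Q : \sum_(i in S) q i <= Q -> var S x <= Q * diam x S ^+ 2.
Proof.
move=> qQ; apply: le_trans (var_le_moment _ _ (ostat x S 0)) _.
apply: (@le_trans _ _ ((\sum_(i in S) q i) * diam x S ^+ 2)); last first.
  by apply: ler_wpM2r => //; apply: sqr_ge0.
rewrite mulr_suml; apply: ler_sum => i iS; apply: ler_wpM2l; first exact: ltW.
have h1 := ostat_first x iS; have h2 := ostat_last x iS.
rewrite ler_sqr ?nnegrE ?subr_ge0 //; last exact: le_trans h1 h2.
by rewrite /diam; lra.
Qed.

Variable M : T -> T -> R.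
Hypothesis M_sym : forall i j, M i j = M j i.
Hypothesis M_ge0 : forall i j, 0 <= M i j.
Hypothesis M_sum : forall i, \sum_j M i j = q i.

Definition dissip S x y : R := \sum_(k in S) \sum_j M k j * (x j - y k) ^+ 2.

Lemma dissip_ge0 S x y : 0 <= dissip S x y.
Proof. by apply: sumr_ge0 => k _; apply: sumr_ge0 => j _; rewrite mulr_ge0 ?sqr_ge0. Qed.

Lemma dissip_ge_pair S x y k i j : k \in S -> 1 <= M k i -> 1 <= M k j ->
  (x i - x j) ^+ 2 / 2 <= dissip S x y.
Proof.
move=> kS Mi Mj; apply: le_trans (@moment_ge_pair (M k) (y k) x i j _ Mi Mj) _ => //.
rewrite /dissip [leRHS](bigD1 k) //= lerDl.
by apply: sumr_ge0 => u _; apply: sumr_ge0 => v _; rewrite mulr_ge0 ?sqr_ge0.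
Qed.

(** In each row, the second moment of the neighbourhood about [c] splits into that of its mean [y k]
    and its dispersion about [y k]. Summed over the rows, the symmetry of [M] turns the weights into
    column sums, which are at most [q]. *)
Lemma var_step S x y :
  (forall k j, k \in S -> M k j != 0 -> j \in S) ->
  (forall k, y k = \sum_j M k j / q k * x j) ->
  var S y <= var S x - dissip S x y.
Proof.
move=> cS yE; rewrite {2}/var; set c := (_ / _).
apply: le_trans (var_le_moment _ _ c) _; rewrite lerBrDr.
have row k : q k * (y k - c) ^+ 2 + \sum_j M k j * (x j - y k) ^+ 2
    = \sum_j M k j * (x j - c) ^+ 2.
  have qy : q k * y k = \sum_j M k j * x j.
    rewrite yE mulr_sumr; apply: eq_bigr => j _; field; exact: lt0r_neq0.
  have ex d : \sum_j M k j * (x j - d) ^+ 2 =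
      \sum_j M k j * x j ^+ 2 - 2 * d * (q k * y k) + d ^+ 2 * q k.
    rewrite qy -M_sum !mulr_sumr -sumrB -big_split; apply: eq_bigr => i _ /=; ring.
  rewrite !ex; ring.
rewrite /moment /dissip -big_split /= (eq_bigr _ (fun k _ => row k)).
rewrite (eq_bigr (fun k => \sum_(j in S) M j k * (x j - c) ^+ 2)); last first.
  move=> k kS; rewrite [RHS]big_mkcond /=; apply: eq_bigr => j _.
  rewrite M_sym; case: ifP => // jS; have [->|nz] := eqVneq (M j k) 0.
    by rewrite mul0r.
  by move: nz; rewrite M_sym => /(cS _ _ kS); rewrite jS.
rewrite exchange_big; apply: ler_sum => j jS; rewrite -mulr_suml.
apply: ler_wpM2r; first exact: sqr_ge0.
rewrite -(M_sum j) big_mkcond; apply: ler_sum => k _.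
by case: ifP.
Qed.

End Variance.

(** With [z = s * delta <= 1], the power of [1 - delta] is at most [expR (- z)], hence at most
    [(1 + z)^-1], hence at most [1 - z / 2]. *)
Lemma powR_drop (R : realType) (s delta v w : R) : 0 < s <= 1 -> 0 <= delta <= 1 ->
  0 <= v -> v <= (1 - delta) * w -> 0 <= w -> v `^ s <= (1 - s * delta / 2) * w `^ s.
Proof.
move=> /andP[s0 s1] /andP[d0 d1] v0 vw w0.
apply: (@le_trans _ _ (((1 - delta) * w) `^ s)).
  apply: ge0_ler_powR; rewrite ?nnegrE //; first exact: ltW.
  by rewrite mulr_ge0 // subr_ge0.
rewrite powRM // ?subr_ge0 //; apply: ler_wpM2r; first exact: powR_ge0.
have [->|d1'] := eqVneq delta 1.
  by rewrite subrr powR0 ?gt_eqF // mulr1; lra.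
have d2 : 0 < 1 - delta by rewrite subr_gt0 lt_neqAle d1' d1.
rewrite /powR gt_eqF //; apply: (@le_trans _ _ (expR (- (s * delta)))).
  rewrite ler_expR -mulrN; apply: ler_wpM2l; first exact: ltW.
  by rewrite -[leRHS]expRK ler_ln ?posrE ?expR_gt0 // expR_ge1Dx.
have h : 1 + s * delta <= expR (s * delta) by exact: expR_ge1Dx.
have sd0 : 0 <= s * delta by apply: mulr_ge0 => //; exact: ltW.
have sd1 : s * delta <= 1 by nra.
rewrite expRN; apply: (@le_trans _ _ (1 + s * delta)^-1).
  by rewrite lef_pV2 ?posrE ?expR_gt0 //; lra.
rewrite -[leLHS]mul1r ler_pdivrMr; last by lra.
by move: (s * delta) sd0 sd1 => z z0 z1; nra.
Qed.

(** * Reversible systems *)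

Lemma quarter_div_le (R : realType) (D m g : R) :
  0 < m -> D / 4 <= m * g -> D / (4 * m) <= g.
Proof. by move=> m0 h; rewrite ler_pdivrMr ?mulr_gt0 //; lra. Qed.

Lemma inv32_in01 (R : realType) (K : R) : 1 <= K -> 0 <= (32 * K)^-1 <= 1.
Proof. by move=> K1; rewrite invr_ge0 invf_le1; lra. Qed.

Lemma sqr_quarter_le (R : realType) (D g : R) :
  0 < D -> D / 4 <= g -> D ^+ 2 / 32 <= g ^+ 2 / 2.
Proof.
move=> D0 h; have : (D / 4) ^+ 2 <= g ^+ 2 by rewrite ler_sqr ?nnegrE; lra.
by rewrite expr_div_n; lra.
Qed.

Lemma three_levels (R : realType) (a a' b b' g : R) :
  g <= a' - a -> g <= b' - b -> a' <= b -> 0 <= g ->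
  [/\ a + g <= a', a + g <= b' & b + g <= b'].
Proof. by move=> *; split; lra. Qed.

Lemma triple_succ_le (R : realType) (k : R) : 1 <= k -> 3 * k + 1 <= 576 * k.
Proof. by move=> k1; lra. Qed.

Section ReversibleCount.
Variables (R : realType) (T : finType) (P M : nat -> T -> T -> R) (q : T -> R).
Variables (x : nat -> T -> R) (eps : R).
Hypothesis q_ge1 : forall i, 1 <= q i.
Hypothesis M_sym : forall t i j, M t i j = M t j i.
Hypothesis M_01 : forall t i j, M t i j = 0 \/ 1 <= M t i j.
Hypothesis M_refl : forall t i, M t i i != 0.
Hypothesis M_sum : forall t i, \sum_j M t i j = q i.
Hypothesis P_E : forall t i j, P t i j = M t i j / q i.
Hypothesis x_step : forall t i, x t.+1 i = \sum_j P t i j * x t j.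
Hypothesis eps_gt0 : 0 < eps.

Definition support_rel t : rel T := fun i j => P t i j != 0.
Local Notation e := support_rel.
Implicit Types (S A : {set T}).

Let q_gt0 i : 0 < q i. Proof. exact: lt_le_trans ltr01 (q_ge1 i). Qed.

Lemma rev_ge0 t i j : 0 <= M t i j.
Proof. by case: (M_01 t i j) => [->|/(le_trans ler01)]. Qed.

Lemma rev_relE t i j : e t i j = (M t i j != 0).
Proof. by rewrite /e P_E mulf_eq0 invr_eq0 (gt_eqF (q_gt0 i)) orbF. Qed.

Lemma rev_rel_ge1 t i j : e t i j -> 1 <= M t i j.
Proof. by rewrite rev_relE; case: (M_01 t i j) => // ->; rewrite eqxx. Qed.

Lemma rev_rel_sym t : symmetric (e t).
Proof. by move=> i j; rewrite !rev_relE M_sym. Qed.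

Lemma rev_rel_refl t : reflexive (e t).
Proof. by move=> i; rewrite rev_relE M_refl. Qed.

Lemma rev_var_step S t : sclosed e S t ->
  var q S (x t.+1) <= var q S (x t) - dissip (M t) S (x t) (x t.+1).
Proof.
move=> /sclosedP cS; apply: var_step => //.
- by move=> i j; apply: rev_ge0.
- by move=> k j kS; rewrite -rev_relE; apply: cS.
- by move=> k; rewrite x_step; apply: eq_bigr => j _; rewrite P_E.
Qed.

Lemma rev_var_noninc S t : sclosed e S t -> var q S (x t.+1) <= var q S (x t).
Proof.
move=> cS; apply: le_trans (rev_var_step cS) _; rewrite gerBl.
by apply: dissip_ge0 => i j; apply: rev_ge0.
Qed.

Lemma rev_var_noninc_iter S t u : (t <= u)%N ->
  (forall v, (t <= v < u)%N -> sclosed e S v) -> var q S (x u) <= var q S (x t).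
Proof.
move=> /subnKC <-; elim: (u - t)%N => [|k IH] cS; first by rewrite addn0.
rewrite addnS; apply: le_trans (rev_var_noninc _) (IH _).
  by apply: cS; nat_lia.
by move=> v tv; apply: cS; nat_lia.
Qed.

(** The reversible and the expanding cases share the argument below and differ in [dissip_large] and
    in these parameters. [Q] bounds the total weight and [mu] the number of uncrossed gaps. The
    premise [1 < Mx] keeps the number of agents out of the connected case, where no gap is
    uncrossed. *)
Variables (s K Q : R) (Mx mu : nat).
Hypothesis s01 : 0 < s <= 1.
Hypothesis K_ge1 : 1 <= K.
Hypothesis dissip_large : forall S t, sclosed e S t -> (scomp e S t <= Mx)%N ->
  diam (x t) S / 2 <= \sum_(j < #|S|.-1 | crossed (e t) (x t) S j) gap (x t) S j ->
  var q S (x t) <= 16 * K * dissip (M t) S (x t) (x t.+1).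
Hypothesis q_sum : (1 < Mx)%N -> \sum_i q i <= Q.
Hypothesis Q_le : (1 < Mx)%N -> Q <= K.
Hypothesis Qmu_le : (1 < Mx)%N -> Q * mu%:R ^+ 2 <= K ^+ 2.
Hypothesis mu_ge : (#|T| <= mu)%N || (Mx <= mu)%N.

Definition rev_energy (S : {set T}) t : R := (2 * var q S (x t) / eps ^+ 2) `^ s.

(** The constant [192] makes [kappa * (s / (64 * K))] equal to [3]: two units for the two parts of a
    split at one gap, one for the crossing time. *)
Variable kappa : R.
Hypothesis kappaE : kappa = 192 * K / s.
Let s_gt0 : 0 < s. Proof. by case/andP: s01. Qed.
Let s_le1 : s <= 1. Proof. by case/andP: s01. Qed.
Let K_gt0 : 0 < K. Proof. exact: lt_le_trans ltr01 K_ge1. Qed.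

Let kappa_ge : 192 * K <= kappa.
Proof. by rewrite kappaE ler_pdivlMr // ler_piMr // mulr_ge0 // ltW. Qed.

Let kappa_ge1 : 1 <= kappa. Proof. by have := kappa_ge; have := K_ge1; lra. Qed.

Lemma rev_energy_arg_ge0 S t : 0 <= 2 * var q S (x t) / eps ^+ 2.
Proof. by rewrite divr_ge0 ?mulr_ge0 ?var_ge0 ?exprn_ge0 ?(ltW eps_gt0). Qed.

Lemma rev_energy_drop S t u delta : 0 <= delta <= 1 ->
  var q S (x u) <= (1 - delta) * var q S (x t) ->
  rev_energy S u <= (1 - s * delta / 2) * rev_energy S t.
Proof.
move=> d01 h; have e2 : 0 < eps ^+ 2 by rewrite exprn_gt0.
apply: powR_drop => //; try exact: rev_energy_arg_ge0.
by rewrite mulrA ler_pM2r ?invr_gt0 // mulrCA ler_pM2l.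
Qed.

Lemma rev_energyS S A t : A \subset S -> rev_energy A t <= rev_energy S t.
Proof.
move=> AS; have e2 : 0 < eps ^+ 2 by rewrite exprn_gt0.
apply: ge0_ler_powR; rewrite ?nnegrE ?rev_energy_arg_ge0 //; first exact: ltW.
by rewrite ler_pM2r ?invr_gt0 // ler_pM2l // varS.
Qed.

Lemma rev_energy_active S t : sactive e x eps S t -> 1 <= rev_energy S t.
Proof.
move=> /sactiveP[i [j [iS jS _ h]]]; have e2 : 0 < eps ^+ 2 by rewrite exprn_gt0.
rewrite -(powRr0 (2 * var q S (x t) / eps ^+ 2)); apply: ler_powR; last exact: ltW.
rewrite ler_pdivlMr // mul1r; have := var_ge_pair q_ge1 (x t) iS jS.
suff : eps ^+ 2 <= (x t i - x t j) ^+ 2 by lra.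
by rewrite -[leRHS]real_normK ?num_real // ler_sqr ?nnegrE // ltW.
Qed.

(** The energy is monotone in the set, so the parts together cost at most
    [r.+2%:R * kappa ^+ (m - r.+1)] times the energy of [S]. The first edge between parts spans at
    least [g] and dissipates [g ^+ 2 / 2], a fraction [delta] of the variance at the time of the
    split. *)
Lemma rev_split r (f : T -> 'I_r.+2) S t m g delta :
  (forall a, lpart f S a != set0) -> 0 <= g -> 0 <= delta <= 1 ->
  delta * var q S (x t) <= g ^+ 2 / 2 ->
  r.+2%:R * kappa ^+ (m - r.+1) + 1 <= kappa ^+ m * (s * delta / 2) ->
  (forall u, (t <= u)%N -> (forall v, (t <= v <= u)%N -> sclosed e S v) ->
     (forall v, (t <= v < u)%N -> monochrome e f S v) ->
     forall i j, i \in S -> j \in S -> f i != f j -> g <= `|x u i - x u j|) ->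
  drops_after_split e rev_energy (fun _ => GRing.exp kappa) S t m.
Proof.
move=> f0 g0 d01 dv num sep; exists r, f; split=> //.
  have := num; have : split_cost rev_energy (fun _ => GRing.exp kappa) f S t m
      <= r.+2%:R * kappa ^+ (m - r.+1) * rev_energy S t.
    rewrite /split_cost -mulr_sumr -mulrA mulrCA; apply: ler_wpM2l.
      by rewrite exprn_ge0 // (le_trans ler01).
    rewrite mulr_natl -[X in _ *+ X]card_ord -sumr_const; apply: ler_sum => a _.
    by apply: rev_energyS; apply/subsetP => i; rewrite inE => /andP[].
  move=> le le2; apply: le_trans le _; apply: ler_wpM2r; first exact: powR_ge0.
  apply: (@le_trans _ _ (kappa ^+ m * (s * delta / 2))); first lra.
  rewrite ler_piMr ?exprn_ge0 ?(le_trans ler01 kappa_ge1) //.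
  by case/andP: d01 => d0 d1; have := s_le1; have := s_gt0; nra.
move=> t1 tt1 cS mS nm.
have [i [j [iS jS eij fij]]] : exists i j, [/\ i \in S, j \in S, e t1 i j & f i != f j].
  move: nm; rewrite /monochrome negb_forall_in => /exists_inP[i iS].
  rewrite negb_forall_in => /exists_inP[j jS]; rewrite negb_imply => /andP[eij fij].
  by exists i, j.
have gx := sep t1 tt1 cS mS i j iS jS fij.
have c1 : sclosed e S t1 by apply: cS; rewrite tt1 leqnn.
have dis : g ^+ 2 / 2 <= dissip (M t1) S (x t1) (x t1.+1).
  apply: le_trans (dissip_ge_pair (rev_ge0 t1) (x t1) _ iS _ (rev_rel_ge1 eij)); last first.
    by apply: rev_rel_ge1; apply: rev_rel_refl.
  rewrite ler_pM2r ?invr_gt0 // -[leRHS]real_normK ?num_real // ler_sqr ?nnegrE //.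
have v1 : var q S (x t1) <= var q S (x t).
  apply: rev_var_noninc_iter => // v /andP[tv vt]; apply: cS.
  by rewrite tv ltnW.
have U1 : rev_energy S t1.+1 <= (1 - s * delta / 2) * rev_energy S t.
  apply: rev_energy_drop => //; have := rev_var_step c1; lra.
have cost : split_cost rev_energy (fun _ => GRing.exp kappa) f S t m
      <= r.+2%:R * kappa ^+ (m - r.+1) * rev_energy S t.
  rewrite /split_cost -mulr_sumr -mulrA mulrCA; apply: ler_wpM2l.
    by rewrite exprn_ge0 // (le_trans ler01).
  rewrite mulr_natl -[X in _ *+ X]card_ord -sumr_const; apply: ler_sum => a _.
  by apply: rev_energyS; apply/subsetP => k; rewrite inE => /andP[].
have k0 : 0 <= kappa ^+ m by rewrite exprn_ge0 // (le_trans ler01).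
have Ut0 : 0 <= rev_energy S t by exact: powR_ge0.
have := ler_wpM2l k0 U1; have := ler_wpM2r Ut0 num.
rewrite mulrDl mul1r.
move: cost; move: (split_cost _ _ _ _ _ _) => c; move: (kappa ^+ m) => k.
move: (_ * kappa ^+ _) => k1; move: (rev_energy S t) (rev_energy S t1.+1) => u v.
by move=> h1 h2 h3; move: (s * delta / 2) h2 h3 => z h2 h3; lra.
Qed.

Lemma rev_drops S t m : sclosed e S t -> (scomp e S t <= m)%N -> (m <= Mx)%N ->
  sactive e x eps S t -> drops_at_once rev_energy (fun _ => GRing.exp kappa) S t m
  \/ drops_after_split e rev_energy (fun _ => GRing.exp kappa) S t m.
Proof.
move=> cS sm mM act; have /sactiveP[i0 [j0 [i0S j0S _ h0]]] := act.
have S0 : S != set0 by apply/set0Pn; exists i0.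
have D0 : 0 < diam (x t) S.
  by apply: lt_le_trans eps_gt0 (le_trans h0 _); apply: dist_le_diam.
have cS' : sclosed (fun=> e t) S 0 by exact: cS.
have Ulem := card_uncrossed (@rev_rel_refl t) (@rev_rel_sym t) (x t) cS' S0.
set D := diam (x t) S in D0 *.
pose U := [set j : 'I_#|S|.-1 | ~~ crossed (e t) (x t) S j].
have Um : (#|U| < m)%N by apply: leq_trans Ulem sm.
have jS (j : 'I_#|S|.-1) : (j.+1 < #|S|)%N by exact: ord_predS_lt.
have k1 k : 1 <= kappa ^+ k by apply: exprn_ege1.
have k0 k : 0 <= kappa ^+ k by apply: le_trans ler01 (k1 k).
have kS k : kappa ^+ k.+1 * (s / (64 * K)) = 3 * kappa ^+ k.
  rewrite exprS kappaE; field.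
  by rewrite !gt_eqF.
have Dsum : D = \sum_(j < #|S|.-1 | crossed (e t) (x t) S j) gap (x t) S j
     + \sum_(j in U) gap (x t) S j.
  rewrite /D diam_sum_gap (bigID (fun j : 'I_#|S|.-1 => crossed (e t) (x t) S j)) /=.
  by congr (_ + _); apply: eq_bigl => j; rewrite inE.
have [big|small] := lerP (D / 2)
    (\sum_(j < #|S|.-1 | crossed (e t) (x t) S j) gap (x t) S j).
  left; have := dissip_large cS (leq_trans sm mM) big => hd.
  have m1 : (0 < m)%N by nat_lia.
  have U1 : rev_energy S t.+1 <= (1 - s * (16 * K)^-1 / 2) * rev_energy S t.
    apply: rev_energy_drop.
      rewrite invr_ge0 invf_le1; last by have := K_gt0; lra.
      by have := K_ge1; lra.
    have := rev_var_step cS; rewrite mulrBl mul1r.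
    suff : (16 * K)^-1 * var q S (x t) <= dissip (M t) S (x t) (x t.+1) by lra.
    by rewrite mulrC ler_pdivrMr ?mulr_gt0 // mulrC.
  rewrite /drops_at_once -lerBrDr -mulrBr.
  have Ut0 : 0 <= rev_energy S t by exact: powR_ge0.
  apply: (@le_trans _ _ (kappa ^+ m * (s * (16 * K)^-1 / 2 * rev_energy S t))); last first.
    by apply: ler_wpM2l => //; move: U1; rewrite mulrBl mul1r; lra.
  rewrite mulrA ler_peMl //.
  have -> : s * (16 * K)^-1 / 2 = 2 * (s / (64 * K)) by field; rewrite gt_eqF.
  rewrite mulrCA -(prednK m1) kS.
  by have := k1 m.-1; lra.
right.
have Ubig : D / 2 <= \sum_(j in U) gap (x t) S j by lra.
have U1 : (0 < #|U|)%N.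
  rewrite card_gt0; apply/negP => /eqP U0; move: Ubig; rewrite U0 big_set0.
  by move: D0; lra.
have Mx1 : (1 < Mx)%N by nat_lia.
have qQ : \sum_(i in S) q i <= Q.
  apply: le_trans (q_sum Mx1); rewrite [leRHS](bigID (mem S)) /= lerDl.
  by apply: sumr_ge0 => i _; apply: ltW.
have vD : var q S (x t) <= Q * D ^+ 2 by apply: var_le_diam.
have D2 : 0 <= D ^+ 2 by exact: sqr_ge0.
have hull r (f : T -> 'I_r.+2) lo hi g :
    (forall i, i \in S -> lo (f i) <= x t i <= hi (f i)) ->
    (forall a b : 'I_r.+2, (a < b)%N -> hi a + g <= lo b) ->
    forall u, (t <= u)%N -> (forall v, (t <= v <= u)%N -> sclosed e S v) ->
     (forall v, (t <= v < u)%N -> monochrome e f S v) ->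
     forall i j, i \in S -> j \in S -> f i != f j -> g <= `|x u i - x u j|.
  move=> h1 h2 u tu cu mu_ i j iS jS' fij.
  have P0 u' i' j' : 0 <= P u' i' j' by rewrite P_E divr_ge0 ?rev_ge0 // ltW.
  have P1 u' i' : \sum_j' P u' i' j' = 1.
    under eq_bigr do rewrite P_E.
    by rewrite -mulr_suml M_sum divff // gt_eqF.
  have sp k : k \in S -> lo (f k) <= x u k <= hi (f k).
    move=> kS'; apply: (split_separated P0 P1 x_step tu _ mu_ h1 kS').
    by move=> v tv; apply: cu; nat_lia.
  have /andP[a1 a2] := sp i iS; have /andP[b1 b2] := sp j jS'.
  case: (ltngtP (f i) (f j)) => [lt|lt|eq]; last by move: fij; rewrite (val_inj eq) eqxx.
    rewrite distrC; apply: le_trans (ler_norm _); have := h2 _ _ lt; lra.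
  apply: le_trans (ler_norm _); have := h2 _ _ lt; lra.
(* Splitting at the largest gap alone would cost a factor [mu ^+ 2]; when that gap is
   below [D / 4], splitting at two gaps leaves [m - 2] components in each part. *)
have [/exists_inP[j jU jbig]|nbig] := boolP [exists j in U, D / 4 <= gap (x t) S j].
  have nc : ~~ crossed (e t) (x t) S j by move: jU; rewrite inE.
  have gj0 := uncrossed_gap_gt0 (@rev_rel_refl t) (jS j) nc.
  pose f i : 'I_2 := if x t i <= ostat (x t) S j then ord0 else ord_max.
  (* The fraction [(32 * K)^-1] comes from [D ^+ 2 / 32 <= g ^+ 2 / 2] for the gap [g], against a
     variance of at most [Q * D ^+ 2 <= K * D ^+ 2]. *)
  apply: (@rev_split _ f _ _ _ (gap (x t) S j) (32 * K)^-1).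
  - move=> a; apply/set0Pn.
    have [i iS xi] := ostat_mem (x t) (ltnW (jS j)).
    have [k kS' xk] := ostat_mem (x t) (jS j).
    have [a0|a0] := eqVneq a ord0.
      by exists i; rewrite inE iS /f xi lexx a0.
    exists k; rewrite inE kS' /f xk leNgt -subr_gt0 gj0 /=.
    by apply/eqP/val_inj => /=; case: a a0 => [[|[|]]].
  - exact: ltW.
  - exact: inv32_in01.
  - apply: (@le_trans _ _ (D ^+ 2 / 32)); last exact: sqr_quarter_le.
    rewrite mulrC ler_pdivrMr; last by rewrite mulr_gt0.
    have -> : D ^+ 2 / 32 * (32 * K) = K * D ^+ 2 by field.
    by apply: le_trans vD _; apply: ler_wpM2r => //; apply: Q_le.
  - have -> : s * (32 * K)^-1 / 2 = s / (64 * K) by field; rewrite gt_eqF.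
    have -> : m = (m - 1).+1 by nat_lia.
    rewrite kS subn1 /=; have := k1 (m - 1)%N; rewrite subn1; lra.
  - pose hi (a : 'I_2) := if a == ord0 then ostat (x t) S j else ostat (x t) S #|S|.-1.
    pose lo (a : 'I_2) := if a == ord0 then ostat (x t) S 0 else ostat (x t) S j.+1.
    apply: (@hull _ f lo hi) => [i iS|a b].
      rewrite /lo /hi /f; have [h|h] := lerP (x t i) (ostat (x t) S j).
        by rewrite eqxx ostat_first.
      rewrite /= ostat_last // andbT.
      by have := ostat_dichotomy (x t) iS (jS j); rewrite leNgt h.
    rewrite /lo /hi; case: a => [[|[|a]] ?]; case: b => [[|[|b]] ?] //= _.
    by rewrite /gap addrC subrK.
have Umu : (#|U| <= mu)%N.
  case/orP: mu_ge => h; last by nat_lia.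
  apply: leq_trans h; apply: leq_trans (max_card _) _; rewrite card_ord.
  by apply: leq_trans (leq_pred _) (max_card _).
have D20 : 0 < D / 2 by lra.
have [j1 j1U j1big] := exists_ge_average D20 Ubig Umu.
(* The gap of [j1] is below [D / 4], so the other uncrossed gaps still add up to [D / 4] and a
   second gap can be chosen among them. *)
have rest : D / 4 <= \sum_(j in U :\ j1) gap (x t) S j.
  move: Ubig; rewrite (big_setD1 j1) //=.
  move: nbig; rewrite negb_exists_in => /forall_inP/(_ j1 j1U); rewrite -ltNge; lra.
have D40 : 0 < D / 4 by lra.
have Umu' : (#|U :\ j1| <= mu)%N.
  by apply: leq_trans Umu; apply: subset_leq_card; apply: subD1set.
have [j2 j2U j2big] := exists_ge_average D40 rest Umu'.
have [ja [jb [jaU jbU jab jabig jbbig]]] : exists ja jb : 'I_#|S|.-1,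
    [/\ ja \in U, jb \in U, (ja < jb)%N, D / 4 <= mu%:R * gap (x t) S ja
      & D / 4 <= mu%:R * gap (x t) S jb].
  move: j2U; rewrite in_setD1 => /andP[j21 j2U].
  have j1big' : D / 4 <= mu%:R * gap (x t) S j1 by lra.
  case: (ltngtP j1 j2) => [lt|lt|eq].
  - by exists j1, j2.
  - by exists j2, j1.
  - by move: j21; rewrite (val_inj eq) eqxx.
have mu0 : (0 < mu)%N by nat_lia.
have muR : 0 < mu%:R :> R by rewrite ltr0n.
have m2 : (2 < m)%N.
  suff : (1 < #|U|)%N by nat_lia.
  apply/card_gt1P; exists ja, jb; split=> //.
  by apply/eqP => eq; move: jab; rewrite eq ltnn.
have gpos j : j \in U -> 0 < gap (x t) S j.
  by rewrite inE => nc; apply: (uncrossed_gap_gt0 (@rev_rel_refl t) (jS j) nc).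
pose X := ostat (x t) S.
have Xmid : X ja.+1 <= X jb by apply: ostat_homo => //; apply: ltnW.
pose f i : 'I_3 := if x t i <= X ja then ord0 else
                   if x t i <= X jb then inord 1 else ord_max.
pose hi (a : 'I_3) := if val a is k.+1 then (if k is _.+1 then X #|S|.-1 else X jb) else X ja.
pose lo (a : 'I_3) := if val a is k.+1 then (if k is _.+1 then X jb.+1 else X ja.+1) else X 0%N.
have ha := gpos _ jaU; have hb := gpos _ jbU.
have Xa : X ja < X ja.+1 by rewrite -subr_gt0.
have Xb : X jb < X jb.+1 by rewrite -subr_gt0.
(* Gaps of order [D / mu] give only a fraction of order [K ^- 2], by [Q * mu ^+ 2 <= K ^+ 2]. The
   second factor [kappa] saved by having three parts makes up for the second [K]. *)
apply: (@rev_split _ f _ _ _ (D / (4 * mu%:R)) (32 * K ^+ 2)^-1).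
- move=> a; apply/set0Pn.
  have [i iS xi] := ostat_mem (x t) (ltnW (jS ja)).
  have [k kS' xk] := ostat_mem (x t) (ltnW (jS jb)).
  have [l lS xl] := ostat_mem (x t) (jS jb).
  rewrite -/X in xi xk xl.
  case: a => [[|[|[|//]]] a3].
  + by exists i; rewrite inE iS /f xi lexx.
  + exists k; rewrite inE kS' /f xk leNgt (lt_le_trans Xa Xmid) lexx /=.
    by apply/eqP/val_inj => /=; rewrite inordK.
  + exists l; rewrite inE lS /f xl leNgt (lt_trans (lt_le_trans Xa Xmid) Xb) /=.
    by rewrite leNgt Xb.
- by rewrite divr_ge0 ?mulr_ge0 ?ltW.
- by apply: inv32_in01; apply: exprn_ege1.
- rewrite mulrC ler_pdivrMr; last by rewrite mulr_gt0 ?exprn_gt0.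
  apply: le_trans vD _; rewrite expr_div_n exprMn.
  have -> : D ^+ 2 / (4 ^+ 2 * mu%:R ^+ 2) / 2 * (32 * K ^+ 2) = (K ^+ 2 / mu%:R ^+ 2) * D ^+ 2.
    by field; rewrite gt_eqF.
  by apply: ler_wpM2r => //; rewrite ler_pdivlMr ?exprn_gt0 // Qmu_le.
- have -> : m = (m - 2).+2 by nat_lia.
  have -> : ((m - 2).+2 - 2)%N = (m - 2)%N by nat_lia.
  have -> : s * (32 * K ^+ 2)^-1 / 2 = s / (64 * K) * K^-1 by field; rewrite gt_eqF.
  rewrite [kappa ^+ _.+2 * _]mulrA kS exprS.
  have -> : 3 * (kappa * kappa ^+ (m - 2)) / K = 576 / s * kappa ^+ (m - 2).
    by rewrite kappaE; field; rewrite !gt_eqF.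
  have s576 : 576 <= 576 / s by rewrite ler_pdivlMr // ler_piMr.
  have k2 := k1 (m - 2)%N; apply: (@le_trans _ _ (576 * kappa ^+ (m - 2))).
    exact: triple_succ_le.
  by apply: ler_wpM2r.
- have ga : D / (4 * mu%:R) <= gap (x t) S ja.
    exact: quarter_div_le.
  have gb : D / (4 * mu%:R) <= gap (x t) S jb.
    exact: quarter_div_le.
  have g0 : 0 <= D / (4 * mu%:R) by rewrite divr_ge0 ?mulr_ge0 ?ltW.
  apply: (@hull _ f lo hi) => [i iS|a b].
    have da := ostat_dichotomy (x t) iS (jS ja).
    have db := ostat_dichotomy (x t) iS (jS jb).
    rewrite /lo /hi /f; have [h|h] := lerP (x t i) (X ja).
      by rewrite /= ostat_first.
    rewrite leNgt h /= in da; have [h'|h'] := lerP (x t i) (X jb).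
      by rewrite /= inordK //= da.
    by rewrite leNgt h' /= in db; rewrite /= db ostat_last.
  have [l1 l2 l3] := three_levels ga gb Xmid g0.
  by rewrite /lo /hi; case: a => [[|[|[|a]]] ?]; case: b => [[|[|[|b]]] ?] //=.
Qed.

Theorem rev_scount_le m N S t : (m <= Mx)%N ->
  (forall u, (t <= u < t + N)%N -> sclosed e S u) ->
  (forall u, (t <= u < t + N)%N -> (scomp e S u <= m)%N) ->
  (scount e x eps S t N)%:R <= kappa ^+ m * rev_energy S t.
Proof.
move=> mM cS sS.
apply: (@scount_le _ _ _ x eps rev_rel_sym rev_energy (fun _ => GRing.exp kappa) Mx) => //.
- by move=> *; apply: powR_ge0.
- by move=> _ k; rewrite exprn_ge0 // (le_trans ler01).
- move=> A u cA; have e2 : 0 < eps ^+ 2 by rewrite exprn_gt0.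
  apply: ge0_ler_powR; rewrite ?nnegrE ?rev_energy_arg_ge0 //; first exact: ltW.
  by rewrite ler_pM2r ?invr_gt0 // ler_pM2l // rev_var_noninc.
- by move=> A u _; apply: rev_energy_active.
- exact: rev_drops.
Qed.

End ReversibleCount.

(** * Cheeger's inequality *)

Section Cheeger.
Variables (R : realType) (T : finType) (C : {set T}) (a : T -> T -> R) (h Dg : R).
Hypothesis a_sym : forall i j, a i j = a j i.
Hypothesis a_ge0 : forall i j, 0 <= a i j.
Hypothesis a_row : forall i, i \in C -> \sum_(j in C) a i j <= Dg.
Hypothesis h_gt0 : 0 < h.
Hypothesis Dg_gt0 : 0 < Dg.
Hypothesis expansion : forall S : {set T}, S \subset C -> S != set0 ->
  (2 * #|S| <= #|C|)%N -> h * #|S|%:R <= \sum_(i in S) \sum_(j in C :\: S) a i j.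

(** A discrete coarea inequality, by peeling off layers: lowering [f] by its least positive value
    [al] on the support [S] gains [al] on every edge of the cut of [S], in both orientations, and
    shrinks the support. *)
Lemma total_variation_ge (f : T -> R) : (forall i, 0 <= f i) ->
  (2 * #|[set i in C | (0 < f i)%R]| <= #|C|)%N ->
  2 * h * \sum_(i in C) f i <= \sum_(i in C) \sum_(j in C) a i j * `|f i - f j|.
Proof.
move: {2}#|_|.+1 (ltnSn #|[set i in C | 0 < f i]|) => N.
elim: N f => // N IH f; set S := [set i in C | 0 < f i] => SN f0 SC.
have [S0|S0] := eqVneq S set0.
  rewrite big1 ?mulr0.
    by apply: sumr_ge0 => i _; apply: sumr_ge0 => j _; rewrite mulr_ge0.
  move=> i iC; apply/eqP; rewrite eq_le f0 andbT leNgt.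
  by apply/negP => fi; move: (in_set0 i); rewrite -S0 inE iC fi.
have [i1 i1S] := set0Pn _ S0.
case: (arg_minP f i1S) => i0 i0S' i0min; set al := f i0.
have i0S : i0 \in S := i0S'.
have al0 : 0 < al by move: i0S; rewrite inE => /andP[].
have SsubC : S \subset C by apply/subsetP => i; rewrite inE => /andP[].
pose f' i := if i \in S then f i - al else 0.
have f'0 i : 0 <= f' i by rewrite /f'; case: ifP => // iS; rewrite subr_ge0; apply: i0min.
have sub' : [set i in C | 0 < f' i] \subset S :\ i0.
  apply/subsetP => i; rewrite in_setD1 in_set /f' => /andP[iC].
  case: ifP => [iS|]; last by rewrite ltxx.
  by rewrite subr_gt0 => lt; rewrite andbT; apply: contraTneq lt => ->; rewrite ltxx.
have card' : (#|[set i in C | (0 < f' i)%R]| < #|S|)%N.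
  by apply: leq_ltn_trans (subset_leq_card sub') _; rewrite [leqRHS](cardsD1 i0) i0S.
have SC' : (2 * #|[set i in C | (0 < f' i)%R]| <= #|C|)%N.
  by apply: leq_trans SC; rewrite leq_mul2l ltnW.
have IHf' := IH f' (leq_trans card' SN) f'0 SC'.
pose cut i j : R := ((i \in S) && (j \notin S))%:R.
have pw i j : i \in C -> j \in C ->
    a i j * `|f' i - f' j| + al * (a i j * cut i j + a i j * cut j i)
      <= a i j * `|f i - f j|.
  move=> iC jC; rewrite -mulrDr mulrCA -mulrDr; apply: ler_wpM2l => //.
  have fz k : k \in C -> k \notin S -> f k = 0.
    move=> kC; rewrite inE kC /= -leNgt => fk; apply/eqP; by rewrite eq_le fk f0.
  rewrite /cut /f'; case: (boolP (i \in S)) => iS; case: (boolP (j \in S)) => jS /=.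
  - by rewrite addr0 mulr0 addr0; have -> : f i - al - (f j - al) = f i - f j by ring.
  - have fi : al <= f i by apply: i0min.
    rewrite (fz j) // !subr0 addr0 mulr1 !ger0_norm ?subr_ge0 //; lra.
  - have fj : al <= f j by apply: i0min.
    rewrite (fz i) // !sub0r !normrN add0r mulr1 !ger0_norm ?subr_ge0 //; lra.
  - by rewrite !subr0 normr0 addr0 mulr0 add0r.
have le1 : \sum_(i in C) \sum_(j in C)
      (a i j * `|f' i - f' j| + al * (a i j * cut i j + a i j * cut j i))
    <= \sum_(i in C) \sum_(j in C) a i j * `|f i - f j|.
  by apply: ler_sum => i iC; apply: ler_sum => j jC; apply: pw.
apply: le_trans le1.
have cutE : \sum_(i in C) \sum_(j in C) a i j * cut i j
    = \sum_(i in S) \sum_(j in C :\: S) a i j.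
  rewrite (big_setID S) /= (setIidPr SsubC) [X in _ + X]big1 ?addr0; last first.
    move=> i; rewrite inE => /andP[iS _]; apply: big1 => j _.
    by rewrite /cut (negbTE iS) mulr0.
  apply: eq_bigr => i iS; rewrite [LHS]big_mkcond [RHS]big_mkcond /=.
  apply: eq_bigr => j _; rewrite inE /cut iS /=.
  by case: (j \in S); case: (j \in C); rewrite /= ?mulr1 ?mulr0.
have cutE' : \sum_(i in C) \sum_(j in C) a i j * cut j i
    = \sum_(i in S) \sum_(j in C :\: S) a i j.
  rewrite -cutE exchange_big; apply: eq_bigr => i _; apply: eq_bigr => j _.
  by rewrite a_sym.
have split : \sum_(i in C) \sum_(j in C)
      (a i j * `|f' i - f' j| + al * (a i j * cut i j + a i j * cut j i))
   = \sum_(i in C) \sum_(j in C) a i j * `|f' i - f' j|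
     + 2 * al * \sum_(i in S) \sum_(j in C :\: S) a i j.
  under eq_bigr do rewrite big_split /=.
  rewrite big_split /=; congr (_ + _).
  under eq_bigr do rewrite -mulr_sumr big_split /=.
  rewrite -mulr_sumr big_split /= cutE cutE'; ring.
rewrite split.
have sumf : \sum_(i in C) f i = \sum_(i in C) f' i + al * #|S|%:R.
  rewrite (big_setID S) [in RHS](big_setID S) /= (setIidPr SsubC).
  rewrite [X in _ + X = _]big1 ?addr0; last first.
    move=> i; rewrite !inE => /andP[]; case: (i \in C) => //= nf _.
    by apply/eqP; rewrite eq_le f0 andbT leNgt.
  rewrite [X in _ + X + _]big1 ?addr0; last first.
    by move=> i; rewrite inE /f' => /andP[/negbTE ->].
  rewrite mulr_natr -sumr_const -big_split /=; apply: eq_bigr => i iS.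
  by rewrite /f' iS subrK.
have ex := expansion SsubC S0 SC.
have := ler_wpM2l (ltW al0) ex; rewrite sumf.
by move: IHf'; lra.
Qed.

(** The coarea bound is applied to the squares of [y]; the factors [y i + y j] in their differences
    are controlled by the row sums. *)
Lemma dirichlet_ge_half (y : T -> R) : (forall i, 0 <= y i) ->
  (2 * #|[set i in C | (0 < y i)%R]| <= #|C|)%N ->
  h ^+ 2 * \sum_(i in C) y i ^+ 2
    <= Dg * \sum_(i in C) \sum_(j in C) a i j * (y i - y j) ^+ 2.
Proof.
move=> y0 ysup; pose Y := \sum_(i in C) y i ^+ 2.
pose E := \sum_(i in C) \sum_(j in C) a i j * (y i - y j) ^+ 2.
rewrite -/Y -/E.
have tv : 2 * h * Y <= \sum_(i in C) \sum_(j in C) a i j * `|y i ^+ 2 - y j ^+ 2|.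
  apply: (@total_variation_ge (fun i => y i ^+ 2)) => [i|]; first exact: sqr_ge0.
  have -> : [set i in C | 0 < y i ^+ 2] = [set i in C | 0 < y i].
    by apply/setP => i; rewrite !inE exprn_even_gt0 //= lt0r y0 andbT.
  by [].
have lam0 : 0 < 2 * Dg / h by rewrite divr_gt0 ?mulr_gt0.
(* AM-GM: [2 |u^2 - v^2| <= l (u - v)^2 + (u + v)^2 / l] with [l = 2 Dg / h]. *)
have amgm : 2 * \sum_(i in C) \sum_(j in C) a i j * `|y i ^+ 2 - y j ^+ 2| <=
    2 * Dg / h * E +
    (2 * Dg / h)^-1 * \sum_(i in C) \sum_(j in C) a i j * (y i + y j) ^+ 2.
  rewrite /E !mulr_sumr -big_split /=; apply: ler_sum => i _.
  rewrite !mulr_sumr -big_split /=; apply: ler_sum => j _.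
  rewrite mulrCA [X in _ <= X + _]mulrCA [X in _ <= _ + X]mulrCA -mulrDr.
  apply: ler_wpM2l => //; rewrite subr_sqr normrM [`|y i + y j|]ger0_norm ?addr_ge0 //.
  rewrite -[(y i - y j) ^+ 2]real_normK ?num_real //.
  move: (2 * Dg / h) lam0 (`|_|) (y i + y j) => l l0 u v.
  have li0 : 0 < l^-1 by rewrite invr_gt0.
  have := mulr_ge0 (ltW li0) (sqr_ge0 (l * u - v)).
  have -> : l^-1 * (l * u - v) ^+ 2 = l * u ^+ 2 - 2 * (u * v) + l^-1 * v ^+ 2.
    by field; rewrite gt_eqF.
  lra.
have plus : \sum_(i in C) \sum_(j in C) a i j * (y i + y j) ^+ 2 <= 4 * Dg * Y.
  have rowb : \sum_(i in C) \sum_(j in C) a i j * y i ^+ 2 <= Dg * Y.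
    rewrite /Y mulr_sumr; apply: ler_sum => i iC; rewrite -mulr_suml.
    by apply: ler_wpM2r; [apply: sqr_ge0 | apply: a_row].
  have colb : \sum_(i in C) \sum_(j in C) a i j * y j ^+ 2 <= Dg * Y.
    rewrite exchange_big; apply: le_trans rowb; apply: ler_sum => i _.
    by apply: ler_sum => j _; rewrite a_sym.
  apply: (@le_trans _ _ (2 * \sum_(i in C) \sum_(j in C) a i j * y i ^+ 2 +
       2 * \sum_(i in C) \sum_(j in C) a i j * y j ^+ 2)); last by lra.
  rewrite !mulr_sumr -big_split /=; apply: ler_sum => i _.
  rewrite !mulr_sumr -big_split /=; apply: ler_sum => j _.
  rewrite !(mulrCA 2) -mulrDr; apply: ler_wpM2l => //.
  have := sqr_ge0 (y i - y j); lra.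
have : (2 * Dg / h)^-1 * \sum_(i in C) \sum_(j in C) a i j * (y i + y j) ^+ 2
    <= 2 * h * Y.
  have -> : 2 * h * Y = (2 * Dg / h)^-1 * (4 * Dg * Y).
    by field; rewrite !gt_eqF.
  by apply: ler_wpM2l => //; rewrite invr_ge0 ltW.
move=> last; have : 2 * h * Y <= 2 * Dg / h * E by lra.
have -> : 2 * Dg / h * E = 2 * (Dg * E) / h by ring.
rewrite ler_pdivlMr //.
have -> : 2 * h * Y * h = 2 * (h ^+ 2 * Y) by ring.
by lra.
Qed.

(** [c] is a median, so the positive and the negative part of [x - c] are each supported on at most
    half of [C]. *)
Lemma cheeger (x : T -> R) : exists c,
  h ^+ 2 * \sum_(i in C) (x i - c) ^+ 2
    <= Dg * \sum_(i in C) \sum_(j in C) a i j * (x i - x j) ^+ 2.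
Proof.
have [->|C0] := eqVneq C set0.
  by exists 0; rewrite !big_set0 !mulr0.
have pC : (0 < #|C|)%N by rewrite card_gt0.
have hC : (#|C|./2 < #|C|)%N by lia.
pose c := ostat x C #|C|./2; exists c.
pose yp i := Num.max (x i - c) 0; pose ym i := Num.max (c - x i) 0.
have yp0 i : 0 <= yp i by rewrite le_max lexx orbT.
have ym0 i : 0 <= ym i by rewrite le_max lexx orbT.
have low : (#|[set i in C | (x i < c)%R]| <= #|C|./2)%N by rewrite -ostat_ge.
have high : (#|C|./2 < #|[set i in C | (x i <= c)%R]|)%N by rewrite -ostat_le.
have cp := @dirichlet_ge_half yp yp0; have cm := @dirichlet_ge_half ym ym0.
have setp : [set i in C | 0 < yp i] = C :\: [set i in C | x i <= c].
  apply/setP => i; rewrite !inE /yp lt_max ltxx orbF subr_gt0 ltNge.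
  by case: (i \in C); rewrite /= ?andbT ?andbF.
have setm : [set i in C | 0 < ym i] = [set i in C | x i < c].
  by apply/setP => i; rewrite !inE /ym lt_max ltxx orbF subr_gt0.
have {}cp := cp _; have {}cm := cm _.
rewrite setm in cm; rewrite setp in cp.
have sub : [set i in C | x i <= c] \subset C by apply/subsetP => i; rewrite inE => /andP[].
have {}cm := cm ltac:(lia).
have {}cp := cp ltac:(rewrite cardsD (setIidPr sub); lia).
have -> : \sum_(i in C) (x i - c) ^+ 2
    = \sum_(i in C) yp i ^+ 2 + \sum_(i in C) ym i ^+ 2.
  rewrite -big_split; apply: eq_bigr => i _; rewrite /= /yp /ym !maxEle.
  by case: ifP => h1; case: ifP => h2; nra.
rewrite mulrDr; apply: le_trans (lerD cp cm) _; rewrite -mulrDr.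
apply: ler_wpM2l; first exact: ltW.
rewrite -big_split; apply: ler_sum => i _; rewrite -big_split; apply: ler_sum => j _ /=.
rewrite -mulrDr; apply: ler_wpM2l => //; rewrite /yp /ym.
have -> : x i - x j = (x i - c) - (x j - c) by ring.
have -> : c - x i = - (x i - c) by ring.
have -> : c - x j = - (x j - c) by ring.
(* Taking positive and negative parts contracts: the squared differences of the two parts add up to
   at most [(u - v) ^+ 2]. *)
move: (x i - c) (x j - c) => u v.
rewrite !maxEle; case: (lerP u 0) => u0; case: (lerP v 0) => v0;
  case: (lerP (- u) 0) => u1; case: (lerP (- v) 0) => v1; nra.
Qed.

End Cheeger.

(** Cauchy-Schwarz, read off from the nonnegative variance about the mean [c]. *)
Lemma sqr_sum_le (R : realType) (I : finType) (A : {set I}) (f : I -> R) :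
  (\sum_(i in A) f i) ^+ 2 <= #|A|%:R * \sum_(i in A) f i ^+ 2.
Proof.
set s := \sum_(i in A) f i; set s2 := \sum_(i in A) _.
have [A0|A0] := eqVneq A set0.
  by rewrite /s /s2 A0 !big_set0 expr0n mulr0.
have n0 : 0 < #|A|%:R :> R by rewrite ltr0n card_gt0.
pose c := s / #|A|%:R.
have : 0 <= \sum_(i in A) (f i - c) ^+ 2 by apply: sumr_ge0 => i _; apply: sqr_ge0.
have -> : \sum_(i in A) (f i - c) ^+ 2 = s2 - s ^+ 2 / #|A|%:R.
  have -> : s2 - s ^+ 2 / #|A|%:R = s2 - 2 * c * s + c ^+ 2 * #|A|%:R.
    by rewrite /c; field; rewrite gt_eqF.
  rewrite /s2 /s mulr_natr -sumr_const mulr_sumr -sumrB -big_split.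
  by apply: eq_bigr => i _ /=; ring.
by rewrite subr_ge0 ler_pdivrMr // mulrC.
Qed.

(** * Reversible systems: trajectories of matrices and the bound *)

Section Translation.
Variables (R : realType) (n : nat) (P : nat -> 'M[R]_n) (x0 : 'cV[R]_n) (eps : R).

Definition weights t i j : R := P t i j.
Definition state t (i : 'I_n) : R := traj P x0 t i 0.

Lemma state_step t i : state t.+1 i = \sum_j weights t i j * state t j.
Proof. by rewrite /state /= mxE. Qed.

Lemma count_activeE N :
  count_active eps P x0 N = scount (support_rel weights) state eps setT 0 N.
Proof.
rewrite /count_active /scount add0n big_mkord; apply: eq_bigr => t _; congr nat_of_bool.
apply/existsP/sactiveP => [[i /existsP[j /andP[h1 h2]]]|[i [j [_ _ h1 h2]]]].
  by exists i, j; rewrite !inE.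
by exists i; apply/existsP; exists j; apply/andP.
Qed.

Lemma scomp_setT t : scomp (support_rel weights) setT t = ncomp (P t).
Proof.
by apply: eq_card => i; rewrite !inE andbC.
Qed.

Lemma sclosed_setT t : sclosed (support_rel weights) setT t.
Proof. by apply/sclosedP => i j _ _; rewrite inE. Qed.

End Translation.

Lemma count_active_ord0 (R : realType) n (P : nat -> 'M[R]_n) (x0 : 'cV[R]_n) eps N :
  n = 0%N -> count_active eps P x0 N = 0%N.
Proof.
move=> n0; apply: big1 => t _; apply/eqP; rewrite eqb0; apply/existsP => -[[i lt_i] _].
by rewrite n0 in lt_i.
Qed.

(** The argument is at most [eps^-1 ^+ 3], the factor [2] being absorbed by one [eps^-1]; the
    exponent cancels the logarithm and leaves [expR (3 * 192)]. *)
Lemma energy_final (R : realType) (eps V : R) : 0 < eps -> 192 <= ln eps^-1 ->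
  0 <= V <= 1 -> (2 * V / eps ^+ 2) `^ (192 / ln eps^-1) <= expR 576.
Proof.
move=> e0 L /andP[V0 V1]; set l := ln eps^-1 in L *.
have l0 : 0 < l by lra.
have ie : eps^-1 = expR l by rewrite lnK // posrE invr_gt0.
have ie2 : 2 <= eps^-1 by rewrite ie; apply: le_trans (expR_ge1Dx _); lra.
have -> : expR 576 = ((eps^-1) ^+ 3) `^ (192 / l) :> R.
  rewrite ie -expRM_natl -expRM; congr expR; field; exact: lt0r_neq0.
have s0 : 0 <= 192 / l by rewrite divr_ge0 // ltW.
apply: ge0_ler_powR => //; rewrite ?nnegrE.
- by rewrite divr_ge0 ?mulr_ge0 ?exprn_ge0 // ltW.
- by rewrite exprn_ge0 // invr_ge0 ltW.
- rewrite -exprVn [leRHS]exprS; apply: ler_wpM2r; first by rewrite exprn_ge0 // invr_ge0 ltW.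
  lra.
Qed.

(** With the exponent [s = 192 / l], [kappa] is exactly the base of the claimed bound. *)
Lemma ratio_kappa (R : realType) (K l : R) : 0 < l -> 192 * K / (192 / l) = K * l.
Proof. by move=> l0; field; rewrite gt_eqF. Qed.

Lemma ratio_in01 (R : realType) (c l : R) : 0 < c -> c <= l -> 0 < c / l <= 1.
Proof.
move=> c0 cl; have l0 := lt_le_trans c0 cl.
by rewrite divr_gt0 //= ler_pdivrMr // mul1r.
Qed.

Lemma wvarE (R : realType) n (q : 'I_n -> R) (x : 'cV[R]_n) :
  wvar_le1 q x -> var q setT (fun i => x i 0) <= 1.
Proof.
have E (F : 'I_n -> R) : \sum_(i in setT) F i = \sum_i F i.
  by apply: eq_bigl => i; rewrite inE.
by rewrite /var /moment !E.
Qed.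

Section RevTheorem.
Variables (R : realType) (T : finType) (M : T -> T -> R) (q : T -> R) (x y : T -> R).
Hypothesis M_ge0 : forall i j, 0 <= M i j.
Variable e : rel T.
Hypothesis e_refl : reflexive e.
Hypothesis e_ge1 : forall i j, e i j -> 1 <= M i j.
Hypothesis q_ge1 : forall i, 1 <= q i.

(** A crossed gap is covered by the range of the neighbourhood of the lower endpoint of a crossing
    edge. A squared range is at most twice the local dissipation, and Cauchy-Schwarz over [S] gives
    the factor [#|S|]. *)
Lemma dissip_ge_diam (S : {set T}) : sclosed (fun=> e) S 0 ->
  diam x S / 2 <= \sum_(j < #|S|.-1 | crossed e x S j) gap x S j ->
  diam x S ^+ 2 <= 8 * #|S|%:R * dissip M S x y.
Proof.
move=> cS; pose N k := [set j | e k j]; set D := diam x S => half.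
have Nk k : k \in N k by rewrite inE.
have cov : \sum_(j < #|S|.-1 | crossed e x S j) gap x S j <= \sum_(k in S) diam x (N k).
  apply: (@sum_gap_crossed _ _ e _ _ T (mem S) (fun k => ostat x (N k) 0)
            (fun k => ostat x (N k) #|N k|.-1)) => [k _|j jS /crossedP].
    exact: le_trans (ostat_first x (Nk k)) (ostat_last x (Nk k)).
  move=> [i [k [iS kS eik xi xk]]]; exists i => //.
  rewrite (le_trans (ostat_first x (Nk i)) xi) /= (le_trans xk) //.
  by apply: ostat_last; rewrite inE.
have rows : \sum_(k in S) diam x (N k) ^+ 2 <= 2 * dissip M S x y.
  rewrite /dissip mulr_sumr; apply: ler_sum => k kS.
  have N0 : N k != set0 by apply/set0Pn; exists k.
  have [i [j [iN jN ->]]] := diam_attained x N0.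
  rewrite inE in iN; rewrite inE in jN.
  have := @moment_ge_pair _ _ (M k) (y k) x j i (M_ge0 k) (e_ge1 jN) (e_ge1 iN).
  lra.
have cs := sqr_sum_le S (fun k => diam x (N k)).
have D0 : 0 <= D by exact: diam_ge0.
have le : D / 2 <= \sum_(k in S) diam x (N k) by apply: le_trans half cov.
have : (D / 2) ^+ 2 <= (\sum_(k in S) diam x (N k)) ^+ 2.
  by rewrite ler_sqr ?nnegrE //; lra.
rewrite expr_div_n => h1.
have := ler_wpM2l (ler0n R #|S|) rows; move: h1 cs; lra.
Qed.

End RevTheorem.

Theorem rev_count (R : realType) (eps : R) n m rho (q : 'I_n -> R)
    (P : nat -> 'M[R]_n) (x0 : 'cV[R]_n) N :
  0 < eps -> 192 <= ln eps^-1 -> 0 < rho -> rho <= 2^-1 ->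
  (forall t, admissible rho (P t)) ->
  (forall t, exists M : 'M[R]_n, rev_mat rho q M (P t)) ->
  (forall t, (ncomp (P t) <= m)%N) -> wvar_le1 q x0 ->
  (count_active eps P x0 N)%:R <= expR 576 * ((n ^ 2)%:R / rho * ln eps^-1) ^+ m.
Proof.
move=> e0 L rho0 rho12 adm /boolp.choice[M revM] comps wv.
set l := ln eps^-1 in L *; have l0 : 0 < l by lra.
have [n0|n0] := posnP n.
  rewrite count_active_ord0 // mulr_ge0 ?expR_ge0 // exprn_ge0 //.
  by rewrite mulr_ge0 ?divr_ge0 ?ler0n ?(ltW l0) ?(ltW rho0).
pose x := state P x0; pose W := weights P.
have Msym t i j : M t i j = M t j i.
  by have [<- _ _ _ _] := revM t; rewrite mxE; have [-> _ _ _ _] := revM t.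
have M01 t i j : M t i j = 0 \/ 1 <= M t i j by have [_ h _ _ _] := revM t.
have Mge0 t i j : 0 <= M t i j by case: (M01 t i j) => [->|/(le_trans ler01)].
have Msum t i : \sum_j M t i j = q i by have [_ _ h _ _] := revM t.
have PE t i j : W t i j = M t i j / q i by have [_ _ _ _ h] := revM t; exact: h.
have Mrefl t i : M t i i != 0.
  have [_ _ _ h _] := adm t; have := h i; have := PE t i i; rewrite /W /weights => ->.
  by apply: contraNN => /eqP ->; rewrite mul0r.
have q1 i : 1 <= q i.
  rewrite -(Msum 0%N i) (bigD1 i) //=.
  have : 1 <= M 0%N i i by case: (M01 0%N i i) (Mrefl 0%N i) => // ->; rewrite eqxx.
  move=> h; apply: le_trans h _; rewrite lerDl; exact: sumr_ge0.
have qr i : q i <= rho^-1 by have [_ _ _ h _] := revM 0%N.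
pose K : R := (n ^ 2)%:R / rho.
have ri : 2 <= rho^-1 by rewrite -[2]invrK lef_pV2 ?posrE ?invr_gt0.
have nR : 1 <= n%:R :> R by rewrite ler1n.
have n2 : 1 <= (n ^ 2)%:R :> R by rewrite ler1n expn_gt0 n0.
have K1 : 1 <= K by rewrite /K; nra.
have sum_q (S : {set 'I_n}) : \sum_(i in S) q i <= n%:R / rho.
  apply: (@le_trans _ _ (\sum_(i in S) rho^-1)); first by apply: ler_sum.
  rewrite sumr_const -[leLHS]mulr_natl; apply: ler_wpM2r; first by lra.
  by rewrite ler_nat -[leqRHS]card_ord max_card.
have s01 := ratio_in01 (ltr0n R 192) L.
(* The choice is [Q = n / rho] and [mu = n]. Then [Q * mu ^+ 2 = n ^+ 3 / rho], which is within
   [K ^+ 2] for [K = n ^+ 2 / rho]. *)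
have h := @rev_scount_le R 'I_n W (fun t i j => M t i j) q x eps q1 Msym M01 Mrefl Msum PE
   (@state_step _ _ P x0) e0 (192 / l) K (n%:R / rho) m n s01 K1.
rewrite count_activeE -/W -/x mulrC.
have := h _ _ _ _ _ (192 * K / (192 / l)) erefl m N setT 0%N (leqnn m).
rewrite ratio_kappa // => hh.
apply: le_trans (hh _ _ _ _ _ _ _) _.
- move=> S t cS _ half.
  have e1 i j : support_rel W t i j -> 1 <= M t i j.
    exact: (@rev_rel_ge1 _ _ W (fun t i j => M t i j) q q1 M01 PE).
  have er : reflexive (support_rel W t).
    exact: (@rev_rel_refl _ _ W (fun t i j => M t i j) q q1 Mrefl PE).
  have := @dissip_ge_diam _ _ (M t) (x t) (x t.+1) (Mge0 t) _ er e1 S cS half.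
  have := var_le_diam q1 (x t) (sum_q S).
  have d0 := dissip_ge0 (Mge0 t) S (x t) (x t.+1).
  have S_n : #|S|%:R <= n%:R :> R by rewrite ler_nat -[leqRHS]card_ord max_card.
  have nr0 : 0 <= n%:R / rho by rewrite divr_ge0 ?ler0n // ltW.
  move=> h1 h2; apply: le_trans h1 _.
  apply: le_trans (ler_wpM2l nr0 h2) _.
  apply: (@le_trans _ _ (n%:R / rho * (8 * n%:R * dissip (M t) S (x t) (x t.+1)))).
    apply: ler_wpM2l => //; apply: ler_wpM2r => //; lra.
  have -> : n%:R / rho * (8 * n%:R * dissip (M t) S (x t) (x t.+1))
      = 8 * K * dissip (M t) S (x t) (x t.+1) by rewrite /K natrX; ring.
  apply: ler_wpM2r => //; lra.
- by move=> _; have := sum_q setT; rewrite (eq_bigl predT) // => i; rewrite inE.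
- by move=> _; rewrite /K natrX; apply: ler_wpM2r; [lra | nra].
- move=> _; rewrite /K natrX.
  have -> : n%:R / rho * n%:R ^+ 2 = n%:R ^+ 3 / rho by ring.
  have -> : (n%:R ^+ 2 / rho) ^+ 2 = n%:R ^+ 3 / rho * (n%:R / rho) by ring.
  rewrite ler_peMr //; last by nra.
  by rewrite divr_ge0 ?exprn_ge0 ?ler0n // ltW.
- by rewrite card_ord leqnn.
- by move=> u _; apply: sclosed_setT.
- by move=> u _; rewrite scomp_setT.
apply: ler_wpM2l; first by rewrite exprn_ge0 // mulr_ge0 //; lra.
apply: energy_final => //; rewrite var_ge0 //=.
exact: wvarE wv.
Qed.

(** * Expanding systems *)

Section RegularDissipation.
Variables (R : realType) (T : finType) (M : T -> T -> R) (d h : R) (x y : T -> R).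
Hypothesis M_01 : forall i j, M i j = 0 \/ M i j = 1.
Hypothesis M_sym : forall i j, M i j = M j i.
Hypothesis M_refl : forall i, M i i = 1.
Hypothesis M_sum : forall i, \sum_j M i j = d.
Hypothesis d_ge1 : 1 <= d.
Hypothesis y_E : forall k, y k = \sum_j M k j / d * x j.

Let d_gt0 : 0 < d. Proof. exact: lt_le_trans ltr01 d_ge1. Qed.

Lemma regular_ge0 i j : 0 <= M i j.
Proof. by case: (M_01 i j) => ->. Qed.

Lemma var_const_ge_pair (C : {set T}) i j : i \in C -> j \in C ->
  d * (x i - x j) ^+ 2 / 2 <= var (fun=> d) C x.
Proof.
move=> iC jC; rewrite /var; set c := (X in moment _ C x X).
have -> : moment (fun=> d) C x c = d * \sum_k (k \in C)%:R * (x k - c) ^+ 2.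
  rewrite /moment big_mkcond mulr_sumr; apply: eq_bigr => k _.
  by case: (k \in C); rewrite ?mul1r // mul0r mulr0.
rewrite -mulrA ler_pM2l //; apply: (@moment_ge_pair _ _ (fun k => (k \in C)%:R)) => //=.
- by rewrite iC.
- by rewrite jC.
Qed.

(** By the self-loop, [(x k - y k) ^+ 2] is one of the terms on the right, so moving the centre from
    [y k] to [x k] costs the factor [1 + d <= 2 * d]. *)
Lemma row_spread_le k :
  \sum_j M k j * (x j - x k) ^+ 2 <= 2 * d * \sum_j M k j * (x j - y k) ^+ 2.
Proof.
have dy : d * y k = \sum_j M k j * x j.
  rewrite y_E mulr_sumr; apply: eq_bigr => j _; field; exact: lt0r_neq0.
have ex c : \sum_j M k j * (x j - c) ^+ 2 =
    \sum_j M k j * x j ^+ 2 - 2 * c * (d * y k) + c ^+ 2 * d.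
  rewrite dy -(M_sum k) !mulr_sumr -sumrB -big_split; apply: eq_bigr => i _ /=; ring.
have self : (x k - y k) ^+ 2 <= \sum_j M k j * (x j - y k) ^+ 2.
  rewrite (bigD1 k) //= M_refl mul1r lerDl; apply: sumr_ge0 => j _.
  by rewrite mulr_ge0 ?sqr_ge0 ?regular_ge0.
have -> : \sum_j M k j * (x j - x k) ^+ 2
    = \sum_j M k j * (x j - y k) ^+ 2 + d * (x k - y k) ^+ 2 by rewrite !ex; ring.
have := ler_wpM2l (ltW d_gt0) self.
have S0 : 0 <= \sum_j M k j * (x j - y k) ^+ 2.
  by apply: sumr_ge0 => j _; rewrite mulr_ge0 ?sqr_ge0 ?regular_ge0.
have := ler_wpM2r S0 d_ge1; rewrite mul1r; lra.
Qed.

Lemma dirichlet_le_dissip (C : {set T}) :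
  \sum_(i in C) \sum_(j in C) M i j * (x i - x j) ^+ 2 <= 2 * d * dissip M C x y.
Proof.
rewrite /dissip mulr_sumr; apply: ler_sum => k kC.
apply: le_trans (row_spread_le k); rewrite [leRHS](bigID (mem C)) /=.
have -> : \sum_(j in C) M k j * (x k - x j) ^+ 2 = \sum_(j in C) M k j * (x j - x k) ^+ 2.
  by apply: eq_bigr => j _; ring.
by rewrite lerDl; apply: sumr_ge0 => j _; rewrite mulr_ge0 ?sqr_ge0 ?regular_ge0.
Qed.

Hypothesis h_gt0 : 0 < h.

(** The three factors [d] come from the weights in the variance, the row sums in Cheeger's
    inequality and the change of centre in [row_spread_le]. *)
Lemma expander_dissip (C : {set T}) :
  (forall S : {set T}, S \subset C -> S != set0 -> (2 * #|S| <= #|C|)%N ->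
     h * #|S|%:R <= \sum_(i in S) \sum_(j in C :\: S) M i j) ->
  h ^+ 2 * var (fun=> d) C x <= 2 * d ^+ 3 * dissip M C x y.
Proof.
move=> expn.
have row i : i \in C -> \sum_(j in C) M i j <= d.
  move=> _; rewrite -(M_sum i) [leRHS](bigID (mem C)) /= lerDl.
  by apply: sumr_ge0 => j _; apply: regular_ge0.
have [c hc] := cheeger M_sym regular_ge0 row h_gt0 d_gt0 expn x.
have vm := var_le_moment (fun=> d_ge1) C x c.
have me : moment (fun=> d) C x c = d * \sum_(i in C) (x i - c) ^+ 2.
  by rewrite /moment mulr_sumr.
have h2 : 0 <= h ^+ 2 by exact: sqr_ge0.
apply: le_trans (ler_wpM2l h2 vm) _; rewrite me mulrCA.
apply: le_trans (ler_wpM2l (ltW d_gt0) hc) _; rewrite mulrA.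
have dd : 0 <= d * d by apply: mulr_ge0; apply: ltW.
apply: le_trans (ler_wpM2l dd (dirichlet_le_dissip C)) _.
by rewrite le_eqVlt; apply/orP; left; apply/eqP; ring.
Qed.

End RegularDissipation.

Section ComponentDissipation.
Variables (R : realType) (T : finType) (e : rel T) (M : T -> T -> R) (x y : T -> R).
Hypothesis e_sym : symmetric e.

Let C r := [set j | connect e r j].
Let rts (S : {set T}) := [set r in S | roots e r].

Lemma sum_components (S : {set T}) (F : T -> R) : sclosed (fun=> e) S 0 ->
  \sum_(k in S) F k = \sum_(r in rts S) \sum_(k in C r) F k.
Proof.
move=> cS; have csym := sym_connect_sym e_sym.
rewrite (partition_big (fingraph.root e) (mem (rts S))) /=; last first.
  move=> k kS; rewrite inE roots_root // andbT.
  by apply: (sclosed_connect cS kS); apply: connect_root.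
apply: eq_bigr => r; rewrite inE => /andP[rS rr]; apply: eq_bigl => k.
rewrite inE -[connect e r k](root_connect csym) eq_sym (eqP rr).
have [eq|] := eqVneq (fingraph.root e k) r; rewrite ?andbF // andbT.
apply: (sclosed_connect cS rS); rewrite csym -eq; exact: connect_root.
Qed.

(** The covering intervals are ranges of components rather than of neighbourhoods; Cauchy-Schwarz
    over them then loses the number of components instead of the number of agents. *)
Lemma sum_gap_crossed_components (S : {set T}) : sclosed (fun=> e) S 0 ->
  \sum_(j < #|S|.-1 | crossed e x S j) gap x S j <= \sum_(r in rts S) diam x (C r).
Proof.
move=> cS; have csym := sym_connect_sym e_sym.
have rC r : r \in C r by rewrite inE.
apply: (@sum_gap_crossed _ _ e _ _ T (mem (rts S)) (fun r => ostat x (C r) 0)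
          (fun r => ostat x (C r) #|C r|.-1)) => [r _|j jS /crossedP].
  exact: le_trans (ostat_first x (rC r)) (ostat_last x (rC r)).
move=> [i [k [iS kS eik xi xk]]]; exists (fingraph.root e i).
  by rewrite !inE roots_root // andbT; apply: (sclosed_connect cS iS); apply: connect_root.
have iC : i \in C (fingraph.root e i) by rewrite inE csym connect_root.
have kC : k \in C (fingraph.root e i).
  by rewrite inE; apply: connect_trans (connect1 eik); rewrite csym connect_root.
by rewrite (le_trans (ostat_first x iC) xi) (le_trans xk (ostat_last x kC)).
Qed.

End ComponentDissipation.

Section ExpTheorem.
Variables (R : realType) (n : nat) (P : nat -> 'M[R]_n) (x0 : 'cV[R]_n).
Variables (d : nat) (h eps : R) (M : nat -> 'M[R]_n).
Hypothesis M_01 : forall t i j, M t i j = 0 \/ M t i j = 1.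
Hypothesis M_sym : forall t i j, M t i j = M t j i.
Hypothesis M_refl : forall t i, M t i i = 1.
Hypothesis M_sum : forall t i, \sum_j M t i j = d%:R.
Hypothesis P_E : forall t i j, P t i j = M t i j / d%:R.
Hypothesis d_ge1 : 1 <= d%:R :> R.
Hypothesis h_gt0 : 0 < h.
Hypothesis h_le : h <= d%:R.
Hypothesis P_cheeger : forall t, cheeger_ge h (P t).

Local Notation x := (state P x0).
Local Notation e := (support_rel (weights P)).
Local Notation dR := (d%:R : R).

Let e_M t i j : e t i j -> M t i j = 1.
Proof.
rewrite /e /support_rel /weights P_E; case: (M_01 t i j) => // ->.
by rewrite mul0r eqxx.
Qed.

Let e_sym t : symmetric (e t).
Proof. by move=> i j; rewrite /e /support_rel /weights !P_E M_sym. Qed.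

Lemma component_dissip t v : h ^+ 2 * var (fun=> dR) (Defs.comp (P t) v) (x t)
  <= 2 * dR ^+ 3 * dissip (M t) (Defs.comp (P t) v) (x t) (x t.+1).
Proof.
apply: expander_dissip => //.
- by move=> k; rewrite state_step; apply: eq_bigr => j _; rewrite /weights P_E.
move=> S SC S0 Sc; have S1 : (0 < #|S|)%N by rewrite card_gt0.
apply: le_trans (P_cheeger SC S1 Sc) _.
rewrite -sum1_card natr_sum pair_big_dep /= big_mkcond [leRHS]big_mkcond /=.
apply: ler_sum => -[i j] _ /=; rewrite !inE /=.
case: (i \in S) => //=; case: (j \in S) => //=.
by case: ifP => [/andP[-> /e_M ->]|_] //=; case: ifP => // _; case: (M_01 t i j) => ->.
Qed.

(** The constant is a product: total weight [d * n], then [4 * m] for passing from the diameter of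
    [S] to those of its components, then [4 * d ^+ 2 / h ^+ 2] for the dissipation in each
    component. *)
Lemma exp_dissip_large m S t : sclosed e S t -> (scomp e S t <= m)%N ->
  diam (x t) S / 2 <= \sum_(j < #|S|.-1 | crossed (e t) (x t) S j) gap (x t) S j ->
  var (fun=> dR) S (x t)
    <= 16 * ((d ^ 3 * m * n)%:R / h ^+ 2) * dissip (M t) S (x t) (x t.+1).
Proof.
move=> cS sm half; pose A := [set r in S | roots (e t) r].
set dis := dissip _ _ _ _.
have d0 : 0 < dR by apply: lt_le_trans d_ge1.
have h2 : 0 < h ^+ 2 by rewrite exprn_gt0.
have cS' : sclosed (fun=> e t) S 0 by exact: cS.
have disE : dis = \sum_(r in A) dissip (M t) (Defs.comp (P t) r) (x t) (x t.+1).
  exact: (sum_components (@e_sym t) _ cS').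
have le1 : diam (x t) S / 2 <= \sum_(r in A) diam (x t) (Defs.comp (P t) r) :=
  le_trans half (sum_gap_crossed_components (x t) (@e_sym t) cS').
have cs := sqr_sum_le A (fun r => diam (x t) (Defs.comp (P t) r)).
have D0 := diam_ge0 (x t) S.
have dA : h ^+ 2 * \sum_(r in A) diam (x t) (Defs.comp (P t) r) ^+ 2 <= 4 * dR ^+ 2 * dis.
  rewrite disE !mulr_sumr; apply: ler_sum => r _.
  have C0 : Defs.comp (P t) r != set0 by apply/set0Pn; exists r; rewrite inE connect0.
  have [i [j [iC jC ->]]] := diam_attained (x t) C0.
  have := component_dissip t r; have := var_const_ge_pair (x t) d_ge1 jC iC.
  move=> v1 v2; have v3 := le_trans (ler_wpM2l (ltW h2) v1) v2.
  rewrite -(ler_pM2l d0); move: v3; set z := dissip _ _ _ _; set w := (_ - _) ^+ 2.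
  have -> : h ^+ 2 * (dR * w / 2) = dR * (h ^+ 2 * w) / 2 by ring.
  have -> : dR * (4 * dR ^+ 2 * z) = 2 * (2 * dR ^+ 3 * z) by ring.
  lra.
have sumq : \sum_(i in S) dR <= dR * n%:R.
  rewrite sumr_const -[leLHS]mulr_natr; apply: ler_wpM2l; first exact: ltW.
  by rewrite ler_nat -[leqRHS]card_ord max_card.
have vD := var_le_diam (fun=> d_ge1) (x t) sumq.
set D := diam (x t) S in le1 vD D0 *.
set Sg := \sum_(r in A) _ in le1 cs; set Sg2 := \sum_(r in A) _ in cs dA.
have DS : D ^+ 2 <= 4 * (m%:R * Sg2).
  have : (D / 2) ^+ 2 <= Sg ^+ 2 by rewrite ler_sqr ?nnegrE; lra.
  have : #|A|%:R * Sg2 <= m%:R * Sg2.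
    apply: ler_wpM2r; last by rewrite ler_nat.
    by apply: sumr_ge0 => r _; apply: sqr_ge0.
  rewrite expr_div_n; lra.
have dis0 : 0 <= dis.
  by apply: dissip_ge0 => i j; case: (M_01 t i j) => ->.
apply: le_trans vD _.
have dn : 0 <= dR * n%:R by rewrite mulr_ge0 ?ler0n.
apply: le_trans (ler_wpM2l dn DS) _.
have S2 : Sg2 <= 4 * dR ^+ 2 * dis / h ^+ 2 by rewrite ler_pdivlMr // mulrC.
apply: (@le_trans _ _ (dR * n%:R * (4 * (m%:R * (4 * dR ^+ 2 * dis / h ^+ 2))))).
  by apply: ler_wpM2l => //; apply: ler_wpM2l => //; apply: ler_wpM2l.
by rewrite !natrM le_eqVlt; apply/orP; left; apply/eqP; ring.
Qed.

(** On a single component Cheeger's inequality compares variance and dissipation directly; bypassing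
    the diameter removes the factor [n]. *)
Lemma exp_dissip_connected S t : sclosed e S t -> (scomp e S t <= 1)%N ->
  var (fun=> dR) S (x t) <= 16 * (dR ^+ 3 / h ^+ 2) * dissip (M t) S (x t) (x t.+1).
Proof.
move=> cS s1; have dis0 A : 0 <= dissip (M t) A (x t) (x t.+1).
  by apply: dissip_ge0 => i j; case: (M_01 t i j) => ->.
have h2 : 0 < h ^+ 2 by rewrite exprn_gt0.
have K0 : 0 <= dR ^+ 3 / h ^+ 2 by rewrite divr_ge0 ?exprn_ge0 ?ler0n ?(ltW h_gt0).
have [->|S0] := eqVneq S set0.
  by rewrite /var /moment !big_set0 mulr_ge0 // mulr_ge0.
have [i iS] := set0Pn _ S0; have csym := sym_connect_sym (@e_sym t).
have -> : S = Defs.comp (P t) i.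
  apply/setP => j; rewrite inE; apply/idP/idP => [jS|]; last exact: (sclosed_connect cS iS).
  rewrite -[connect _ i j](root_connect csym); apply/eqP.
  have rS k : k \in S -> fingraph.root (e t) k \in [set r in S | roots (e t) r].
    move=> kS; rewrite inE roots_root // andbT.
    exact: (sclosed_connect cS kS (connect_root _ _)).
  by have /card_le1P := s1 => /(_ _ (rS i iS)) => one; have := rS j jS; rewrite one => /eqP.
have := component_dissip t i; rewrite [leLHS]mulrC -ler_pdivlMr // => hv.
apply: le_trans hv _; have := dis0 (Defs.comp (P t) i).
have -> (z : R) : 2 * dR ^+ 3 * z / h ^+ 2 = 2 * (dR ^+ 3 / h ^+ 2) * z by ring.
by move=> dz; apply: ler_wpM2r => //; apply: ler_wpM2r => //; rewrite ler_nat.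
Qed.

Hypothesis eps_gt0 : 0 < eps.
Hypothesis eps_small : 192 <= ln eps^-1.
Hypothesis x0_var : wvar_le1 (fun=> dR) x0.
Hypothesis n_gt0 : (0 < n)%N.

Let l := ln eps^-1.
Let l_gt0 : 0 < l. Proof. by apply: lt_le_trans eps_small. Qed.

Let M_ge1 t i j : M t i j = 0 \/ 1 <= M t i j.
Proof. by case: (M_01 t i j) => ->; [left | right]. Qed.

Let M_neq0 t i : M t i i != 0. Proof. by rewrite M_refl oner_eq0. Qed.

Let scount_bound (K Q : R) Mx mu := @rev_scount_le R 'I_n (weights P)
  (fun t i j => M t i j) (fun=> dR) x eps (fun=> d_ge1) M_sym M_ge1 M_neq0 M_sum P_E
  (@state_step _ _ P x0) eps_gt0 (192 / l) K Q Mx mu (ratio_in01 (ltr0n R 192) eps_small).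

Let energy_bound : rev_energy (fun=> dR) x eps (192 / l) setT 0 <= expR 576.
Proof.
apply: energy_final => //; rewrite var_ge0 //=; exact: wvarE.
Qed.

Lemma exp_count m N : (forall t, (ncomp (P t) <= m)%N) ->
  (count_active eps P x0 N)%:R
    <= expR 576 * ((d ^ 3 * m * n)%:R / h ^+ 2 * ln eps^-1) ^+ m.
Proof.
move=> comps; rewrite count_activeE mulrC; pose K : R := (d ^ 3 * m * n)%:R / h ^+ 2.
have m_gt0 : (0 < m)%N.
  apply: leq_trans (comps 0%N); rewrite -scomp_setT; apply: scomp_gt0 => //.
    exact: sclosed_setT.
  by apply/set0Pn; exists (Ordinal n_gt0); rewrite inE.
have m1 : 1 <= m%:R :> R by rewrite ler1n.
have n1 : 1 <= n%:R :> R by rewrite ler1n.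
have h2 : 0 < h ^+ 2 by rewrite exprn_gt0.
have hd : h ^+ 2 <= dR ^+ 2 by rewrite ler_sqr ?nnegrE ?ler0n // ltW.
have d_gt0 : 0 < dR by apply: lt_le_trans d_ge1.
have KE : K = dR ^+ 2 / h ^+ 2 * (dR * m%:R * n%:R) by rewrite /K !natrM; ring.
have ratio1 : 1 <= dR ^+ 2 / h ^+ 2 by rewrite ler_pdivlMr // mul1r.
have Kdmn : dR * m%:R * n%:R <= K.
  by rewrite KE ler_peMl // !mulr_ge0 ?ler0n.
have dm1 : 1 <= dR * m%:R by rewrite -[leLHS]mulr1 ler_pM.
have dn0 : 0 <= dR * n%:R by rewrite mulr_ge0 ?ler0n.
have K1 : 1 <= K by apply: le_trans Kdmn; rewrite -[leLHS]mulr1 ler_pM.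
have QK : dR * n%:R <= K.
  by apply: le_trans Kdmn; rewrite mulrAC ler_peMr.
have := @scount_bound K (dR * n%:R) m m K1 _ _ _ _ _ (192 * K / (192 / l)) erefl m N setT 0%N
  (leqnn m).
rewrite ratio_kappa // => hh; apply: le_trans (hh _ _ _ _ _ _ _) _.
- by move=> S t cS sm half; apply: exp_dissip_large.
- by move=> _; rewrite sumr_const card_ord -[leLHS]mulr_natr.
- by [].
- move=> _; apply: (@le_trans _ _ ((dR * m%:R * n%:R) ^+ 2)).
    have -> : (dR * m%:R * n%:R) ^+ 2 = dR * n%:R * m%:R ^+ 2 * (dR * n%:R) by ring.
    rewrite ler_peMr //; first by rewrite mulr_ge0 // sqr_ge0.
    by rewrite -[leLHS]mulr1 ler_pM.
  by rewrite ler_sqr ?nnegrE // ?(le_trans ler01 K1) // !mulr_ge0 ?ler0n.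
- by rewrite leqnn orbT.
- by move=> u _; apply: sclosed_setT.
- by move=> u _; rewrite scomp_setT.
apply: ler_wpM2l energy_bound; rewrite exprn_ge0 // mulr_ge0 ?(ltW l_gt0) //.
exact: le_trans ler01 K1.
Qed.

Lemma exp_count_connected N : (forall t, (ncomp (P t) <= 1)%N) ->
  (count_active eps P x0 N)%:R <= expR 576 * (d ^ 3)%:R / h ^+ 2 * ln eps^-1.
Proof.
move=> comps; rewrite count_activeE; pose K : R := dR ^+ 3 / h ^+ 2.
have h2 : 0 < h ^+ 2 by rewrite exprn_gt0.
have hd : h ^+ 2 <= dR ^+ 2 by rewrite ler_sqr ?nnegrE ?ler0n // ltW.
have K1 : 1 <= K.
  rewrite /K ler_pdivlMr // mul1r; apply: le_trans hd _.
  by rewrite [leRHS]exprS ler_peMl // sqr_ge0.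
(* For [Mx = 1] the premise [1 < Mx] is false, so [Q = 0] will do and [K] stays free of [n]. *)
have := @scount_bound K 0 1 1 K1 _ _ _ _ _ (192 * K / (192 / l)) erefl 1 N setT 0%N
  (leqnn 1).
rewrite ratio_kappa // expr1 => hh; apply: le_trans (hh _ _ _ _ _ _ _) _ => //.
- by move=> S t cS sm half; apply: exp_dissip_connected.
- by rewrite leqnn orbT.
- by move=> u _; apply: sclosed_setT.
- by move=> u _; rewrite scomp_setT.
have -> : expR 576 * (d ^ 3)%:R / h ^+ 2 * ln eps^-1 = K * l * expR 576.
  by rewrite /K natrX -/l; ring.
apply: ler_wpM2l energy_bound; rewrite mulr_ge0 ?(ltW l_gt0) //.
exact: le_trans ler01 K1.
Qed.

End ExpTheorem.

Theorem exp_bound (R : realType) (eps : R) n m d rho h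
    (P : nat -> 'M[R]_n) (x0 : 'cV[R]_n) N :
  0 < eps -> 192 <= ln eps^-1 -> 0 < h ->
  (forall t, admissible rho (P t)) ->
  (forall t, exists M : 'M[R]_n, rev_mat rho (fun _ => d%:R) M (P t) /\
     (forall i j, M i j = 0 \/ M i j = 1)) ->
  (forall t, cheeger_ge h (P t)) ->
  (forall t, (ncomp (P t) <= m)%N) ->
  wvar_le1 (fun _ => d%:R) x0 ->
  (count_active eps P x0 N)%:R
      <= expR 576 * ((d ^ 3 * m * n)%:R / h ^+ 2 * ln eps^-1) ^+ m
  /\ ((m <= 1)%N -> (count_active eps P x0 N)%:R
        <= expR 576 * (d ^ 3)%:R / h ^+ 2 * ln eps^-1).
Proof.
move=> e0 L h0 adm /boolp.choice[M revM] chg comps wv.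
have l0 : 0 <= ln eps^-1 by apply: le_trans L.
have pos0 : 0 <= expR 576 * ((d ^ 3 * m * n)%:R / h ^+ 2 * ln eps^-1) ^+ m.
  rewrite mulr_ge0 ?expR_ge0 // exprn_ge0 // mulr_ge0 // divr_ge0 ?ler0n //.
  exact: sqr_ge0.
have pos1 : 0 <= expR 576 * (d ^ 3)%:R / h ^+ 2 * ln eps^-1.
  by rewrite mulr_ge0 // divr_ge0 ?sqr_ge0 // mulr_ge0 ?expR_ge0 ?ler0n.
have [n0|n0] := posnP n; first by rewrite count_active_ord0.
have M01 t i j : M t i j = 0 \/ M t i j = 1 by have [_ hM] := revM t.
have Msym t i j : M t i j = M t j i.
  by have [[<- _ _ _ _] _] := revM t; rewrite mxE; have [[-> _ _ _ _] _] := revM t.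
have PE t i j : P t i j = M t i j / d%:R by have [[_ _ _ _ hM] _] := revM t.
have Mrefl t i : M t i i = 1.
  have [_ _ _ hr _] := adm t; have := hr i; rewrite PE.
  by case: (M01 t i i) => // ->; rewrite mul0r eqxx.
have Msum t i : \sum_j M t i j = d%:R by have [[_ _ hM _ _] _] := revM t.
have d1 : 1 <= d%:R :> R.
  rewrite -(Msum 0%N (Ordinal n0)) (bigD1 (Ordinal n0)) //= Mrefl lerDl.
  by apply: sumr_ge0 => j _; case: (M01 0%N (Ordinal n0) j) => ->.
have [hd|hd] := lerP h d%:R.
  have hyps := @exp_count R n P x0 d h eps M M01 Msym Mrefl Msum PE d1 h0 hd chg e0 L wv n0.
  split; first exact: hyps.
  move=> m1; apply: (@exp_count_connected R n P x0 d h eps M) => // t.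
  exact: leq_trans (comps t) m1.
(* A component with two vertices contains singletons of boundary at most [d < h]. *)
suff -> : count_active eps P x0 N = 0%N by [].
apply: big1 => t _; apply/eqP; rewrite eqb0; apply/existsP => -[i /existsP[j]].
move=> /andP[eij far]; have ij : i != j.
  apply/eqP => ij; move: far; rewrite ij subrr normr0 leNgt => /negP; exact.
have iC : i \in Defs.comp (P t) i by rewrite inE connect0.
have jC : j \in Defs.comp (P t) i by rewrite inE connect1.
have := chg t i [set i] _ _ _; rewrite sub1set iC cards1 => /(_ isT isT) hS.
have two : (2 * 1 <= #|Defs.comp (P t) i|)%N.
  by rewrite muln1; apply/card_gt1P; exists i, j.
have := hS two; rewrite mulr1 => hle.
suff : h <= d%:R by rewrite leNgt hd.
apply: le_trans hle _; apply: (@le_trans _ _ #|[set k | P t i k != 0]|%:R).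
  rewrite ler_nat; apply: leq_trans (leq_imset_card (fun k => (i, k)) _).
  apply: subset_leq_card; apply/subsetP => -[a b]; rewrite !inE /=.
  by move=> /and3P[/eqP -> _ ab]; apply/imsetP; exists b; rewrite ?inE.
rewrite -sum1_card natr_sum big_mkcond -(Msum t i); apply: ler_sum => k _.
by rewrite inE PE; case: (M01 t i k) => ->; rewrite ?mul0r ?eqxx //; case: ifP.
Qed.

(** * General systems *)

Section Twist.
Variables (R : realType) (T : finType) (P : T -> T -> R) (rho lam : R).
Hypothesis P_ge0 : forall i j, 0 <= P i j.
Hypothesis P_sum1 : forall i, \sum_j P i j = 1.
Hypothesis P_ge : forall i j, P i j != 0 -> rho <= P i j.
Hypothesis P_refl : forall i, P i i != 0.
Hypothesis P_sym : forall i j, (P i j != 0) = (P j i != 0).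
Hypothesis rho_gt0 : 0 < rho.
Hypothesis lam_gt0 : 0 < lam.
Hypothesis lam_le : lam <= rho.

Let e : rel T := fun i j => P i j != 0.

(* The weights make the functional nonincreasing: within a block the [j]-th order
   statistic is pulled down by [rho] times the depth of the previous one. *)
Definition rank_sum (x : T -> R) (S : {set T}) : R :=
  \sum_(j < #|S|) lam ^+ (#|S|.-1 - j) * ostat x S j.

Section Step.
Variables (x y : T -> R) (S : {set T}).
Hypothesis yE : forall i, y i = \sum_j P i j * x j.
Hypothesis S_closed : sclosed (fun=> e) S 0.
Hypothesis S_gt0 : (0 < #|S|)%N.

Local Notation X := (ostat x S).
Local Notation p := #|S|.

(* [block_top k] is the last order statistic of the block of rank [p.-1 - k]. *)
Fixpoint block_top k : R :=
  if k is k'.+1 then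
    if crossed e x S (p.-1 - k) then block_top k' else X (p.-1 - k)
  else X p.-1.

Let Z j := block_top (p.-1 - j).

Let Z_rec j : (j.+1 < p)%N -> Z j = if crossed e x S j then Z j.+1 else X j.
Proof.
move=> jp; rewrite /Z; have -> : (p.-1 - j = (p.-1 - j.+1).+1)%N by nat_lia.
by rewrite /=; have -> : (p.-1 - (p.-1 - j.+1).+1 = j)%N by nat_lia.
Qed.

Let Z_last : Z p.-1 = X p.-1. Proof. by rewrite /Z subnn. Qed.

Let down_ind (Q : nat -> Prop) : Q p.-1 ->
  (forall j, (j.+1 < p)%N -> Q j.+1 -> Q j) -> forall j, (j < p)%N -> Q j.
Proof.
move=> Q0 QS j jp; have -> : j = (p.-1 - (p.-1 - j))%N by nat_lia.
have : (p.-1 - j <= p.-1)%N by nat_lia.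
elim: (p.-1 - j)%N => [|k IH] kp; first by rewrite subn0.
apply: QS; first by nat_lia.
by have -> : (p.-1 - k.+1).+1 = (p.-1 - k)%N by [nat_lia]; apply: IH; nat_lia.
Qed.

Let Z_ge j : (j < p)%N -> X j <= Z j.
Proof.
move: j; apply: down_ind => [|j jp IH]; first by rewrite Z_last.
rewrite Z_rec //; case: ifP => // _; apply: le_trans IH.
by apply: ostat_homo.
Qed.

Let Z_closed j i k : (j < p)%N -> i \in S -> x i <= Z j -> e i k -> x k <= Z j.
Proof.
move=> jp; move: j jp i k.
apply: (@down_ind (fun j => forall i k, i \in S -> x i <= Z j -> e i k -> x k <= Z j)).
  move=> i k iS _ eik; rewrite Z_last; apply: ostat_last.
  by move/sclosedP: S_closed => /(_ i k iS eik).
move=> j jp IH i k iS; rewrite Z_rec //; case: ifP => [_|/negbT nc]; first exact: IH.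
move=> xi eik; have kS : k \in S by move/sclosedP: S_closed => /(_ i k iS eik).
have /orP[//|xk] := ostat_dichotomy x kS jp.
by case/negP: nc; apply/crossedP; exists i, k.
Qed.

Let z j := Z j - X j.

Let z_ge0 j : (j < p)%N -> 0 <= z j.
Proof. by move=> jp; rewrite subr_ge0 Z_ge. Qed.

Let y_le i c : (forall j, e i j -> x j <= c) -> y i <= c.
Proof.
move=> h; rewrite yE -[c]mul1r -(P_sum1 i) mulr_suml; apply: ler_sum => j _.
have [->|nz] := eqVneq (P i j) 0; first by rewrite !mul0r.
by apply: ler_wpM2l => //; apply: h.
Qed.

Let y_le_pulled i k a c : e i k -> x k <= a -> a <= c ->
  (forall j, e i j -> x j <= c) -> y i <= rho * a + (1 - rho) * c.
Proof.
move=> eik xk ac h; rewrite yE (bigD1 k) //=.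
have rest : \sum_(j | j != k) P i j * x j <= (1 - P i k) * c.
  have -> : 1 - P i k = \sum_(j | j != k) P i j.
    by rewrite -(P_sum1 i) (bigD1 k) //= addrAC subrr add0r.
  rewrite mulr_suml; apply: ler_sum => j _.
  have [->|nz] := eqVneq (P i j) 0; first by rewrite !mul0r.
  by apply: ler_wpM2l => //; apply: h.
have := ler_wpM2l (P_ge0 i k) xk; have Pr := P_ge eik.
have : 0 <= (P i k - rho) * (c - a) by rewrite mulr_ge0 ?subr_ge0.
move: rest; move: (\sum_(_ | _) _) (P i k * x k) => u v; nra.
Qed.

Let Y_le_Z j : (j < p)%N -> ostat y S j <= Z j.
Proof.
move=> jp; rewrite ostat_le //.
have : (j < #|[set i in S | (x i <= X j)%R]|)%N by rewrite -ostat_le.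
move=> h; apply: leq_trans h _; apply: subset_leq_card; apply/subsetP => i.
rewrite !inE => /andP[iS xi]; rewrite iS; apply: y_le => k.
by apply: Z_closed => //; apply: le_trans xi (Z_ge jp).
Qed.

(** At least [j.+1] agents lie at or below [X j] and are held down by their own loops. The upper
    endpoint of the crossing edge is pulled down by its neighbour and supplies one more, unless a
    tie already does. *)
Let Y_le_pulled j : (j.+1 < p)%N -> crossed e x S j ->
  ostat y S j.+1 <= rho * X j + (1 - rho) * Z j.
Proof.
move=> jp cj; have jp' := ltnW jp; rewrite ostat_le //.
have base i : i \in S -> x i <= X j -> y i <= rho * X j + (1 - rho) * Z j.
  move=> iS xi; apply: (@y_le_pulled i i) => //; [exact: P_refl|exact: Z_ge|].
  by move=> k; apply: Z_closed => //; apply: le_trans xi (Z_ge jp').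
have [eqX|ltX] := leP (X j.+1) (X j).
  have : (j.+1 < #|[set i in S | (x i <= X j.+1)%R]|)%N by rewrite -ostat_le.
  move=> h; apply: leq_trans h _; apply: subset_leq_card; apply/subsetP => i.
  by rewrite !inE => /andP[iS xi]; rewrite iS base // (le_trans xi).
have /crossedP[i [k [iS kS eik xi xk]]] := cj.
have : (j < #|[set i in S | (x i <= X j)%R]|)%N by rewrite -ostat_le.
move=> h; have kn : k \notin [set i in S | x i <= X j].
  by rewrite inE kS /= -ltNge (lt_le_trans ltX).
apply: (@leq_trans #|k |: [set i in S | (x i <= X j)%R]|); first by rewrite cardsU1 kn.
apply: subset_leq_card; apply/subsetP => i'; rewrite !inE => /orP[/eqP ->|/andP[iS' xi']].
  rewrite kS; apply: (@y_le_pulled k i) => //; first by rewrite /e P_sym.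
    exact: Z_ge.
  move=> k'; apply: Z_closed => //; apply: (Z_closed jp' iS _ eik).
  exact: le_trans xi (Z_ge jp').
by rewrite iS' base.
Qed.

(** With [z j] the distance from [X j] to the top of its block, rank [j] may rise by [z j], while
    rank [j.+1] ends at least [rho * z j] below its block top. The weights of the two ranks have
    ratio [lam], so the loss exceeds the gain by a multiple of [(rho - lam) * z j], and [z j] is at
    least the crossed gap. *)
Lemma rank_sum_step : rank_sum y S <= rank_sum x S -
  \sum_(j < p.-1 | crossed e x S j) (rho - lam) * lam ^+ (p.-2 - j) * gap x S j.
Proof.
have reindex (F : nat -> R) : \sum_(j < p) F j = F 0%N + \sum_(j < p.-1) F j.+1.
  by rewrite -(big_mkord xpredT F) -(prednK S_gt0) big_ltn // big_add1 big_mkord.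
have lastsum (F : nat -> R) : \sum_(j < p) F j = \sum_(j < p.-1) F j + F p.-1.
  by move: S_gt0; case: #|S| => // k _; rewrite big_ord_recr.
have w0 k : 0 <= lam ^+ k by rewrite exprn_ge0 // ltW.
have step (j : 'I_p.-1) : lam ^+ (p.-1 - j.+1) * ostat y S j.+1
    <= lam ^+ (p.-1 - j.+1) * (Z j.+1 - rho * z j).
  apply: ler_wpM2l => //; have jp := ord_predS_lt j.
  have := Z_rec jp; case: (boolP (crossed e x S j)) => [cj Zj|nc Zj].
    by apply: le_trans (Y_le_pulled jp cj) _; rewrite /z -Zj; lra.
  by rewrite /z Zj subrr mulr0 subr0; apply: Y_le_Z.
have bound : rank_sum y S <= \sum_(j < p) lam ^+ (p.-1 - j) * Z j
    - \sum_(j < p.-1) lam ^+ (p.-1 - j.+1) * (rho * z j).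
  rewrite /rank_sum (reindex (fun j => lam ^+ (p.-1 - j) * ostat y S j)).
  rewrite (reindex (fun j => lam ^+ (p.-1 - j) * Z j)) -addrA -sumrB; apply: lerD.
    by apply: ler_wpM2l => //; apply: Y_le_Z.
  by apply: ler_sum => j _; apply: le_trans (step j) _; rewrite mulrBr.
apply: le_trans bound _.
have -> : \sum_(j < p) lam ^+ (p.-1 - j) * Z j
    = rank_sum x S + \sum_(j < p.-1) lam ^+ (p.-1 - j) * z j.
  have -> : \sum_(j < p) lam ^+ (p.-1 - j) * Z j
      = rank_sum x S + \sum_(j < p) lam ^+ (p.-1 - j) * z j.
    rewrite /rank_sum -big_split; apply: eq_bigr => j _ /=; rewrite /z; ring.
  rewrite (lastsum (fun j => lam ^+ (p.-1 - j) * z j)).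
  by rewrite {2}/z Z_last subrr mulr0 addr0.
rewrite -addrA lerD2l -sumrB -sumrN big_mkcond [leRHS]big_mkcond; apply: ler_sum => j _ /=.
have jp := ord_predS_lt j.
have -> : (p.-1 - j = (p.-2 - j).+1)%N by nat_lia.
have -> : (p.-1 - j.+1 = p.-2 - j)%N by nat_lia.
have -> : lam ^+ (p.-2 - j).+1 * z j - lam ^+ (p.-2 - j) * (rho * z j)
    = - ((rho - lam) * lam ^+ (p.-2 - j) * z j) by rewrite exprS; ring.
have c0 : 0 <= (rho - lam) * lam ^+ (p.-2 - j) by rewrite mulr_ge0 // subr_ge0.
case: ifP => cj.
  rewrite lerN2; apply: ler_wpM2l => //.
  rewrite /z Z_rec // cj /gap lerB //; exact: Z_ge.
by rewrite oppr_le0 mulr_ge0 // z_ge0 // ltnW.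
Qed.

End Step.

(** Adding the mirror image makes the functional invariant under translations, hence comparable with
    the diameter, and weighs a crossed gap from both ends. *)
Definition spread_sum (x : T -> R) S : R := rank_sum x S + rank_sum (fun i => - x i) S.

Lemma gap_opp (x : T -> R) (S : {set T}) j : (j.+1 < #|S|)%N ->
  gap (fun i => - x i) S j = gap x S (#|S|.-2 - j).
Proof.
move=> jS; rewrite /gap !ostat_opp //; last exact: ltnW.
have -> : (#|S|.-1 - j.+1 = #|S|.-2 - j)%N by nat_lia.
have -> : (#|S|.-1 - j = (#|S|.-2 - j).+1)%N by nat_lia.
by rewrite opprK addrC.
Qed.

Lemma crossed_opp (x : T -> R) (S : {set T}) j : (j.+1 < #|S|)%N ->
  crossed e (fun i => - x i) S j = crossed e x S (#|S|.-2 - j).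
Proof.
move=> jS; have j1 := ltnW jS.
have E1 : (#|S|.-1 - j.+1 = #|S|.-2 - j)%N by nat_lia.
have E2 : (#|S|.-1 - j = (#|S|.-2 - j).+1)%N by nat_lia.
apply/crossedP/crossedP => -[i [k [iS kS eik xi xk]]]; exists k, i; split => //;
  rewrite ?[e _ _]P_sym //; move: xi xk; by rewrite ?ostat_opp // ?E1 ?E2 ?lerN2.
Qed.

Lemma spread_sum_step (x y : T -> R) (S : {set T}) : (forall i, y i = \sum_j P i j * x j) ->
  sclosed (fun=> e) S 0 -> (0 < #|S|)%N ->
  spread_sum y S <= spread_sum x S - \sum_(j < #|S|.-1 | crossed e x S j)
     (rho - lam) * (lam ^+ (#|S|.-2 - j) + lam ^+ j) * gap x S j.
Proof.
move=> yE cS S0; have h1 := rank_sum_step yE cS S0.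
have yE' i : - y i = \sum_j P i j * - x j.
  by rewrite yE -sumrN; apply: eq_bigr => j _; rewrite mulrN.
have h2 := rank_sum_step yE' cS S0.
have rev : \sum_(j < #|S|.-1 | crossed e (fun i => - x i) S j)
      (rho - lam) * lam ^+ (#|S|.-2 - j) * gap (fun i => - x i) S j
   = \sum_(j < #|S|.-1 | crossed e x S j) (rho - lam) * lam ^+ j * gap x S j.
  rewrite [RHS](reindex_inj rev_ord_inj) /=.
  apply: eq_big => [j|j _]; have jp := ord_predS_lt j.
    by rewrite crossed_opp //; congr crossed; nat_lia.
  rewrite gap_opp //; have -> // : (#|S|.-1 - j.+1 = #|S|.-2 - j)%N by nat_lia.
rewrite rev in h2; have := lerD h1 h2; rewrite /spread_sum => h; apply: le_trans h _.
rewrite addrACA -opprD lerD2l lerN2 -big_split; apply: ler_sum => j _ /=.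
by rewrite le_eqVlt; apply/orP; left; apply/eqP; ring.
Qed.

Hypothesis lam_half : lam <= 2^-1.

Let geometric k : \sum_(j < k) lam ^+ j <= 2 - 2 * lam ^+ k.
Proof.
elim: k => [|k IH]; first by rewrite big_ord0 expr0; lra.
rewrite big_ord_recr /= exprS.
have : lam * lam ^+ k <= 2^-1 * lam ^+ k by apply: ler_wpM2r => //; rewrite exprn_ge0 // ltW.
lra.
Qed.

Let spread_sumE x (S : {set T}) : spread_sum x S =
  \sum_(j < #|S|) lam ^+ (#|S|.-1 - j) * (ostat x S j - ostat x S (#|S|.-1 - j)).
Proof.
rewrite /spread_sum /rank_sum -big_split; apply: eq_bigr => j _ /=.
by rewrite ostat_opp // mulrBr mulrN.
Qed.

Lemma spread_sum_le x (S : {set T}) : spread_sum x S <= 2 * diam x S.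
Proof.
rewrite spread_sumE; have D0 := diam_ge0 x S.
apply: (@le_trans _ _ (\sum_(j < #|S|) lam ^+ (#|S|.-1 - j) * diam x S)).
  apply: ler_sum => j _; apply: ler_wpM2l; first by rewrite exprn_ge0 // ltW.
  have jp := ltn_ord j.
  by apply: lerB; apply: ostat_homo; nat_lia.
rewrite -mulr_suml; apply: ler_wpM2r => //.
rewrite (reindex_inj rev_ord_inj) /=.
have -> : \sum_(j < #|S|) lam ^+ (#|S|.-1 - (#|S| - j.+1)) = \sum_(j < #|S|) lam ^+ j.
  by apply: eq_bigr => j _; have jp := ltn_ord j; congr (_ ^+ _); nat_lia.
apply: le_trans (geometric _) _.
by rewrite gerBl mulr_ge0 // exprn_ge0 // ltW.
Qed.

(** When mirror ranks are paired all terms become nonnegative, and the two extreme ranks alone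
    contribute [2 * (1 - lam ^+ #|S|.-1) * diam x S] to the doubled sum. *)
Lemma spread_sum_ge x (S : {set T}) : diam x S / 2 <= spread_sum x S.
Proof.
have twice : 2 * spread_sum x S = \sum_(j < #|S|)
    (lam ^+ (#|S|.-1 - j) - lam ^+ j) * (ostat x S j - ostat x S (#|S|.-1 - j)).
  rewrite mulr_natl mulr2n {1}spread_sumE spread_sumE [X in _ + X](reindex_inj rev_ord_inj).
  rewrite -big_split; apply: eq_bigr => j _ /=; have jp := ltn_ord j.
  have -> : (#|S| - j.+1 = #|S|.-1 - j)%N by nat_lia.
  have -> : (#|S|.-1 - (#|S|.-1 - j) = j)%N by nat_lia.
  ring.
have lam1 : lam <= 1 by apply: le_trans lam_half _; lra.
have term (j : 'I_#|S|) :
    0 <= (lam ^+ (#|S|.-1 - j) - lam ^+ j) * (ostat x S j - ostat x S (#|S|.-1 - j)).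
  have jp := ltn_ord j.
  have mono a b : (a <= b)%N -> lam ^+ b <= lam ^+ a.
    by move=> ab; apply: ler_wiXn2l => //; apply: ltW.
  case: (leqP (#|S|.-1 - j) j) => le.
    by rewrite mulr_ge0 // subr_ge0 ?mono // ostat_homo.
  rewrite mulr_le0 // subr_le0; first by apply: mono; apply: ltnW.
  by apply: ostat_homo; [apply: ltnW | nat_lia].
have [S2|S2] := ltnP 1 #|S|; last first.
  have p0 : #|S|.-1 = 0%N by nat_lia.
  have -> : diam x S = 0 by rewrite /diam p0 subrr.
  rewrite mul0r -(pmulr_rge0 _ (ltr0n R 2)) twice; exact: sumr_ge0.
have p0 : (0 < #|S|)%N by nat_lia.
have p1 : (#|S|.-1 < #|S|)%N by nat_lia.
suff : diam x S <= 2 * spread_sum x S by lra.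
rewrite twice (bigD1 (Ordinal p1)) //= (bigD1 (Ordinal p0)) /=; last first.
  by apply/eqP => /(congr1 val) /=; nat_lia.
rewrite subnn subn0 expr0 -/(diam x S).
set rest := \sum_(_ | _) _; have : 0 <= rest by apply: sumr_ge0.
have -> : ostat x S 0 - ostat x S #|S|.-1 = - diam x S by rewrite /diam opprB.
have D0 := diam_ge0 x S.
have : lam ^+ #|S|.-1 <= lam.
  by rewrite -[leRHS]expr1; apply: ler_wiXn2l; rewrite ?(ltW lam_gt0) //; nat_lia.
move: (lam ^+ _) => u ul; have : u * diam x S <= 2^-1 * diam x S.
  by apply: ler_wpM2r => //; apply: le_trans ul lam_half.
lra.
Qed.

End Twist.

(** Drops are indexed by ranks, but a split is a set of agents. As long as [A] stays below its
    complement it fills the ranks up to [j], so an edge between the parts crosses the gap of that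
    same rank. *)
Lemma rank_cut (R : realType) (T : finType) (x : T -> R) (S A : {set T}) j a c :
  A \subset S -> #|A| = j.+1 -> (j.+1 < #|S|)%N -> a < c ->
  (forall i, i \in A -> x i <= a) -> (forall i, i \in S -> i \notin A -> c <= x i) ->
  [/\ forall i, i \in A -> x i <= ostat x S j,
      forall i, i \in S -> i \notin A -> ostat x S j.+1 <= x i
    & c - a <= gap x S j].
Proof.
move=> AS cA jS ac xA xB; have jS' := ltnW jS; split.
- move=> i iA; rewrite ostat_ge // -ltnS -cA; apply: proper_card; apply/properP; split.
    apply/subsetP => k; rewrite inE => /andP[kS xk]; apply/negPn/negP => kA.
    have := lt_trans xk (le_lt_trans (xA i iA) ac); rewrite ltNge.
    by rewrite xB.
  by exists i; rewrite // inE ltxx andbF.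
- move=> k kS kA; rewrite ostat_le // -cA; apply: (@leq_trans #|k |: A|).
    by rewrite cardsU1 kA.
  apply: subset_leq_card; apply/subsetP => i; rewrite !inE => /orP[/eqP ->|iA].
    by rewrite kS lexx.
  by rewrite (subsetP AS) //= (le_trans (xA i iA)) // (le_trans (ltW ac)) // xB.
- apply: lerB; first rewrite ostat_ge // -cA.
    apply: subset_leq_card; apply/subsetP => k; rewrite inE => /andP[kS xk].
    by apply/negPn/negP => kA; move: xk; rewrite ltNge xB.
  rewrite ostat_le // -cA; apply: subset_leq_card; apply/subsetP => i iA.
  by rewrite inE (subsetP AS) // xA.
Qed.

Lemma bernoulli_half (R : realType) (u : R) n k :
  0 <= u <= 1 -> u * n%:R <= 2^-1 -> (k <= n)%N -> 2^-1 <= (1 - u) ^+ k.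
Proof.
move=> /andP[u0 u1] un kn; suff h : 1 - u * k%:R <= (1 - u) ^+ k.
  apply: le_trans h; have : u * k%:R <= u * n%:R by apply: ler_wpM2l; rewrite ?ler_nat.
  lra.
elim: k {kn} => [|k IH]; first by rewrite mulr0 subr0 expr0.
rewrite exprS -natr1; have v0 : 0 <= 1 - u by lra.
apply: le_trans (ler_wpM2l v0 IH); have : 0 <= k%:R :> R by exact: ler0n.
by move: (k%:R) => z z0; have := mulr_ge0 z0 (mulr_ge0 u0 u0); lra.
Qed.

Lemma at_once_numeric (R : realType) (b s delta u v : R) :
  0 <= b -> 0 <= u -> 1 <= b * (s * delta / 2) -> v <= (1 - s * delta / 2) * u ->
  u + b * v <= b * u.
Proof.
move=> b0 u0 h1 h2; have := ler_wpM2l b0 h2; have := ler_wpM2r u0 h1.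
by rewrite mul1r; move: (s * delta / 2) => z; lra.
Qed.

Lemma after_split_numeric (R : realType) (b s delta c u v k : R) :
  0 <= b -> 0 <= u -> c <= k * u -> k + 1 <= b * (s * delta / 2) ->
  v <= (1 - s * delta / 2) * u -> c + u + b * v <= b * u.
Proof.
move=> b0 u0 hc h1 h2; have := ler_wpM2l b0 h2; have := ler_wpM2r u0 h1.
by move: (s * delta / 2) => z; lra.
Qed.

(** * General systems: splittings and the bound *)

Section GeneralCount.
Variables (R : realType) (T : finType) (P : nat -> T -> T -> R) (x : nat -> T -> R).
Variables (rho eps s kappa : R) (n Mx : nat).
Hypothesis P_ge0 : forall t i j, 0 <= P t i j.
Hypothesis P_sum1 : forall t i, \sum_j P t i j = 1.
Hypothesis P_ge : forall t i j, P t i j != 0 -> rho <= P t i j.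
Hypothesis P_refl : forall t i, P t i i != 0.
Hypothesis P_sym : forall t i j, (P t i j != 0) = (P t j i != 0).
Hypothesis x_step : forall t i, x t.+1 i = \sum_j P t i j * x t j.
Hypothesis rho_gt0 : 0 < rho.
Hypothesis rho_half : rho <= 2^-1.
Hypothesis eps_gt0 : 0 < eps.
Hypothesis s01 : 0 < s <= 1.
Hypothesis card_T : #|T| = n.
Hypothesis n_gt0 : (0 < n)%N.
Hypothesis Mx_gt0 : (0 < Mx)%N.
Hypothesis kappaE : kappa = 160 * (Mx%:R * n%:R) / s.

Local Notation e := (support_rel P).
Implicit Types (S A : {set T}).

(** It must be below [rho] for a crossed gap to cause a drop, yet so close that its [k]-th power is
    at least [rho ^+ k / 2] for [k <= n]. The margin [rho / (2 * n)] does both and is the source of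
    the factor [n] in [kappa]. *)
Definition discount : R := rho * (1 - (2 * n%:R)^-1).
Local Notation lam := discount.
Local Notation G := (spread_sum lam).

Definition gen_energy S t : R := (2 * G (x t) S / eps) `^ s.
Definition gen_coef p m : R := rho^-1 ^+ p.-1 * kappa ^+ m.

Let nR : 1 <= n%:R :> R. Proof. by rewrite ler1n. Qed.
Let MR : 1 <= Mx%:R :> R. Proof. by rewrite ler1n. Qed.
Let s_gt0 : 0 < s. Proof. by case/andP: s01. Qed.
Let s_le1 : s <= 1. Proof. by case/andP: s01. Qed.
Let n_neq0 : n%:R != 0 :> R. Proof. by rewrite pnatr_eq0 -lt0n. Qed.
Let M_neq0 : Mx%:R != 0 :> R. Proof. by rewrite pnatr_eq0 -lt0n. Qed.
Let s_neq0 : s != 0. Proof. by rewrite gt_eqF. Qed.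
Let rho_neq0 : rho != 0. Proof. by rewrite gt_eqF. Qed.
Let n2_gt0 : 0 < 2 * n%:R :> R. Proof. by have := nR; lra. Qed.

Let u01 : 0 <= (2 * n%:R : R)^-1 <= 2^-1.
Proof.
by rewrite invr_ge0 ltW //= lef_pV2 ?posrE // ler_peMr.
Qed.

Let lam_le : lam <= rho.
Proof.
rewrite /discount ler_piMr ?(ltW rho_gt0) //; have /andP[h _] := u01; lra.
Qed.

Let lam_gt0 : 0 < lam.
Proof. by rewrite /discount mulr_gt0 // subr_gt0; have /andP[_ h] := u01; lra. Qed.

Let lam_half : lam <= 2^-1. Proof. exact: le_trans lam_le rho_half. Qed.

Lemma lam_pow_ge k : (k <= n)%N -> rho ^+ k.+1 / (4 * n%:R) <= (rho - lam) * lam ^+ k.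
Proof.
move=> kn; have b : 2^-1 <= (1 - (2 * n%:R)^-1) ^+ k :> R.
  have /andP[u0 u1] := u01; apply: (@bernoulli_half _ _ n) => //.
    by rewrite u0; apply: le_trans u1 _; lra.
  by rewrite invfM -mulrA mulVf ?mulr1 // gt_eqF // (lt_le_trans ltr01 nR).
have -> : (rho - lam) * lam ^+ k
    = rho ^+ k.+1 / (2 * n%:R) * (1 - (2 * n%:R)^-1) ^+ k.
  by rewrite /discount exprMn exprS; ring.
have -> : rho ^+ k.+1 / (4 * n%:R) = rho ^+ k.+1 / (2 * n%:R) * 2^-1 :> R.
  by field; rewrite n_neq0.
by apply: ler_wpM2l => //; rewrite divr_ge0 ?exprn_ge0 // ltW.
Qed.

Let e_refl t : reflexive (e t). Proof. by move=> i; apply: P_refl. Qed.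
Let e_sym t : symmetric (e t). Proof. by move=> i j; apply: P_sym. Qed.

Let spread_step S t : sclosed e S t -> (0 < #|S|)%N ->
  G (x t.+1) S <= G (x t) S - \sum_(j < #|S|.-1 | crossed (e t) (x t) S j)
     (rho - lam) * (lam ^+ (#|S|.-2 - j) + lam ^+ j) * gap (x t) S j.
Proof.
move=> cS S0; exact: (spread_sum_step (P_ge0 t) (P_sum1 t) (@P_ge t) (P_refl t)
  (P_sym t) lam_gt0 lam_le (x_step t) cS S0).
Qed.

Let term_ge0 S t j : (j.+1 < #|S|)%N ->
  0 <= (rho - lam) * (lam ^+ (#|S|.-2 - j) + lam ^+ j) * gap (x t) S j.
Proof.
move=> jS; rewrite mulr_ge0 ?gap_ge0 // mulr_ge0 ?subr_ge0 // addr_ge0 ?exprn_ge0 //.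
- exact: ltW.
- exact: ltW.
Qed.

Let spread_noninc S t : sclosed e S t -> G (x t.+1) S <= G (x t) S.
Proof.
move=> cS; have [S0|S0] := posnP #|S|.
  by rewrite /spread_sum /rank_sum S0 !big_ord0.
apply: le_trans (spread_step cS S0) _; rewrite gerBl; apply: sumr_ge0 => j _.
exact: term_ge0 (ord_predS_lt j).
Qed.

Let spread_noninc_iter S t u : (t <= u)%N ->
  (forall v, (t <= v < u)%N -> sclosed e S v) -> G (x u) S <= G (x t) S.
Proof.
move=> /subnKC <-; elim: (u - t)%N => [|k IH] cS; first by rewrite addn0.
rewrite addnS; apply: le_trans (spread_noninc _) (IH _).
  by apply: cS; nat_lia.
by move=> v tv; apply: cS; nat_lia.
Qed.

Let G_ge S t : diam (x t) S / 2 <= G (x t) S.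
Proof. exact: spread_sum_ge. Qed.

Let G_le S t : G (x t) S <= 2 * diam (x t) S.
Proof. exact: spread_sum_le. Qed.

Let G_ge0 S t : 0 <= G (x t) S.
Proof. by apply: le_trans (G_ge S t); rewrite divr_ge0 ?diam_ge0. Qed.

Let arg_ge0 S t : 0 <= 2 * G (x t) S / eps.
Proof. by rewrite divr_ge0 ?mulr_ge0 ?G_ge0 // ltW. Qed.

Let energy_ge0 S t : 0 <= gen_energy S t. Proof. exact: powR_ge0. Qed.

Let energy_drop S t u delta : 0 <= delta <= 1 ->
  G (x u) S <= (1 - delta) * G (x t) S ->
  gen_energy S u <= (1 - s * delta / 2) * gen_energy S t.
Proof.
move=> d01 h; apply: powR_drop => //; try exact: arg_ge0.
by rewrite mulrA ler_pM2r ?invr_gt0 // mulrCA ler_pM2l.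
Qed.

(** The comparison passes through the diameter, which is monotone in the set and agrees with [G] up
    to a factor [2] on either side; this costs the [4]. *)
Let energyS S A t : A \subset S -> gen_energy A t <= 4 * gen_energy S t.
Proof.
move=> AS; apply: (@le_trans _ _ ((4 * (2 * G (x t) S / eps)) `^ s)).
  have big0 : 0 <= 4 * (2 * G (x t) S / eps) by apply: mulr_ge0 (arg_ge0 S t).
  apply: ge0_ler_powR; rewrite ?nnegrE ?arg_ge0 ?big0 //; first exact: ltW.
  rewrite mulrA ler_pM2r ?invr_gt0 // mulrCA ler_pM2l //.
  have := G_le A t; have := G_ge S t; have := diamS (x t) AS; lra.
rewrite powRM ?arg_ge0 //; apply: ler_wpM2r; first exact: powR_ge0.
by apply: ler1_powR => //; rewrite ler1n.
Qed.

Let energy_active S t : sactive e x eps S t -> 1 <= gen_energy S t.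
Proof.
move=> /sactiveP[i [j [iS jS _ h]]].
rewrite -(powRr0 (2 * G (x t) S / eps)); apply: ler_powR; last exact: ltW.
rewrite ler_pdivlMr // mul1r; have := G_ge S t.
have := le_trans h (dist_le_diam (x t) iS jS); lra.
Qed.

Let kappa_ge1 : 1 <= kappa.
Proof.
rewrite kappaE ler_pdivlMr // mul1r; apply: le_trans s_le1 _.
by have := MR; have := nR; nra.
Qed.

Let kappa_pow_ge1 k : 1 <= kappa ^+ k. Proof. exact: exprn_ege1. Qed.
Let kappa_pow_ge0 k : 0 <= kappa ^+ k. Proof. exact: le_trans ler01 _. Qed.
Let rhoV_ge1 : 1 <= rho^-1.
Proof. by rewrite invf_ge1 //; have := rho_half; lra. Qed.
Let rhoV_pow_ge1 k : 1 <= rho^-1 ^+ k. Proof. exact: exprn_ege1. Qed.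
Let coef_ge0 p m : 0 <= gen_coef p m.
Proof. by rewrite mulr_ge0 // exprn_ge0 // invr_ge0 ltW. Qed.

(** The [5 = 160 / 32] covers the factor [4] lost in [energyS] and one unit for the crossing
    time. *)
Let kappaS k : kappa ^+ k.+1 * (s / (32 * (Mx%:R * n%:R))) = 5 * kappa ^+ k.
Proof.
rewrite exprS kappaE; field; by rewrite ?expf_neq0 ?n_neq0 ?M_neq0 ?s_neq0 ?rho_neq0.
Qed.

Lemma gen_drop_at_once S t m : sclosed e S t -> (1 < #|S|)%N -> (0 < m)%N ->
  diam (x t) S / 2 <= \sum_(j < #|S|.-1 | crossed (e t) (x t) S j) gap (x t) S j ->
  drops_at_once gen_energy gen_coef S t m.
Proof.
move=> cS S1 m1 big; have S0 : (0 < #|S|)%N by exact: ltnW.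
have r0 : 0 <= rho ^+ #|S|.-1 by rewrite exprn_ge0 // ltW.
have r1 : rho ^+ #|S|.-1 <= 1.
  by rewrite exprn_ile1 ?(ltW rho_gt0) //; have := rho_half; lra.
have nn : 0 < 16 * n%:R :> R by have := nR; lra.
(* Crossed gaps carry weight at least [rho ^+ #|S|.-1 / (4 * n)] and make up half of the diameter,
   while [G] is at most twice the diameter; together this gives the [16]. *)
pose delta : R := rho ^+ #|S|.-1 / (16 * n%:R).
have d01 : 0 <= delta <= 1.
  rewrite /delta divr_ge0 ?(ltW nn) //= ler_pdivrMr // mul1r.
  by apply: le_trans r1 _; have := nR; lra.
have drop : G (x t.+1) S <= (1 - delta) * G (x t) S.
  apply: le_trans (spread_step cS S0) _; rewrite mulrBl mul1r lerB //.
  apply: (@le_trans _ _ (rho ^+ #|S|.-1 / (4 * n%:R) *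
      \sum_(j < #|S|.-1 | crossed (e t) (x t) S j) gap (x t) S j)).
    apply: (@le_trans _ _ (rho ^+ #|S|.-1 / (4 * n%:R) * (diam (x t) S / 2))).
      have := ler_wpM2l r0 (G_le S t); rewrite /delta => h.
      have -> : rho ^+ #|S|.-1 / (16 * n%:R) * G (x t) S
          = rho ^+ #|S|.-1 * G (x t) S / (16 * n%:R) by ring.
      rewrite ler_pdivrMr //; apply: le_trans h _.
      rewrite le_eqVlt; apply/orP; left; apply/eqP; field.
      by rewrite n_neq0.
    by apply: ler_wpM2l => //; rewrite divr_ge0 // mulr_ge0 ?ler0n.
  rewrite mulr_sumr; apply: ler_sum => j _; have jS := ord_predS_lt j.
  apply: ler_wpM2r; first exact: gap_ge0.
  have jn : (j <= n)%N.
    by rewrite -card_T; apply: leq_trans (max_card (mem S)); exact: ltnW (ltnW jS).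
  apply: (@le_trans _ _ ((rho - lam) * lam ^+ j)).
    apply: le_trans (lam_pow_ge jn); apply: ler_wpM2r.
      by rewrite invr_ge0 mulr_ge0 ?ler0n.
    apply: ler_wiXn2l; rewrite ?(ltW rho_gt0) //; have := rho_half; lra.
  apply: ler_wpM2l; first by rewrite subr_ge0.
  by rewrite lerDr exprn_ge0 // ltW.
have := energy_drop d01 drop; apply: at_once_numeric; rewrite ?energy_ge0 ?coef_ge0 //.
have -> : gen_coef #|S| m * (s * delta / 2) = Mx%:R * (kappa ^+ m * (s / (32 * (Mx%:R * n%:R)))).
  rewrite /gen_coef /delta exprVn; field.
  by rewrite ?expf_neq0 ?n_neq0 ?M_neq0 ?s_neq0 ?rho_neq0.
rewrite -(prednK m1) kappaS.
by have := kappa_pow_ge1 m.-1; have := MR; nra.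
Qed.

Lemma gen_drop_after_split S t m (j : 'I_#|S|.-1) : sclosed e S t -> (1 < m)%N ->
  ~~ crossed (e t) (x t) S j -> diam (x t) S / 2 <= Mx%:R * gap (x t) S j ->
  drops_after_split e gen_energy gen_coef S t m.
Proof.
move=> cS m1 nc big; have jS := ord_predS_lt j.
have gj0 := uncrossed_gap_gt0 (@e_refl t) jS nc.
set a := ostat (x t) S j; set c := ostat (x t) S j.+1.
have ac : a < c by rewrite -subr_gt0.
pose f i : 'I_2 := if x t i <= a then ord0 else ord_max.
pose A := [set i in S | x t i <= a].
have dich i : i \in S -> i \notin A -> c <= x t i.
  move=> iS; rewrite inE iS /= => /negbTE h.
  by have := ostat_dichotomy (x t) iS jS; rewrite -/a h.
have AS : A \subset S by apply/subsetP => i; rewrite inE => /andP[].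
have cA : #|A| = j.+1.
  have low : (j < #|A|)%N by rewrite -(ostat_le (x t) a (ltnW jS)).
  apply/eqP; rewrite eqn_leq low andbT.
  have : c <= ostat (x t) S j.+1 by [].
  rewrite ostat_ge // => h; apply: leq_trans h; apply: subset_leq_card.
  by apply/subsetP => i; rewrite !inE => /andP[-> xi]; rewrite (le_lt_trans xi).
have p0E : lpart f S ord0 = A.
  by apply/setP => i; rewrite !inE /f; case: ifP.
have p1E : lpart f S ord_max = S :\: A.
  by apply/setP => i; rewrite !inE /f; case: (i \in S); case: (x t i <= a).
have cB : #|S :\: A| = (#|S|.-2 - j).+1 by rewrite cardsD (setIidPr AS) cA; nat_lia.
pose C : R := rho^-1 ^+ j + rho^-1 ^+ (#|S|.-2 - j).
have C2 : 2 <= C by have := rhoV_pow_ge1 j; have := rhoV_pow_ge1 (#|S|.-2 - j)%N; rewrite /C; lra.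
have cost : split_cost gen_energy gen_coef f S t m <= 4 * kappa ^+ m.-1 * C * gen_energy S t.
  rewrite /split_cost big_ord_recl big_ord1.
  have -> : lift ord0 ord0 = ord_max :> 'I_2 by apply/val_inj.
  rewrite p0E p1E cA cB /gen_coef /= subn1 /C.
  have BS : S :\: A \subset S by exact: subsetDl.
  have kk := kappa_pow_ge0 m.-1.
  have w0 k : 0 <= rho^-1 ^+ k * kappa ^+ m.-1.
    by rewrite mulr_ge0 // (le_trans ler01).
  have := ler_wpM2l (w0 j) (energyS t AS).
  have := ler_wpM2l (w0 (#|S|.-2 - j)%N) (energyS t BS).
  by move: (rho^-1 ^+ j) (rho^-1 ^+ _) (kappa ^+ _) (gen_energy S t) => *; lra.
pose Lam : R := (rho - lam) * (lam ^+ (#|S|.-2 - j) + lam ^+ j).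
(* By the choice of [j], [G] is at most twice the diameter and hence at most [4 * Mx] times the
   gap. *)
pose delta : R := Lam / (4 * Mx%:R).
have jn : (j <= n)%N.
    by rewrite -card_T; apply: leq_trans (max_card (mem S)); exact: ltnW (ltnW jS).
have jn' : (#|S|.-2 - j <= n)%N.
  rewrite -card_T; apply: leq_trans (max_card (mem S)); apply: leq_trans (leq_subr _ _) _.
  exact: leq_trans (leq_pred _) (leq_pred _).
have lamp k : 0 <= lam ^+ k by rewrite exprn_ge0 // ltW.
have Lam0 : 0 <= Lam by rewrite mulr_ge0 ?subr_ge0 ?addr_ge0.
have Lam1 : Lam <= 1.
  have le1 k : lam ^+ k <= 1.
    by rewrite exprn_ile1 ?(ltW lam_gt0) //; have := lam_half; lra.
  apply: (@le_trans _ _ (2^-1 * 2)); last by lra.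
  apply: ler_pM; rewrite ?subr_ge0 ?addr_ge0 //.
    by have := rho_half; have := lam_gt0; lra.
  by have := le1 j; have := le1 (#|S|.-2 - j)%N; lra.
have M4 : 0 < 4 * Mx%:R :> R by have := MR; lra.
have d01 : 0 <= delta <= 1.
  rewrite /delta divr_ge0 ?(ltW M4) //= ler_pdivrMr // mul1r.
  by apply: le_trans Lam1 _; have := MR; lra.
have num : 4 * kappa ^+ m.-1 * C + 1 <= gen_coef #|S| m * (s * delta / 2).
  (* The drop weight seen from one end pays for the part at the other end: [rho^-1 ^+ #|S|.-1] times
     [rho ^+ k'.+1] leaves [rho^-1 ^+ k] when [k + k' = #|S|.-2]. *)
  have LamC : C / (4 * n%:R) <= rho^-1 ^+ #|S|.-1 * Lam.
    have r0 : rho != 0 by rewrite gt_eqF.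
    have low k k' : (k + k' = #|S|.-2)%N -> (k' <= n)%N ->
        rho^-1 ^+ k / (4 * n%:R) <= rho^-1 ^+ #|S|.-1 * ((rho - lam) * lam ^+ k').
      move=> kk kn; have -> : rho^-1 ^+ k / (4 * n%:R)
          = rho^-1 ^+ #|S|.-1 * (rho ^+ k'.+1 / (4 * n%:R)).
        have -> : #|S|.-1 = (k + k'.+1)%N by rewrite addnS kk; nat_lia.
        rewrite exprD !exprVn.
        have := expf_neq0 k rho_neq0; have := expf_neq0 k'.+1 rho_neq0.
        by move: (rho ^+ k) (rho ^+ _) => u v v0 u0; field; rewrite u0 v0 n_neq0.
      apply: ler_wpM2l; first by rewrite exprn_ge0 // invr_ge0 ltW.
      exact: lam_pow_ge.
    rewrite /C /Lam mulrDl !mulrDr; apply: lerD; apply: low => //; nat_lia.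
  have k5 := kappaS m.-1; rewrite prednK in k5; last exact: ltnW.
  have -> : gen_coef #|S| m * (s * delta / 2)
      = kappa ^+ m * (s / (8 * Mx%:R)) * (rho^-1 ^+ #|S|.-1 * Lam).
    by rewrite /gen_coef /delta; field; rewrite M_neq0.
  apply: (@le_trans _ _ (kappa ^+ m * (s / (8 * Mx%:R)) * (C / (4 * n%:R)))); last first.
    apply: ler_wpM2l => //; rewrite mulr_ge0 // divr_ge0 ?mulr_ge0 ?ler0n //.
    exact: ltW.
  have -> : kappa ^+ m * (s / (8 * Mx%:R)) * (C / (4 * n%:R))
      = kappa ^+ m * (s / (32 * (Mx%:R * n%:R))) * C.
    field; by rewrite ?expf_neq0 ?n_neq0 ?M_neq0 ?s_neq0 ?rho_neq0.
  rewrite k5; have := kappa_pow_ge1 m.-1; move: (kappa ^+ _) C2 => k C2 k1.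
  have := ler_pM ler01 ler01 k1 (le_trans (ler1n R 2) C2); rewrite mulr1; lra.
exists 0%N, f; split.
- move=> b; have [->|b0] := eqVneq b ord0; first by rewrite p0E -card_gt0 cA.
  have -> : b = ord_max by apply/val_inj; case: b b0 => [[|[|]]].
  by rewrite p1E -card_gt0 cB.
- apply: le_trans cost _; apply: ler_wpM2r => //.
  have : gen_coef #|S| m * (s * delta / 2) <= gen_coef #|S| m.
    rewrite ler_piMr //; have /andP[d0 d1] := d01.
    have := mulr_ge0 (ltW s_gt0) d0; have := ler_pM (ltW s_gt0) d0 s_le1 d1.
    by rewrite mulr1; lra.
  by move: num; lra.
move=> t1 tt1 cl mono nm.
have hull i : i \in S -> (i \in A -> x t1 i <= a) /\ (i \notin A -> c <= x t1 i).
  move=> iS; pose lo (b : 'I_2) := if b == ord0 then ostat (x t) S 0 else c.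
  pose hi (b : 'I_2) := if b == ord0 then a else ostat (x t) S #|S|.-1.
  have init k : k \in S -> lo (f k) <= x t k <= hi (f k).
    move=> kS; rewrite /lo /hi /f; have [h|h] := lerP (x t k) a.
      by rewrite eqxx ostat_first.
    by rewrite /= ostat_last // andbT dich // inE kS /= -ltNge.
  have cl' v : (t <= v < t1)%N -> sclosed e S v.
    by move=> /andP[tv vt]; apply: cl; rewrite tv ltnW.
  have /andP[] := split_separated P_ge0 P_sum1 x_step tt1 cl' mono init iS.
   rewrite /lo /hi /f inE iS /=.
  by case: (x t i <= a).
have iA i : i \in S -> i \in A -> x t1 i <= a by move=> /hull[].
have iB i : i \in S -> i \notin A -> c <= x t1 i by move=> /hull[].
have [rA rB rg] := @rank_cut _ _ (x t1) S A j a c AS cA jS ac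
  (fun i h => iA i (subsetP AS i h) h) iB.
have cross : crossed (e t1) (x t1) S j.
  move: nm; rewrite /monochrome negb_forall_in => /exists_inP[i iS].
  rewrite negb_forall_in => /exists_inP[k kS]; rewrite negb_imply => /andP[eik fik].
  have fA l : l \in S -> (f l == ord0) = (l \in A).
    by move=> lS; rewrite inE lS /f; case: ifP.
  have : (i \in A) != (k \in A).
    rewrite -!fA //; move: fik; case: (f i) => [[|[|]]]; case: (f k) => [[|[|]]] //.
  case: (boolP (i \in A)) => hi; case: (boolP (k \in A)) => hk // _.
    by apply/crossedP; exists i, k; rewrite rA ?rB.
  by apply/crossedP; exists k, i; rewrite rA ?rB // e_sym.
have c1 : sclosed e S t1 by apply: cl; rewrite tt1 leqnn.
have S0 : (0 < #|S|)%N by nat_lia.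
have noninc : G (x t1) S <= G (x t) S.
  by apply: spread_noninc_iter => // v /andP[tv vt]; apply: cl; rewrite tv ltnW.
have drop : G (x t1.+1) S <= (1 - delta) * G (x t) S.
  have le1 := spread_step c1 S0; apply: le_trans le1 _; rewrite mulrBl mul1r.
  apply: lerB => //; rewrite (bigD1 j) //=.
  apply: (@le_trans _ _ (Lam * gap (x t1) S j)); last first.
    rewrite lerDl; apply: sumr_ge0 => k _; exact: term_ge0 (ord_predS_lt k).
  have g1 : gap (x t) S j <= gap (x t1) S j by exact: rg.
  apply: le_trans (ler_wpM2l Lam0 g1).
  rewrite /delta -[Lam / _ * _]mulrA; apply: ler_wpM2l => //.
  rewrite mulrC ler_pdivrMr //.
  by apply: le_trans (G_le S t) _; move: big; lra.
have := energy_drop d01 drop; apply: after_split_numeric cost _ => //.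
Qed.

Theorem gen_scount_le m N S t : (m <= Mx)%N ->
  (forall u, (t <= u < t + N)%N -> sclosed e S u) ->
  (forall u, (t <= u < t + N)%N -> (scomp e S u <= m)%N) ->
  (scount e x eps S t N)%:R <= gen_coef #|S| m * gen_energy S t.
Proof.
move=> mM cS sS.
apply: (@scount_le _ _ _ x eps e_sym gen_energy gen_coef Mx) => //.
- move=> A u cA; apply: ge0_ler_powR; rewrite ?nnegrE ?arg_ge0 //; first exact: ltW.
  by rewrite ler_pM2r ?invr_gt0 // ler_pM2l // spread_noninc.
- by move=> A u _; apply: energy_active.
move=> A u k cA sA kM act; have /sactiveP[i0 [j0 [i0A j0A _ h0]]] := act.
have A0 : A != set0 by apply/set0Pn; exists i0.
have ij0 : i0 != j0.
  by apply/eqP => ij; move: h0; rewrite ij subrr normr0 leNgt eps_gt0.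
have A1 : (1 < #|A|)%N by apply/card_gt1P; exists i0, j0.
have D0 : 0 < diam (x u) A.
  by apply: lt_le_trans eps_gt0 (le_trans h0 _); apply: dist_le_diam.
have Ulem := card_uncrossed (@e_refl u) (@e_sym u) (x u) (cA : sclosed (fun=> e u) A 0) A0.
pose Un := [set j : 'I_#|A|.-1 | ~~ crossed (e u) (x u) A j].
have Um : (#|Un| < k)%N by apply: leq_trans Ulem sA.
have Dsum : diam (x u) A = \sum_(j < #|A|.-1 | crossed (e u) (x u) A j) gap (x u) A j
     + \sum_(j in Un) gap (x u) A j.
  rewrite diam_sum_gap (bigID (fun j : 'I_#|A|.-1 => crossed (e u) (x u) A j)) /=.
  by congr (_ + _); apply: eq_bigl => j; rewrite inE.
have [big|small] := lerP (diam (x u) A / 2)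
    (\sum_(j < #|A|.-1 | crossed (e u) (x u) A j) gap (x u) A j).
  by left; apply: gen_drop_at_once => //; apply: leq_ltn_trans Um.
right; have Ubig : diam (x u) A / 2 <= \sum_(j in Un) gap (x u) A j by lra.
have D20 : 0 < diam (x u) A / 2 by lra.
have UM : (#|Un| <= Mx)%N by apply: leq_trans (ltnW Um) kM.
have [j jU jbig] := exists_ge_average D20 Ubig UM.
apply: (@gen_drop_after_split A u k j) => //.
  by apply: leq_ltn_trans Um; apply/card_gt0P; exists j.
by move: jU; rewrite inE.
Qed.

End GeneralCount.

Theorem gen_bound (R : realType) (eps : R) n m rho (P : nat -> 'M[R]_n)
    (x0 : 'cV[R]_n) N :
  0 < eps -> 192 <= ln eps^-1 -> 0 < rho -> rho <= 2^-1 ->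
  (forall t, admissible rho (P t)) -> (forall t, (ncomp (P t) <= m)%N) ->
  (forall i, 0 <= x0 i 0 <= 1) ->
  (count_active eps P x0 N)%:R
    <= expR 576 * rho^-1 ^+ n.-1 * ((m * n)%:R * ln eps^-1) ^+ m.
Proof.
move=> e0 L rho0 rho12 adm comps x01; set l := ln eps^-1 in L *.
have l0 : 0 < l by lra.
have rV k : 0 <= rho^-1 ^+ k by rewrite exprn_ge0 // invr_ge0 ltW.
have mnl : 0 <= ((m * n)%:R * l) ^+ m by rewrite exprn_ge0 // mulr_ge0 ?ler0n // ltW.
have [n0|n0] := posnP n.
  by rewrite count_active_ord0 // !mulr_ge0 ?expR_ge0.
pose x := state P x0; pose W := weights P.
have W0 t i j : 0 <= W t i j by have [h _ _ _ _] := adm t; exact: h.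
have W1 t i : \sum_j W t i j = 1 by have [_ h _ _ _] := adm t; exact: h.
have Wr t i j : W t i j != 0 -> rho <= W t i j by have [_ _ h _ _] := adm t; exact: h.
have Wi t i : W t i i != 0 by have [_ _ _ h _] := adm t; exact: h.
have Ws t i j : (W t i j != 0) = (W t j i != 0) by have [_ _ _ _ h] := adm t; exact: h.
have m0 : (0 < m)%N.
  apply: leq_trans (comps 0%N); rewrite -scomp_setT; apply: scomp_gt0.
  - by move=> t i j; apply: Ws.
  - exact: sclosed_setT.
  - by apply/set0Pn; exists (Ordinal n0); rewrite inE.
have L160 : 160 <= l by lra.
have s01 := ratio_in01 (ltr0n R 160) L160.
have kE : m%:R * n%:R * l = 160 * (m%:R * n%:R) / (160 / l) by field; rewrite gt_eqF.
rewrite count_activeE.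
apply: le_trans (gen_scount_le (m := m) W0 W1 Wr Wi Ws (@state_step _ _ P x0) rho0 rho12
  e0 s01 (card_ord n) n0 m0 kE (leqnn m) _ _) _.
- by move=> u _; apply: sclosed_setT.
- by move=> u _; rewrite scomp_setT.
rewrite /gen_coef cardsT card_ord natrM -!mulrA [expR _ * _]mulrC -!mulrA.
apply: ler_wpM2l => //; apply: ler_wpM2l; first by rewrite natrM -mulrA in mnl.
(* The initial diameter is at most [1], so the argument of the power is at most
   [4 / eps <= eps^-1 ^+ 2], and the exponent [160 / l] yields [expR 320]. *)
apply: (@le_trans _ _ (expR 320)); last by rewrite ler_expR; lra.
rewrite /gen_energy; set lm := discount _ _; have lm_gt0 : 0 < lm.
  rewrite /lm /discount mulr_gt0 // subr_gt0 invf_lt1; last by rewrite mulr_gt0 ?ltr0n.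
  by have : 1 <= n%:R :> R by [rewrite ler1n]; lra.
have lm_half : lm <= 2^-1.
  apply: le_trans rho12; rewrite /lm /discount ler_piMr ?(ltW rho0) //.
  by rewrite gerBl invr_ge0 mulr_ge0 ?ler0n.
have D1 : diam (x 0%N) setT <= 1.
  have T0 : [set: 'I_n] != set0 by apply/set0Pn; exists (Ordinal n0); rewrite inE.
  have [i [j [_ _ ->]]] := diam_attained (x 0%N) T0; rewrite /x /state /=.
  by have /andP[? ?] := x01 i; have /andP[? ?] := x01 j; lra.
have G2 := spread_sum_le lm_gt0 lm_half (x 0%N) setT.
have G0 := spread_sum_ge lm_gt0 lm_half (x 0%N) setT.
have D0 := diam_ge0 (x 0%N) setT.
have ie : eps^-1 = expR l by rewrite lnK // posrE invr_gt0.
have ie4 : 4 <= eps^-1 by rewrite ie; apply: le_trans (expR_ge1Dx _); lra.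
have -> : expR 320 = ((eps^-1) ^+ 2) `^ (160 / l) :> R.
  by rewrite ie -expRM_natl -expRM; congr expR; field; rewrite gt_eqF.
have eV : 0 <= eps^-1 by rewrite invr_ge0 ltW.
have s0 : 0 <= 160 / l by rewrite divr_ge0 // ltW.
apply: ge0_ler_powR => //; rewrite ?nnegrE.
- by rewrite mulr_ge0 //; lra.
- by rewrite exprn_ge0.
- by rewrite expr2; apply: ler_wpM2r => //; lra.
Qed.

(** * Cuts of random regular graphs *)

Section Cuts.
Variables (T : finType).
Implicit Types (E : {set T * T}) (A B : {set T}).

Definition cut E A : nat := #|[set e in E | (e.1 \in A) && (e.2 \notin A)]|.

Definition small_cut_sets E a b : {set {set T}} :=
  [set A : {set T} | (#|A| == a) && (cut E A <= b)%N].

Definition subsets_le c : nat := #|[set A : {set T} | (#|A| <= c)%N]|.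

Section OneGraph.
Variable E : {set T * T}.
Hypothesis E_irr : forall u, (u, u) \notin E.
Hypothesis E_sym : forall u v, ((u, v) \in E) = ((v, u) \in E).
Hypothesis E_nbr : forall u, exists v, (u, v) \in E.

(* A maximal independent set and its complement dominate each other. *)
Lemma dominating_pair : exists (I : {set T}) (phi : T -> T),
  forall v, ((v, phi v) \in E) && ((phi v \in I) == (v \notin I)).
Proof.
pose indep (I : {set T}) := [forall u in I, forall v in I, (u, v) \notin E].
have indepP (I : {set T}) : reflect (forall u v, u \in I -> v \in I -> (u, v) \notin E) (indep I).
  apply: (iffP forall_inP) => [h u v uI vI|h u uI].
    by have /forall_inP := h u uI; apply.
  by apply/forall_inP => v vI; apply: h.
have ind0 : indep set0 by apply/indepP => u v; rewrite inE.
have [I /maxsetP[/indepP indI maxI] _] := maxset_exists ind0.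
exists I.
suff w v : exists u, ((v, u) \in E) && ((u \in I) == (v \notin I)).
  by exists (fun v => xchoose (w v)) => v; exact: (xchooseP (w v)).
case: (boolP (v \in I)) => [vI|vI].
  have [u vu] := E_nbr v; exists u; rewrite vu /=.
  by rewrite eqbF_neg; apply/negP => uI; have := indI v u vI uI; rewrite vu.
apply/existsP; apply: contraR vI; rewrite negb_exists => /forallP h.
have hI u : u \in I -> (v, u) \notin E.
  by move=> uI; have := h u; rewrite uI eqxx andbT.
suff ind : indep (v |: I) by rewrite -(maxI _ ind (subsetUr _ _)) setU11.
apply/indepP => a b /setU1P[->|aI] /setU1P[->|bI] //.
- exact: hI.
- by rewrite E_sym hI.
- exact: indI.
Qed.

(** The encoding of two sets by one set of size at most [a] and a small error saves a square root:
    sets with small cuts number about the square root of ['C(#|T|, a)], whatever the graph. *)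
Lemma card_small_cut_sets a b :
  (#|small_cut_sets E a b| ^ 2 <= 2 * (subsets_le a * subsets_le (4 * b)))%N.
Proof.
have [I [phi hphi]] := dominating_pair.
have phiE v : (v, phi v) \in E by have /andP[] := hphi v.
have phiI v : (phi v \in I) = (v \notin I) by have /andP[_ /eqP] := hphi v.
pose mis A := [set v | (v \in A) != (phi v \in A)].
(* A vertex [v] of [mis A] yields a cut edge between [v] and [phi v]; an edge can arise twice, once
   from each end. *)
have mis_le A : (#|mis A| <= 2 * cut E A)%N.
  have -> : mis A = [set v in A | phi v \notin A] :|: [set v in ~: A | phi v \in A].
    by apply/setP => v; rewrite !inE; case: (v \in A); case: (phi v \in A).
  apply: leq_trans (leq_card_setU _ _) _; rewrite mul2n -addnn; apply: leq_add.
    rewrite -(card_imset (mem [set v in A | phi v \notin A]) (f := fun v => (v, phi v))).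
      apply: subset_leq_card; apply/subsetP => e /imsetP[v]; rewrite inE => /andP[vA pv] ->.
      by rewrite inE phiE /= vA.
    by move=> u v [].
  rewrite -(card_imset (mem [set v in ~: A | phi v \in A]) (f := fun v => (phi v, v))).
    apply: subset_leq_card; apply/subsetP => e /imsetP[v]; rewrite !inE => /andP[vA pv] ->.
    by rewrite /= E_sym phiE pv vA.
  by move=> u v [].
(* [A] is determined, up to [mis A], by its trace on [I] and also by its trace off [I];
   hence the trace of [A] on [I], that of [A'] off [I] and the two errors encode
   the pair [(A, A')]. *)
pose mix (p : {set T} * {set T}) := (p.1 :&: I) :|: (p.2 :\: I).
pose dl (p : {set T} * {set T}) := (mis p.1 :\: I) :|: (mis p.2 :&: I).
have inj : injective (fun p => (mix p, dl p)).
  move=> [A A'] [B B'] [/setP hm /setP hd].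
  have AI v : v \in I -> (v \in A) = (v \in B).
    by move=> vI; have := hm v; rewrite !inE vI /= !andbT !orbF.
  have AI' v : v \notin I -> (v \in A') = (v \in B').
    by move=> vI; have := hm v; rewrite !inE vI /= (negbTE vI) !andbF /=.
  congr (_, _); apply/setP => v; case: (boolP (v \in I)) => vI.
  - exact: AI.
  - have := hd v; rewrite !inE vI (negbTE vI) !andbF /= !orbF.
    rewrite (AI (phi v)) ?phiI //.
    by case: (v \in A); case: (v \in B); case: (phi v \in B).
  - have := hd v; rewrite !inE vI /= !andbT.
    rewrite (AI' (phi v)) ?phiI ?vI //.
    by case: (v \in A'); case: (v \in B'); case: (phi v \in B').
  - exact: AI'.
pose NC := small_cut_sets E a b.
(* The sizes of [mix (A, A')] and [mix (A', A)] add up to [2 * a], so up to a swap every pair lies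
   in [Q]; the swap is the factor [2] in the bound. *)
pose Q := [set p in setX NC NC | (#|mix p| <= a)%N].
have mixE A A' : (#|mix (A, A')| + #|mix (A', A)| = #|A| + #|A'|)%N.
  have cU X Y : #|mix (X, Y)| = (#|X :&: I| + #|Y :\: I|)%N.
    rewrite /mix /= -cardsUI [X in (_ + X)%N](_ : _ = 0%N) ?addn0 //.
    by apply/eqP; rewrite cards_eq0; apply/eqP/setP => v; rewrite !inE; case: (v \in I); rewrite ?andbF.
  by rewrite !cU -(cardsID I A) -(cardsID I A'); lia.
have cover : setX NC NC \subset Q :|: (fun p => (p.2, p.1)) @: Q.
  apply/subsetP => -[A A'] AA; have : (#|mix (A, A')| <= a)%N || (#|mix (A', A)| <= a)%N.
    move: AA; rewrite !inE /= => /andP[/andP[/eqP cA _] /andP[/eqP cA' _]].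
    by have := mixE A A'; rewrite cA cA'; case: leqP => //=; lia.
  case/orP => h; rewrite inE; apply/orP; [left|right]; first by rewrite inE AA.
  apply/imsetP; exists (A', A) => //; rewrite inE h andbT.
  by move: AA; rewrite !in_setX /= andbC.
have cQ : (#|Q| <= subsets_le a * subsets_le (4 * b))%N.
  rewrite -(card_imset (mem Q) inj) -cardsX; apply: subset_leq_card.
  apply/subsetP => _ /imsetP[p pQ ->]; rewrite in_setX !inE /=.
  move: pQ; rewrite inE => /andP[pN ->] /=; move: pN; rewrite !inE.
  move=> /andP[/andP[_ c1] /andP[_ c2]]; apply: leq_trans (leq_card_setU _ _) _.
  have -> : (4 * b = 2 * b + 2 * b)%N by lia.
  apply: leq_add.
    apply: leq_trans (subset_leq_card (subsetDl _ _)) (leq_trans (mis_le _) _).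
    by rewrite leq_mul2l.
  apply: leq_trans (subset_leq_card (subsetIl _ _)) (leq_trans (mis_le _) _).
  by rewrite leq_mul2l.
rewrite -mulnn -cardsX; apply: leq_trans (subset_leq_card cover) _.
apply: leq_trans (leq_card_setU _ _) _.
rewrite mul2n -addnn; have cQ' := leq_trans (leq_imset_card (fun p => (p.2, p.1)) (mem Q)) cQ.
exact: leq_add cQ cQ'.
Qed.

(** A set containing exactly one end of an edge has a positive cut. This serves the graphs that are
    too small for the counting estimate. *)
Lemma small_cut_sets_proper a : (0 < a)%N -> (a < #|T|)%N ->
  (#|small_cut_sets E a 0| < 'C(#|T|, a))%N.
Proof.
move=> a0 aT; have [u _] : exists u : T, true.
  by have /card_gt0P[u _] : (0 < #|T|)%N by [lia]; exists u.
have [v uv] := E_nbr u.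
have uv' : u != v by apply/eqP => uvE; move: (E_irr u); rewrite {2}uvE uv.
pose B := ~: [set u; v].
have cB : #|B| = (#|T| - 2)%N by rewrite cardsCs setCK cards2 uv'.
have : (0 < #|[set A : {set T} | A \subset B & #|A| == a.-1]|)%N.
  by rewrite cards_draws bin_gt0 cB; lia.
case/card_gt0P => A; rewrite inE => /andP[AB /eqP cA].
have uA : u \notin A by apply/negP => /(subsetP AB); rewrite !inE eqxx.
have vA : v \notin A by apply/negP => /(subsetP AB); rewrite !inE eqxx orbT.
have cuA : #|u |: A| = a by rewrite cardsU1 uA cA; lia.
rewrite -card_draws; apply: proper_card; apply/properP; split.
  by apply/subsetP => X; rewrite !inE => /andP[].
exists (u |: A); first by rewrite inE cuA.
rewrite inE cuA eqxx /= -ltnNge; apply/card_gt0P; exists (u, v).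
by rewrite !inE /= uv eqxx /= negb_or eq_sym uv' vA.
Qed.

End OneGraph.

Section Symmetry.
Variable Om : {set {set T * T}}.
Definition relabel x y E : {set T * T} :=
  [set (tperm x y e.1, tperm x y e.2) | e in E].
Hypothesis Om_relabel : forall x y E, E \in Om -> relabel x y E \in Om.

Definition small_cut_graphs A b : {set {set T * T}} := [set E in Om | (cut E A <= b)%N].

Lemma mem_relabel x y E u v :
  ((u, v) \in relabel x y E) = ((tperm x y u, tperm x y v) \in E).
Proof.
apply/imsetP/idP => [[[a b] abE [-> ->]]|h]; first by rewrite !tpermK.
by exists (tperm x y u, tperm x y v); rewrite //= !tpermK.
Qed.

Lemma relabelK x y : involutive (relabel x y).
Proof. by move=> E; apply/setP => -[u v]; rewrite !mem_relabel !tpermK. Qed.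

Lemma cut_relabel x y E A : cut (relabel x y E) (tperm x y @: A) = cut E A.
Proof.
have inj : injective (fun e : T * T => (tperm x y e.1, tperm x y e.2)).
  by move=> [a b] [c d] [/perm_inj -> /perm_inj ->].
rewrite /cut -[RHS](card_imset _ inj); apply: eq_card => -[u v].
rewrite !inE mem_relabel /=.
have tA w : (w \in tperm x y @: A) = (tperm x y w \in A).
  apply/imsetP/idP => [[z zA ->]|h]; first by rewrite tpermK.
  by exists (tperm x y w); rewrite // tpermK.
rewrite !tA; apply/idP/imsetP => [h|[[a b]]].
  by exists (tperm x y u, tperm x y v); rewrite /= ?tpermK // inE.
by rewrite inE /= => h [-> ->]; rewrite !tpermK.
Qed.

Lemma card_small_cut_graphs_tperm x y A b :
  #|small_cut_graphs (tperm x y @: A) b| = #|small_cut_graphs A b|.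
Proof.
rewrite -[RHS](card_imset _ (inv_inj (@relabelK x y))); apply: eq_card => E.
apply/idP/imsetP => [|[F]].
  rewrite inE => /andP[EO cE]; exists (relabel x y E); last by rewrite relabelK.
  by rewrite inE Om_relabel // -(cut_relabel x y) relabelK.
by rewrite inE => /andP[FO cF] ->; rewrite inE Om_relabel // cut_relabel.
Qed.

(** Transposing an element of [A :\: B] with one of [B :\: A] moves [A] one step towards [B] and
    only relabels the graphs. *)
Lemma card_small_cut_graphs A B b : #|A| = #|B| ->
  #|small_cut_graphs A b| = #|small_cut_graphs B b|.
Proof.
move: {2}#|A :\: B| (leqnn #|A :\: B|) => k; elim: k A => [|k IH] A.
  rewrite leqn0 cards_eq0 setD_eq0 => AB cAB; congr #|pred_of_set (small_cut_graphs _ _)|.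
  by apply/eqP; rewrite eqEcard AB cAB /=.
move=> le cAB; have [|/set0Pn[x xAB]] := eqVneq (A :\: B) set0.
  by move=> AB0; apply: IH => //; rewrite AB0 cards0.
have [y yBA] : exists y, y \in B :\: A.
  apply/set0Pn; rewrite -card_gt0.
  have := cardsID B A; have := cardsID A B; rewrite setIC.
  have : (0 < #|A :\: B|)%N by apply/card_gt0P; exists x.
  lia.
move: xAB yBA; rewrite !inE => /andP[xB xA] /andP[yA yB].
rewrite -(card_small_cut_graphs_tperm x y); apply: IH; last by rewrite card_imset //; apply: perm_inj.
rewrite -ltnS; apply: leq_trans le; apply: proper_card; apply/properP; split.
  apply/subsetP => z; rewrite !inE => /andP[zB /imsetP[w wA zE]].
  move: zB zE; case: tpermP => [wx zB zE|wy zB zE|_ _ zB zE]; last by rewrite zB zE wA.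
    by move: zB; rewrite zE yB.
  by move: yA; rewrite -wy wA.
exists x; rewrite !inE ?xB ?xA //=; apply/negP => /imsetP[w wA].
case: tpermP => [_ xy|wy _|wx wy xE].
- by move: xB; rewrite xy yB.
- by move: yA; rewrite -wy wA.
- by case: wx; rewrite xE.
Qed.

(** Double counting of pairs of a graph and a set of fixed size: the probability for one set becomes
    an average of counts that are bounded graph by graph. *)
Lemma sum_small_cut A b :
  ('C(#|T|, #|A|) * #|small_cut_graphs A b| = \sum_(E in Om) #|small_cut_sets E #|A| b|)%N.
Proof.
have -> : (\sum_(E in Om) #|small_cut_sets E #|A| b|
    = \sum_(E in Om) \sum_(B : {set T} | (#|B| == #|A|) && (cut E B <= b)) 1)%N.
  by apply: eq_bigr => E _; rewrite sum1dep_card; apply: eq_card => B; rewrite !inE.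
rewrite (exchange_big_dep (fun B : {set T} => #|B| == #|A|)) /=; last by move=> E B _ /andP[].
rewrite (eq_bigr (fun=> #|small_cut_graphs A b|)); last first.
  move=> B /eqP cB; rewrite (@card_small_cut_graphs A B b) // sum1dep_card.
  by apply: eq_card => E; rewrite !inE cB eqxx.
by rewrite sum_nat_const -card_draws; congr muln; apply: eq_card => B; rewrite !inE.
Qed.

End Symmetry.

End Cuts.

(** * Binomial coefficients and numbers of small sets *)

Lemma log_budget (R : realType) (S c a y z : R) :
  S <= c * z + a / 32 -> c * z <= c * (63 * y) -> c * 4032 * y <= 4 * a * y ->
  a * 2^-1 <= a * y -> 8 * S <= a * y.
Proof. by move=> *; lra. Qed.

Section BinomialBounds.

Lemma bin_leS n i : (2 * i < n)%N -> ('C(n, i) <= 'C(n, i.+1))%N.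
Proof.
move=> h; have := mul_bin_left n i => e.
rewrite -(leq_pmul2l (ltn0Sn i)) e leq_mul2r; apply/orP; right; lia.
Qed.

Lemma bin_le_half n i a : (i <= a)%N -> (2 * a <= n)%N -> ('C(n, i) <= 'C(n, a))%N.
Proof.
move=> /subnKC <-; elim: (a - i)%N => [|k IH] h; first by rewrite addn0.
apply: (@leq_trans 'C(n, i + k)); first by apply: IH; lia.
by rewrite addnS; apply: bin_leS; lia.
Qed.

Lemma bin_ge_size n a : (0 < a)%N -> (2 * a <= n)%N -> (n <= 'C(n, a))%N.
Proof. by move=> a0 h; rewrite -{1}(bin1 n); apply: bin_le_half. Qed.

Lemma bin_ge_ratio n a : (a <= n)%N -> (n ^ a <= a ^ a * 'C(n, a))%N.
Proof.
elim: a n => [|a IH] [|n] // an; have := IH n an => {}IH.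
have e := mul_bin_diag n.+1 a; rewrite /= in e.
rewrite [(a.+1 ^ _)%N]expnSr -mulnA -e mulnCA expnS leq_mul2l; apply/orP; right.
have [->|a0] := posnP a; first by rewrite !expn0 bin0.
have aa : (0 < a ^ a)%N by rewrite expn_gt0 a0.
rewrite -(leq_pmul2l aa).
apply: (@leq_trans (a.+1 ^ a * n ^ a)); first by rewrite -!expnMn leq_exp2r //; lia.
by rewrite mulnCA leq_mul2l; apply/orP; right.
Qed.

Lemma bin_ge_pow2 n a : (2 * a <= n)%N -> (2 ^ a <= 'C(n, a))%N.
Proof.
have [->|a0] := posnP a; first by rewrite bin0.
move=> h; have aa : (0 < a ^ a)%N by rewrite expn_gt0 a0.
rewrite -(leq_pmul2l aa); apply: leq_trans (bin_ge_ratio _); last by lia.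
by rewrite -expnMn leq_exp2r // mulnC.
Qed.

Variables (R : realType) (T : finType).

Lemma subsets_leE c : subsets_le T c = (\sum_(i < c.+1) 'C(#|T|, i))%N.
Proof.
rewrite /subsets_le -sum1_card.
rewrite (partition_big (fun A : {set T} => inord #|A| : 'I_c.+1) predT) //=.
apply: eq_bigr => i _; rewrite sum1dep_card -card_draws; apply: eq_card => A.
rewrite !inE; apply/andP/idP => [[le /eqP <-]|/eqP e].
  by rewrite inordK.
by rewrite e -ltnS ltn_ord; split=> //; apply/eqP/val_inj; rewrite /= inordK.
Qed.

Lemma subsets_le_bin c : (2 * c <= #|T|)%N ->
  (subsets_le T c <= c.+1 * 'C(#|T|, c))%N.
Proof.
move=> h; rewrite subsets_leE.
apply: (@leq_trans (\sum_(i < c.+1) 'C(#|T|, c))); last by rewrite sum_nat_const card_ord.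
by apply: leq_sum => i _; apply: bin_le_half; rewrite // -ltnS.
Qed.

Lemma subsets_le_gt0 c : (0 < subsets_le T c)%N.
Proof. by apply/card_gt0P; exists set0; rewrite inE cards0. Qed.

(** Chernoff's argument: [u ^+ c] is at most [u ^+ i] for [i <= c], and the sum over all sizes is
    [(1 + u) ^+ #|T|]. *)
Lemma subsets_le_exp (u : R) c : 0 <= u <= 1 -> (c <= #|T|)%N ->
  (subsets_le T c)%:R * u ^+ c <= expR (u * #|T|%:R).
Proof.
move=> /andP[u0 u1] cT; apply: (@le_trans _ _ ((1 + u) ^+ #|T|)); last first.
  rewrite expRM_natr; apply: lerXn2r; rewrite ?nnegrE ?expR_ge0 //; first by lra.
  exact: expR_ge1Dx.
rewrite exprDn subsets_leE natr_sum mulr_suml.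
have -> : \sum_(i < #|T|.+1) 1 ^+ (#|T| - i) * u ^+ i *+ 'C(#|T|, i)
    = \sum_(i < #|T|.+1) 'C(#|T|, i)%:R * u ^+ i.
  by apply: eq_bigr => i _; rewrite expr1n mul1r mulr_natl.
rewrite -(big_mkord xpredT (fun i => 'C(#|T|, i)%:R * u ^+ i)).
rewrite (big_cat_nat (n := c.+1)) //= big_mkord.
apply: (@le_trans _ _ (\sum_(i < c.+1) 'C(#|T|, i)%:R * u ^+ i)).
  apply: ler_sum => i _; apply: ler_wpM2l; first exact: ler0n.
  by apply: ler_wiXn2l => //; rewrite -ltnS.
by rewrite lerDl; apply: sumr_ge0 => i _; rewrite mulr_ge0 ?exprn_ge0 ?ler0n.
Qed.

Lemma half_le_ln2 : 2^-1 <= ln 2 :> R.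
Proof.
rewrite -(expRK 2^-1) ler_ln ?posrE ?expR_gt0 //.
have h : 2^-1 <= expR (- 2^-1) :> R by apply: le_trans (expR_ge1Dx _); lra.
rewrite -[expR _]invrK -expRN -[leRHS]invrK lef_pV2 ?posrE ?expR_gt0 ?invr_gt0 //.
Qed.

Lemma ln_le_sub1 (z : R) : 0 < z -> ln z <= z - 1.
Proof.
move=> z0; rewrite -[leRHS]expRK ler_ln ?posrE ?expR_gt0 //.
by apply: le_trans (expR_ge1Dx _); lra.
Qed.

Lemma ln32_le31 : ln 32 <= 31 :> R.
Proof. by apply: le_trans (ln_le_sub1 _) _; lra. Qed.

(** With [y = n / a] the binomial is at least [y ^+ a]. For [u = (32 * y)^-1] the exponential term
    contributes [8 * a / 32], within half of [a * ln y] because [ln y >= 1 / 2]. The other half must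
    hold [8 * c * 63 * ln y] with [c <= 4 * a / J], which asks for [J >= 64 * 63 = 4032]. *)
Lemma subsets_le_pow8 J a : 4032 <= J%:R :> R -> (0 < a)%N -> (2 * a <= #|T|)%N ->
  (subsets_le T (4 * (a %/ J)) ^ 8 <= 'C(#|T|, a))%N.
Proof.
move=> J_ge a0 aT; set c := (4 * (a %/ J))%N; set n := #|T| in aT *.
have aR : 0 < a%:R :> R by rewrite ltr0n.
have nR : 0 < n%:R :> R by rewrite ltr0n; nat_lia.
pose y : R := n%:R / a%:R.
have y2 : 2 <= y by rewrite /y ler_pdivlMr // -natrM ler_nat.
have y0 : 0 < y by lra.
have lny : 2^-1 <= ln y by apply: le_trans half_le_ln2 _; rewrite ler_ln ?posrE.
have cJ : c%:R * J%:R <= 4 * a%:R :> R.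
  by rewrite -!natrM ler_nat -mulnA leq_mul2l leq_divM.
have JR : 0 < J%:R :> R by lra.
have ca : (c <= n)%N.
  suff : c%:R <= a%:R :> R by rewrite ler_nat => ca; apply: leq_trans ca _; nat_lia.
  have c0 : 0 <= c%:R :> R by exact: ler0n.
  have := ler_wpM2l c0 J_ge; lra.
pose u : R := (32 * y)^-1.
have u32 : 0 < 32 * y by lra.
have u01 : 0 <= u <= 1.
  by rewrite /u invr_ge0 ltW //= invf_le1 //; lra.
have u_gt0 : 0 < u by rewrite invr_gt0.
have S0 : 0 < (subsets_le T c)%:R :> R by rewrite ltr0n subsets_le_gt0.
have := subsets_le_exp u01 ca; rewrite -/n => hS.
have lnS : ln (subsets_le T c)%:R <= c%:R * ln (32 * y) + a%:R / 32.
  have uc : 0 < u ^+ c by rewrite exprn_gt0.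
  have : ln ((subsets_le T c)%:R * u ^+ c) <= u * n%:R.
    by rewrite -[leRHS]expRK ler_ln ?posrE ?expR_gt0 ?mulr_gt0.
  rewrite lnM ?posrE // lnXn // /u lnV ?posrE // -mulr_natl.
  have -> : (32 * y)^-1 * n%:R = a%:R / 32.
    by rewrite /y; field; rewrite !gt_eqF.
  lra.
have ln32 : ln (32 * y) <= 63 * ln y.
  rewrite lnM ?posrE //; have := ln32_le31; lra.
have l0 : 0 <= ln y by lra.
have key : 8 * ln (subsets_le T c)%:R <= a%:R * ln y.
  have c0 : 0 <= c%:R :> R by exact: ler0n.
  have h1 := ler_wpM2l c0 ln32.
  have h2 : c%:R * 4032 <= 4 * a%:R :> R.
    by apply: le_trans cJ; apply: ler_wpM2l.
  exact: log_budget lnS h1 (ler_wpM2r l0 h2) (ler_wpM2l (ltW aR) lny).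
have : (subsets_le T c)%:R ^+ 8 <= y ^+ a.
  rewrite -ler_ln ?posrE ?exprn_gt0 // !lnXn //.
  by rewrite -[leLHS]mulr_natl -[leRHS]mulr_natl; exact: key.
move=> h; have : (subsets_le T c ^ 8)%:R <= ('C(n, a))%:R :> R; last by rewrite ler_nat.
rewrite natrX; apply: le_trans h _; rewrite /y expr_div_n ler_pdivrMr ?exprn_gt0 //.
rewrite -!natrX -natrM ler_nat mulnC; apply: bin_ge_ratio; nat_lia.
Qed.

(** For [a <= 16] the binomial is at least [n0]. Beyond, it is at least [2 ^ a], whose cube grows by
    [8] per step, while the left side grows by at most [(5 / 4) ^+ 8 < 8]. *)
Lemma pow8_le_bin_cube n0 n a : 256 * 17 ^+ 8 <= n0%:R ^+ 3 :> R -> (n0 <= n)%N ->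
  (0 < a)%N -> (2 * a <= n)%N -> 256 * (a.+1)%:R ^+ 8 <= 'C(n, a)%:R ^+ 3 :> R.
Proof.
move=> hn0 n0n a0 an; have [a16|a16] := leqP a 16.
  apply: (@le_trans _ _ (256 * 17 ^+ 8)).
    rewrite ler_pM2l //; apply: lerXn2r; rewrite ?nnegrE ?ler0n //.
    by rewrite ler_nat.
  apply: le_trans hn0 _; apply: lerXn2r; rewrite ?nnegrE ?ler0n //.
  by rewrite ler_nat; apply: leq_trans n0n (bin_ge_size a0 an).
apply: (@le_trans _ _ ((2 ^+ a) ^+ 3)); last first.
  apply: lerXn2r; rewrite ?nnegrE ?ler0n ?exprn_ge0 //.
  by rewrite -natrX ler_nat bin_ge_pow2.
have -> : a = (16 + (a - 16))%N by lia.
elim: (a - 16)%N => [|k IH]; first by rewrite addn0 -exprM; lra.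
rewrite addnS [2 ^+ (16 + k).+1]exprS exprMn.
apply: (@le_trans _ _ (8 * (256 * (16 + k).+1%:R ^+ 8))).
  have -> : 8 * (256 * (16 + k).+1%:R ^+ 8) = 256 * (8 * (16 + k).+1%:R ^+ 8) :> R by ring.
  rewrite ler_pM2l //; apply: (@le_trans _ _ ((5 / 4 * (16 + k).+1%:R) ^+ 8)).
    move: (16 + k)%N (leq_addr k 16) => w w16.
    have w17 : 17 <= w.+1%:R :> R by rewrite ler_nat.
    have wS : w.+2%:R = w.+1%:R + 1 :> R by rewrite natr1.
    by apply: lerXn2r; rewrite ?nnegrE ?wS; lra.
  rewrite exprMn; apply: ler_wpM2r; first by rewrite exprn_ge0 ?ler0n.
  lra.
have -> : 2 ^+ 3 = 8 :> R by ring.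
by rewrite ler_pM2l.
Qed.

End BinomialBounds.

(** * Averages over independent graphs *)

Section Average.
Variables (R : realType) (G : finType) (Om : {set G}).
Implicit Types (F : seq G -> R).

(** The expectation over [N] independent uniform elements of [Om]; lists let a block of graphs be
    split off by concatenation. *)
Fixpoint avg N F : R :=
  if N is N'.+1 then (\sum_(E in Om) avg N' (fun l => F (E :: l))) / #|Om|%:R
  else F [::].

Hypothesis Om_gt0 : (0 < #|Om|)%N.

Let OmR : 0 < #|Om|%:R :> R. Proof. by rewrite ltr0n. Qed.

Lemma avg_le N F1 F2 : (forall l, size l = N -> all (mem Om) l -> F1 l <= F2 l) ->
  avg N F1 <= avg N F2.
Proof.
elim: N F1 F2 => [|N IH] F1 F2 h /=; first exact: h.
rewrite ler_pM2r ?invr_gt0 //; apply: ler_sum => E EO; apply: IH => l sl al.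
by apply: h; rewrite /= ?sl ?al ?andbT.
Qed.

Lemma avg_const N c : avg N (fun=> c) = c.
Proof.
elim: N => //= N ->; rewrite sumr_const -[X in X / _]mulr_natr mulfK //.
by rewrite gt_eqF.
Qed.

Lemma avg_lin N (c : R) F1 F2 : avg N (fun l => F1 l + c * F2 l) = avg N F1 + c * avg N F2.
Proof.
elim: N F1 F2 => //= N IH F1 F2; under eq_bigr do rewrite IH.
by rewrite big_split /= -mulr_sumr mulrDl mulrA.
Qed.

Lemma avg_sum N (I : finType) (P : pred I) (F : I -> seq G -> R) :
  avg N (fun l => \sum_(i | P i) F i l) = \sum_(i | P i) avg N (F i).
Proof.
elim: N F => //= N IH F; under eq_bigr do rewrite IH.
by rewrite exchange_big /= mulr_suml.
Qed.

Lemma avg_cat N1 N2 F :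
  avg (N1 + N2) F = avg N1 (fun l1 => avg N2 (fun l2 => F (l1 ++ l2))).
Proof.
elim: N1 F => //= N1 IH F; congr (_ / _); apply: eq_bigr => E _.
by rewrite (IH (fun l => F (E :: l))).
Qed.

Lemma avg_all N (P : pred G) :
  avg N (fun l => (all P l)%:R) = (#|[set E in Om | P E]|%:R / #|Om|%:R) ^+ N.
Proof.
elim: N => [|N IH] /=; first by rewrite expr0.
rewrite exprS -IH mulrAC; congr (_ / _).
rewrite (bigID P) /= [X in _ + X]big1 ?addr0; last first.
  move=> E /andP[_ /negbTE nP].
  rewrite -[RHS](avg_const N 0); congr avg; apply/funext => l; by rewrite nP.
rewrite (eq_bigr (fun=> avg N (fun l => (all P l)%:R))); last first.
  by move=> E /andP[_ PE]; congr avg; apply/funext => l; rewrite PE.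
rewrite sumr_const -[LHS]mulr_natl; congr (_%:R * _).
by apply: eq_card => E; rewrite !inE.
Qed.

Lemma avg_family N F :
  (\sum_(g in family (fun _ : 'I_N => mem Om)) F [seq g i | i <- enum 'I_N])
    / (#|Om| ^ N)%:R = avg N F.
Proof.
elim: N F => [|N IH] F /=.
  have en : enum 'I_0 = [::] by apply: size0nil; rewrite size_enum_ord.
  rewrite expn0 divr1 (eq_bigr (fun=> F [::])) => [|g _]; last by rewrite en.
  by rewrite sumr_const card_family (_ : image _ _ = [::]) // /image_mem en.
pose h (p : G * {ffun 'I_N -> G}) : {ffun 'I_N.+1 -> G} :=
  [ffun i => if unlift ord0 i is Some j then p.2 j else p.1].
pose h' (f : {ffun 'I_N.+1 -> G}) := (f ord0, [ffun j => f (lift ord0 j)]).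
have hK : cancel h h'.
  move=> [E g]; rewrite /h' /h ffunE unlift_none /=; congr (_, _); apply/ffunP => j.
  by rewrite !ffunE liftK.
have h'K : cancel h' h.
  move=> f; apply/ffunP => i; rewrite /h ffunE /=.
  by case: unliftP => [j ->|->]; rewrite ?ffunE.
rewrite (reindex h); last by apply: onW_bij; exists h'.
have mem_h E g : (h (E, g) \in family (fun _ : 'I_N.+1 => mem Om))
    = (E \in Om) && (g \in family (fun _ : 'I_N => mem Om)).
  apply/familyP/andP => [fh|[EO /familyP gO] i].
    split; first by have := fh ord0; rewrite ffunE unlift_none.
    by apply/familyP => j; have := fh (lift ord0 j); rewrite ffunE liftK.
  by rewrite ffunE; case: unliftP => [j _|_].
have seq_h E g : [seq h (E, g) i | i <- enum 'I_N.+1] = E :: [seq g i | i <- enum 'I_N].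
  rewrite enum_ordSl /= ffunE unlift_none -map_comp; congr (_ :: _).
  by apply: eq_map => j; rewrite /= ffunE liftK.
have -> : \sum_(p | h p \in family (fun _ : 'I_N.+1 => mem Om))
      F [seq h p i | i <- enum 'I_N.+1]
    = \sum_(E in Om) \sum_(g in family (fun _ : 'I_N => mem Om))
      F (E :: [seq g i | i <- enum 'I_N]).
  rewrite pair_big_dep; apply: eq_big => [[E g]|[E g] _]; first exact: mem_h.
  by rewrite seq_h.
rewrite expnS natrM invfM mulrA [X in X / _]mulrC -mulrA mulrC; congr (_ / _).
rewrite mulr_suml; apply: eq_bigr => E _; rewrite -IH //.
Qed.

End Average.

(** The union of a block that is not bad expands by at least [J^-1]. The integer quotient vanishes
    on sets with fewer than [J] vertices, where a single cut edge is enough. *)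
Definition bad_block (T : finType) J (l : seq {set T * T}) : bool :=
  [exists A : {set T}, [&& (0 < #|A|)%N, (2 * #|A| <= #|T|)%N
                         & all (fun E => (cut E A <= #|A| %/ J)%N) l]].

(** * The probability of a bad block *)

Section BadBlocks.
Variables (R : realType) (T : finType) (Om : {set {set T * T}}).
Hypothesis Om_gt0 : (0 < #|Om|)%N.
Hypothesis Om_relabel : forall x y E, E \in Om -> relabel x y E \in Om.
Hypothesis Om_irr : forall E u, E \in Om -> (u, u) \notin E.
Hypothesis Om_sym : forall E u v, E \in Om -> ((u, v) \in E) = ((v, u) \in E).
Hypothesis Om_nbr : forall E u, E \in Om -> exists v, (u, v) \in E.

Local Notation n := #|T|.

Definition cut_prob (A : {set T}) b : R := #|small_cut_graphs Om A b|%:R / #|Om|%:R.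

Let OmR : 0 < #|Om|%:R :> R. Proof. by rewrite ltr0n. Qed.

Lemma cut_prob_ge0 A b : 0 <= cut_prob A b.
Proof. by rewrite divr_ge0 ?ler0n. Qed.

Lemma cut_prob_le1 A b : cut_prob A b <= 1.
Proof.
rewrite ler_pdivrMr // mul1r ler_nat; apply: subset_leq_card.
by apply/subsetP => E; rewrite inE => /andP[].
Qed.

(** Bounding the average count by the maximal one, the squared probability is at most
    [2 * w * s / c]. Its square is at most [c^-1] once [4 * w ^+ 2 * s ^+ 2 <= c]; the fourth power
    of this condition explains the [256], the eighth powers and the cube in the two preceding
    estimates. *)
Lemma cut_prob_large J n0 (A : {set T}) : 4032 <= J%:R :> R -> 256 * 17 ^+ 8 <= n0%:R ^+ 3 :> R ->
  (n0 <= n)%N -> (0 < #|A|)%N -> (2 * #|A| <= n)%N ->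
  cut_prob A (#|A| %/ J) ^+ 4 <= 'C(n, #|A|)%:R^-1.
Proof.
move=> hJ hn0 n0n a0 an; set a := #|A|; set b := (a %/ J)%N.
set C := 'C(n, a); set N := #|small_cut_graphs Om A b|.
set S4 := subsets_le T (4 * b).
have C0 : (0 < C)%N by rewrite bin_gt0; nat_lia.
have C0R : 0 < C%:R :> R by rewrite ltr0n.
have /card_gt0P[E0 E0O] := Om_gt0.
have sumN : (C * N = \sum_(E in Om) #|small_cut_sets E a b|)%N by exact: sum_small_cut.
case: (arg_maxnP (fun E => #|small_cut_sets E a b|) E0O) => Em EmO Emax.
set mx := #|small_cut_sets Em a b| in Emax.
have CN : (C * N <= #|Om| * mx)%N.
  rewrite sumN -sum_nat_const; apply: leq_sum => E EO; exact: Emax.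
have mx2 : (mx ^ 2 <= 2 * (a.+1 * C * S4))%N.
  apply: leq_trans (card_small_cut_sets _ _ _ _ _) _.
  - by move=> u; apply: Om_irr.
  - by move=> u v; apply: Om_sym.
  - by move=> u; apply: Om_nbr.
  by rewrite leq_mul2l /= leq_mul2r; apply/orP; right; apply: subsets_le_bin.
have S8 : (S4 ^ 8 <= C)%N by exact: (subsets_le_pow8 hJ).
have cube := pow8_le_bin_cube hn0 n0n a0 an.
pose s : R := S4%:R; pose c : R := C%:R; pose m : R := mx%:R.
pose w : R := a.+1%:R; pose o : R := #|Om|%:R; pose z : R := N%:R.
have s0 : 0 <= s by exact: ler0n.
have w0 : 0 <= w by exact: ler0n.
have c0 : 0 < c by [].
have key : 4 * w ^+ 2 * s ^+ 2 <= c.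
  have p0 : 0 <= 4 * w ^+ 2 * s ^+ 2 by rewrite !mulr_ge0 // sqr_ge0.
  rewrite -(@ler_pXn2r _ 4) ?nnegrE ?(ltW c0) //.
  have -> : (4 * w ^+ 2 * s ^+ 2) ^+ 4 = (256 * w ^+ 8) * s ^+ 8 by ring.
  have -> : c ^+ 4 = c ^+ 3 * c by ring.
  apply: ler_pM; rewrite ?mulr_ge0 ?exprn_ge0 //.
  by rewrite /s /c -natrX ler_nat.
have h1 : c * z <= o * m by rewrite /c /z /o /m -!natrM ler_nat.
have h2 : m ^+ 2 <= 2 * (w * c * s).
  by rewrite /m /w /c /s -natrX -!natrM ler_nat.
have z0 : 0 <= z by exact: ler0n.
have o0 : 0 < o by [].
have m0 : 0 <= m by exact: ler0n.
have h3 : c * z ^+ 2 <= o ^+ 2 * (2 * w * s).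
  rewrite -(ler_pM2l c0); apply: (@le_trans _ _ ((o * m) ^+ 2)).
    have -> : c * (c * z ^+ 2) = (c * z) ^+ 2 by ring.
    by apply: lerXn2r => //; rewrite nnegrE mulr_ge0 // ltW.
  rewrite exprMn; have -> : c * (o ^+ 2 * (2 * w * s)) = o ^+ 2 * (2 * (w * c * s)) by ring.
  by apply: ler_wpM2l => //; apply: sqr_ge0.
have h4 : c * z ^+ 4 <= o ^+ 4.
  rewrite -(ler_pM2l c0); apply: (@le_trans _ _ ((o ^+ 2 * (2 * w * s)) ^+ 2)).
    have -> : c * (c * z ^+ 4) = (c * z ^+ 2) ^+ 2 by ring.
    apply: lerXn2r => //; rewrite nnegrE ?mulr_ge0 ?sqr_ge0 //; exact: ltW.
  have -> : (o ^+ 2 * (2 * w * s)) ^+ 2 = (4 * w ^+ 2 * s ^+ 2) * o ^+ 4 by ring.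
  by apply: ler_wpM2r => //; rewrite exprn_ge0 // ltW.
rewrite /cut_prob -/N -/z -/o -/c expr_div_n ler_pdivrMr ?exprn_gt0 //.
by rewrite mulrC ler_pdivlMr // mulrC.
Qed.

Lemma cut_prob_no_cut (A : {set T}) : (0 < #|A|)%N -> (2 * #|A| <= n)%N ->
  cut_prob A 0 <= 1 - 'C(n, #|A|)%:R^-1.
Proof.
move=> a0 an; set C := 'C(n, #|A|); set N := #|small_cut_graphs Om A 0|.
have C0 : (0 < C)%N by rewrite bin_gt0; nat_lia.
have CN : (C * N <= #|Om| * C.-1)%N.
  rewrite sum_small_cut // -sum_nat_const; apply: leq_sum => E EO.
  rewrite -ltnS prednK //; apply: small_cut_sets_proper => //.
  - by move=> u; apply: Om_irr.
  - by move=> u; apply: Om_nbr.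
  - by nat_lia.
have C0R : 0 < C%:R :> R by rewrite ltr0n.
rewrite ler_pdivrMr // -/N -(ler_pM2l C0R).
have -> : C%:R * ((1 - C%:R^-1) * #|Om|%:R) = #|Om|%:R * (C%:R - 1) :> R.
  by field; rewrite gt_eqF.
by rewrite -natrM; have -> : C%:R - 1 = C.-1%:R :> R; rewrite -?natrM ?ler_nat // -subn1 natrB.
Qed.

(** A union bound organized by size: for each of the [n] possible sizes, the sets of that size
    contribute at most [(2 * n)^-1] together. *)
Lemma avg_bad_block J k :
  (forall A : {set T}, (0 < #|A|)%N -> (2 * #|A| <= n)%N ->
     'C(n, #|A|)%:R * cut_prob A (#|A| %/ J) ^+ k <= (2 * n%:R)^-1) ->
  avg Om k (fun l => (bad_block J l)%:R) <= 2^-1 :> R.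
Proof.
move=> h; pose PA (A : {set T}) := (0 < #|A|)%N && (2 * #|A| <= n)%N.
apply: (@le_trans _ _ (avg Om k (fun l => \sum_(A : {set T} | PA A)
    (all (fun E => (cut E A <= #|A| %/ J)%N) l)%:R))).
  apply: avg_le => // l _ _; case: (boolP (bad_block J l)) => [|_]; last first.
    by apply: sumr_ge0 => A _; rewrite ler0n.
  move=> /existsP[A /and3P[a0 an al]]; rewrite (bigD1 A) /=; last by rewrite /PA a0.
  by rewrite al lerDl; apply: sumr_ge0 => B _; rewrite ler0n.
rewrite avg_sum; under eq_bigr do rewrite avg_all //.
have [n0|n0] := posnP n.
  rewrite big_pred0; first by rewrite invr_ge0.
  by move=> A; rewrite /PA; have := max_card (mem A); rewrite n0 leqn0 => /eqP ->.
have nR : 0 < n%:R :> R by rewrite ltr0n.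
apply: (@le_trans _ _ (\sum_(A : {set T} | PA A) ((2 * n%:R) * 'C(n, #|A|)%:R)^-1)).
  apply: ler_sum => A /andP[a0 an].
  have C0 : 0 < 'C(n, #|A|)%:R :> R by rewrite ltr0n bin_gt0; nat_lia.
  rewrite invfM ler_pdivlMr // [leLHS]mulrC; exact: h.
rewrite (partition_big (fun A : {set T} => inord #|A| : 'I_n.+1) predT) //=.
apply: (@le_trans _ _ (\sum_(a < n.+1) (if (a == 0 :> nat)%N then 0 else (2 * n%:R)^-1))).
  apply: ler_sum => a _; case: ifP => [/eqP a0|/negbT a0].
    rewrite big_pred0 // => A; apply/negP => /andP[/andP[A0 _] /eqP eA].
    move: a0; rewrite -eA inordK ?ltnS ?max_card // => A0'; by rewrite A0' in A0.
  apply: (@le_trans _ _ (\sum_(A : {set T} | #|A| == a) ((2 * n%:R) * 'C(n, a)%:R)^-1)).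
    rewrite big_mkcond [leRHS]big_mkcond; apply: ler_sum => A _.
    case: ifP => [/andP[_ /eqP eA]|_]; last first.
      by case: ifP => // _; rewrite invr_ge0 !mulr_ge0 ?ler0n.
    have -> : #|A| == a by rewrite -eA inordK // ltnS max_card.
    by rewrite -eA inordK // ltnS max_card.
  rewrite sumr_const -[leLHS]mulr_natl.
  have -> : #|[pred A : {set T} | #|A| == a]| = 'C(n, a).
    by rewrite -card_draws; apply: eq_card => A; rewrite !inE.
  rewrite invfM mulrCA; have C0 : 'C(n, a)%:R != 0 :> R.
    by rewrite pnatr_eq0 -lt0n bin_gt0 -ltnS.
  by rewrite mulfV // mulr1.
rewrite big_ord_recl /= add0r (eq_bigr (fun=> (2 * n%:R)^-1)) // sumr_const card_ord.
rewrite -[leLHS]mulr_natl le_eqVlt; apply/orP; left; apply/eqP.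
by field; rewrite gt_eqF.
Qed.

(** The block length must not depend on [n]. For [n0 <= n], twelve graphs give [C ^- 3] per set, and
    [C ^- 2 <= (2 * n)^-1]. For [n < n0 <= J] the allowed cut is [0], each graph fails with
    probability at most [1 - H^-1], and a [k] depending on [n0] only is enough. *)
Lemma avg_bad_block_le_half (J n0 k : nat) : 4032 <= J%:R :> R ->
  256 * 17 ^+ 8 <= n0%:R ^+ 3 :> R -> (n0 <= J)%N -> (12 <= k)%N ->
  (n0 * 2 * (2 ^ n0 * 2 ^ n0) <= k)%N -> avg Om k (fun l => (bad_block J l)%:R) <= 2^-1 :> R.
Proof.
move=> hJ hn0 n0J k12 kbig; apply: avg_bad_block => A a0 an.
have q0 := cut_prob_ge0 A (#|A| %/ J); have q1 := cut_prob_le1 A (#|A| %/ J).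
set C := 'C(n, #|A|); have nC : (n <= C)%N by exact: bin_ge_size.
have n2 : 2 <= n%:R :> R by rewrite ler_nat; nat_lia.
have CR : n%:R <= C%:R :> R by rewrite ler_nat.
have C0 : 0 < C%:R :> R by lra.
have [n0n|nn0] := leqP n0 n.
  have q4 := cut_prob_large hJ hn0 n0n a0 an; rewrite -/C in q4.
  set q := cut_prob _ _ in q0 q1 q4 *.
  apply: (@le_trans _ _ (C%:R * q ^+ 12)).
    by apply: ler_wpM2l; [exact: ltW | apply: ler_wiXn2l].
  apply: (@le_trans _ _ (C%:R * (C%:R^-1) ^+ 3)).
    apply: ler_wpM2l; first exact: ltW.
    have -> : q ^+ 12 = (q ^+ 4) ^+ 3 by ring.
    by apply: lerXn2r => //; rewrite nnegrE ?exprn_ge0 // invr_ge0 ltW.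
  have -> : C%:R * C%:R^-1 ^+ 3 = (C%:R ^+ 2)^-1 :> R by field; rewrite gt_eqF.
  rewrite lef_pV2 ?posrE ?exprn_gt0 ?mulr_gt0 //; [nra | lra].
have aJ : (#|A| %/ J = 0)%N by apply: divn_small; nat_lia.
rewrite aJ in q0 q1 *; have qC := cut_prob_no_cut a0 an; rewrite -/C in qC.
set q := cut_prob _ _ in q0 q1 qC *.
pose H : R := (2 ^ n0)%:R.
have H1 : 1 <= H by rewrite ler1n expn_gt0.
have CH : C%:R <= H.
  rewrite ler_nat; apply: (@leq_trans (2 ^ n)); last by rewrite leq_exp2l // ltnW.
  rewrite /C -card_draws -cardsT -card_powerset; apply: subset_leq_card.
  by apply/subsetP => B _; rewrite inE subsetT.
have qH : q <= 1 - H^-1.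
  by apply: le_trans qC _; rewrite lerB // lef_pV2 ?posrE //; lra.
have HV : 0 < H^-1 by rewrite invr_gt0; lra.
(* Bernoulli's inequality for [1 + H^-1], combined with [(1 - H^-1) * (1 + H^-1) <= 1]. *)
have bern : q ^+ k * (1 + H^-1 * k%:R) <= 1.
  apply: (@le_trans _ _ ((1 - H^-1) ^+ k * (1 + H^-1) ^+ k)).
    apply: ler_pM; rewrite ?exprn_ge0 //.
    - by have : 0 <= H^-1 * k%:R by [rewrite mulr_ge0 ?ler0n // ltW]; lra.
    - by apply: lerXn2r; rewrite ?nnegrE //; lra.
    - elim: k {k12 kbig} => [|k IH]; first by rewrite mulr0 addr0 expr0.
      rewrite exprS -natr1; have : 0 <= k%:R :> R by exact: ler0n.
      have h1 : 0 <= 1 + H^-1 by lra.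
      move=> kk; apply: le_trans (ler_wpM2l h1 IH).
      have := mulr_ge0 (mulr_ge0 (ltW HV) (ltW HV)) kk; lra.
  rewrite -exprMn exprn_ile1 //; last by nra.
  have : H^-1 <= 1 by rewrite invf_le1 //; lra.
  by nra.
have kR : n0%:R * 2 * (H * H) <= k%:R :> R by rewrite /H -!natrM ler_nat.
have nn0R : n%:R <= n0%:R :> R by rewrite ler_nat ltnW.
rewrite -[leRHS]mul1r ler_pdivlMr; last by lra.
apply: le_trans bern; rewrite mulrC mulrA [_ * q ^+ k]mulrC -[leLHS]mulr1.
rewrite mulr1; apply: ler_wpM2l; first by rewrite exprn_ge0.
have e1 : H^-1 * (n0%:R * 2 * (H * H)) = n0%:R * 2 * H by field; rewrite gt_eqF //; lra.
have := ler_wpM2l (ltW HV) kR; rewrite e1.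
have p1 : n%:R * C%:R <= n0%:R * H by apply: ler_pM; rewrite ?ler0n.
lra.
Qed.

End BadBlocks.

(** * Contraction over blocks of random graphs *)

Section RandomGraphs.
Variables (R : realType) (n d : nat).
Hypothesis d_gt1 : (1 < d)%N.
Local Notation dR := (d%:R : R).
Local Notation Om := (reg_graphs n d).
Implicit Types (E : {set 'I_n * 'I_n}) (x : 'cV[R]_n) (l : seq {set 'I_n * 'I_n}).

Definition looped E (i j : 'I_n) : R := ((i == j) || ((i, j) \in E))%:R.

Let d_gt0 : 0 < dR. Proof. by rewrite ltr0n ltnW. Qed.
Let d_ge1 : 1 <= dR. Proof. by rewrite ler1n ltnW. Qed.

Lemma ran_matE E i j : ran_mat R d E i j = looped E i j / dR.
Proof. by rewrite mxE /looped; case: ifP; rewrite ?mul1r ?mul0r. Qed.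

Lemma reg_graphsP E : reflect
  [/\ forall i, (i, i) \notin E, forall i, #|[set j | (i, j) \in E]| = d.-1
    & forall i j, ((i, j) \in E) = ((j, i) \in E)] (E \in Om).
Proof.
rewrite inE; apply: (iffP andP) => [[/forallP h1 /forallP h2]|[h1 h2 h3]].
  split=> [i|i|i j]; [by have /andP[] := h1 i | by have /andP[_ /eqP] := h1 i |].
  by have /forallP/(_ j)/eqP := h2 i.
split; apply/forallP => i; first by rewrite h1 h2 eqxx.
by apply/forallP => j; rewrite h3.
Qed.

Lemma looped_01 E i j : looped E i j = 0 \/ looped E i j = 1.
Proof. by rewrite /looped; case: (_ || _); [right | left]. Qed.

Lemma looped_ge0 E i j : 0 <= looped E i j. Proof. exact: ler0n. Qed.

Lemma looped_refl E i : looped E i i = 1. Proof. by rewrite /looped eqxx. Qed.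

Lemma looped_sym E i j : E \in Om -> looped E i j = looped E j i.
Proof. by move=> /reg_graphsP[_ _ hs]; rewrite /looped eq_sym hs. Qed.

Lemma looped_sum E i : E \in Om -> \sum_j looped E i j = dR.
Proof.
move=> /reg_graphsP[hi hd _].
rewrite (bigD1 i) //= looped_refl.
have -> : \sum_(j | j != i) looped E i j = d.-1%:R.
  rewrite -(hd i) -sum1_card natr_sum big_mkcond [RHS]big_mkcond; apply: eq_bigr => j _.
  rewrite inE /looped eq_sym; case: eqVneq => [->|_] /=; last by case: ifP.
  by rewrite (negbTE (hi j)).
by rewrite addrC natr1 prednK // ltnW.
Qed.

Lemma reg_graphs_relabel u v E : E \in Om -> relabel u v E \in Om.
Proof.
move=> /reg_graphsP[hi hd hs]; apply/reg_graphsP; split=> [i|i|i j].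
- by rewrite mem_relabel hi.
- rewrite -(hd (tperm u v i)) -(card_imset (mem [set j | (i, j) \in relabel u v E])
    (@perm_inj _ (tperm u v))).
  apply: eq_card => j; rewrite inE; apply/imsetP/idP => [[k]|h].
    by rewrite inE mem_relabel => h ->.
  by exists (tperm u v j); rewrite ?tpermK // inE mem_relabel tpermK.
- by rewrite !mem_relabel hs.
Qed.

Lemma reg_graphs_nbr E i : E \in Om -> exists j, (i, j) \in E.
Proof.
move=> /reg_graphsP[_ hd _]; have : (0 < #|[set j | (i, j) \in E]|)%N.
  by rewrite hd -ltnS prednK // ltnW.
by case/card_gt0P => j; rewrite inE; exists j.
Qed.

Definition gvar x : R := var (fun=> dR) setT (fun i => x i 0).

Definition run l x := foldl (fun y E => ran_mat R d E *m y) x l.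

Definition dirichlet E x : R :=
  \sum_(i in [set: 'I_n]) \sum_(j in [set: 'I_n]) looped E i j * (x i 0 - x j 0) ^+ 2.

Definition gdissip E x : R :=
  dissip (looped E) setT (fun i => x i 0) (fun i => (ran_mat R d E *m x) i 0).

Let stepE E x k : (ran_mat R d E *m x) k 0 = \sum_j looped E k j / dR * x j 0.
Proof. by rewrite mxE; apply: eq_bigr => j _; rewrite ran_matE. Qed.

Lemma gdissip_ge0 E x : 0 <= gdissip E x.
Proof. by apply: dissip_ge0 => i j; apply: looped_ge0. Qed.

Lemma gvar_step E x : E \in Om -> gvar (ran_mat R d E *m x) <= gvar x - gdissip E x.
Proof.
move=> EO; apply: var_step => //.
- by move=> i j; apply: looped_sym.
- by move=> i; apply: looped_sum.
Qed.

Lemma gvar_noninc E x : E \in Om -> gvar (ran_mat R d E *m x) <= gvar x.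
Proof. by move=> EO; have := gvar_step x EO; have := gdissip_ge0 E x; lra. Qed.

Lemma gvar_run l x : all (mem Om) l -> gvar (run l x) <= gvar x.
Proof.
elim: l x => //= E l IH x /andP[EO lO]; apply: le_trans (IH _ lO) _.
exact: gvar_noninc.
Qed.

Lemma dirichlet_le_gdissip E x : E \in Om -> dirichlet E x <= 2 * dR * gdissip E x.
Proof.
move=> EO; apply: (@dirichlet_le_dissip _ _ (looped E) dR) => //.
- exact: looped_01.
- exact: looped_refl.
- by move=> i; apply: looped_sum.
Qed.

(** The squared displacement of an agent is the loop term of its row in the dissipation. *)
Lemma displacement_le E x :
  \sum_i ((ran_mat R d E *m x) i 0 - x i 0) ^+ 2 <= gdissip E x.
Proof.
rewrite /gdissip /dissip [leRHS]big_mkcond; apply: ler_sum => k _ /=.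
rewrite inE (bigD1 k) //= looped_refl mul1r -[(_ - _) ^+ 2]sqrrN opprB lerDl.
by apply: sumr_ge0 => j _; rewrite mulr_ge0 ?sqr_ge0 ?looped_ge0.
Qed.

Lemma dirichlet_perturb E x y : E \in Om ->
  dirichlet E x <= 2 * dirichlet E y + 8 * dR * \sum_i (y i 0 - x i 0) ^+ 2.
Proof.
move=> EO; pose z i := y i 0 - x i 0.
have sT (F : 'I_n -> R) : \sum_(i in [set: 'I_n]) F i = \sum_i F i.
  by apply: eq_bigl => i; rewrite inE.
have rowz : \sum_i \sum_j looped E i j * z i ^+ 2 = dR * \sum_i z i ^+ 2.
  by rewrite mulr_sumr; apply: eq_bigr => i _; rewrite -mulr_suml looped_sum.
have colz : \sum_i \sum_j looped E i j * z j ^+ 2 = dR * \sum_i z i ^+ 2.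
  rewrite exchange_big -rowz; apply: eq_bigr => i _; apply: eq_bigr => j _.
  by rewrite looped_sym.
apply: (@le_trans _ _ (2 * dirichlet E y + (4 * \sum_i \sum_j looped E i j * z i ^+ 2
   + 4 * \sum_i \sum_j looped E i j * z j ^+ 2))); last by rewrite rowz colz -/z; lra.
rewrite /dirichlet !sT !mulr_sumr -!big_split; apply: ler_sum => i _ /=.
rewrite sT !sT !mulr_sumr -!big_split; apply: ler_sum => j _ /=.
have := looped_ge0 E i j; rewrite /z; move: (looped E i j) => w w0.
have -> : 2 * (w * (y i 0 - y j 0) ^+ 2) + (4 * (w * (y i 0 - x i 0) ^+ 2)
    + 4 * (w * (y j 0 - x j 0) ^+ 2))
  = w * (2 * (y i 0 - y j 0) ^+ 2 + 4 * (y i 0 - x i 0) ^+ 2 + 4 * (y j 0 - x j 0) ^+ 2).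
  by ring.
apply: ler_wpM2l => //; move: (x i 0) (x j 0) (y i 0) (y j 0) => a b c e.
have h1 : 0 <= (c - e + ((c - a) - (e - b))) ^+ 2 by exact: sqr_ge0.
have h2 : 0 <= ((c - a) + (e - b)) ^+ 2 by exact: sqr_ge0.
lra.
Qed.

(** Expansion of the union concerns all Dirichlet forms at one state, whereas each graph of the
    block acts on its own state. Moving back to the initial [x] costs displacements, which the
    dissipation bounds; [16 ^+ size l] absorbs their accumulation. *)
Lemma block_dirichlet l x : all (mem Om) l ->
  \sum_(E <- l) dirichlet E x <= dR * 16 ^+ size l * (gvar x - gvar (run l x)).
Proof.
elim: l x => [|E l IH] x /=; first by rewrite big_nil subrr mulr0.
move=> /andP[EO lO]; rewrite big_cons; set y := ran_mat R d E *m x.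
have D1 := gvar_step x EO; rewrite -/y in D1; have g0 := gdissip_ge0 E x.
have dE := dirichlet_le_gdissip x EO.
have dz := displacement_le E x; rewrite -/y in dz.
have r' := gvar_run y lO; have {}IH := IH y lO.
have pert : \sum_(F <- l) dirichlet F x <=
    2 * \sum_(F <- l) dirichlet F y + 8 * dR * (size l)%:R * gdissip E x.
  rewrite [leLHS]big_seq mulr_sumr.
  have -> : 8 * dR * (size l)%:R * gdissip E x = \sum_(F <- l) 8 * dR * gdissip E x.
    by rewrite big_const_seq count_predT iter_addr_0 -[RHS]mulr_natr; ring.
  rewrite -big_split [leRHS]big_seq; apply: ler_sum => F Fl /=.
  have FO : F \in Om by exact: (allP lO).
  apply: le_trans (dirichlet_perturb x y FO) _; rewrite lerD2l.
  by apply: ler_wpM2l => //; rewrite mulr_ge0 // ltW.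
have k16 : 2 + 8 * (size l)%:R <= 16 ^+ (size l).+1 :> R.
  elim: (size l) => [|k IHk]; first by rewrite mulr0; lra.
  rewrite exprS -natr1; have : 0 <= k%:R :> R by exact: ler0n.
  by move: IHk; move: (16 ^+ k.+1) => z; lra.
have z16 : 0 <= 16 ^+ size l :> R by rewrite exprn_ge0.
have D0 : 0 <= gvar x - gvar y by lra.
have D0' : 0 <= gvar y - gvar (run l y) by lra.
have sl : 0 <= (size l)%:R :> R by exact: ler0n.
rewrite /run /= -/y -/(run l y).
apply: (@le_trans _ _ (dR * ((2 + 8 * (size l)%:R) * (gvar x - gvar y))
    + 2 * (dR * 16 ^+ size l * (gvar y - gvar (run l y))))).
  have gD : gdissip E x <= gvar x - gvar y by lra.
  have c0 : 0 <= dR * (2 + 8 * (size l)%:R) by rewrite mulr_ge0 ?(ltW d_gt0) //; lra.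
  have := ler_wpM2l c0 gD; lra.
have := ler_wpM2r D0 k16 => h1; have := ler_wpM2l (ltW d_gt0) h1.
have := mulr_ge0 (mulr_ge0 (ltW d_gt0) z16) D0'.
rewrite exprS; lra.
Qed.

(** Cheeger's inequality is applied to the sum [a] of the looped graphs, with expansion [J^-1] and
    row sums [k * d]. The other two factors [d] come from the weights in the variance and from
    [block_dirichlet]. *)
Lemma good_block_contracts J l x : (0 < J)%N -> (0 < size l)%N -> all (mem Om) l ->
  ~~ bad_block J l ->
  gvar (run l x)
    <= (1 - (J%:R ^+ 2 * ((size l)%:R * dR ^+ 3 * 16 ^+ size l))^-1) * gvar x.
Proof.
move=> J0 k0 lO good; pose k : R := (size l)%:R; pose h : R := J%:R^-1.
have JR : 0 < J%:R :> R by rewrite ltr0n.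
have kR : 0 < k by rewrite ltr0n.
have h0 : 0 < h by rewrite invr_gt0.
pose a i j : R := \sum_(E <- l) looped E i j.
have a_sym i j : a i j = a j i.
  rewrite /a big_seq [RHS]big_seq; apply: eq_bigr => E El.
  by apply: looped_sym; apply: (allP lO).
have a_ge0 i j : 0 <= a i j by apply: sumr_ge0 => E _; apply: looped_ge0.
have a_row i : i \in [set: 'I_n] -> \sum_(j in [set: 'I_n]) a i j <= k * dR.
  move=> _; rewrite /a exchange_big big_seq /=.
  rewrite (eq_bigr (fun=> dR)); last first.
    move=> E El; rewrite -(@looped_sum E i); last exact: (allP lO).
    by apply: eq_bigl => j; rewrite inE.
  by rewrite -big_seq big_const_seq count_predT iter_addr_0 -[leLHS]mulr_natl.
have Dg0 : 0 < k * dR by rewrite mulr_gt0.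
have expansion (S : {set 'I_n}) : S \subset [set: 'I_n] -> S != set0 ->
    (2 * #|S| <= #|[set: 'I_n]|)%N ->
    h * #|S|%:R <= \sum_(i in S) \sum_(j in [set: 'I_n] :\: S) a i j.
  move=> _ S0 Sn; move: good; rewrite negb_exists => /forallP/(_ S).
  rewrite card_gt0 S0 -cardsT Sn /= => /allPn[E El]; rewrite -ltnNge => big.
  apply: (@le_trans _ _ (cut E S)%:R).
    rewrite mulrC ler_pdivrMr // -natrM ler_nat.
    apply: ltnW; apply: leq_trans (ltn_ceil #|S| J0) _.
    by rewrite leq_mul2r big orbT.
  apply: (@le_trans _ _ (\sum_(i in S) \sum_(j in [set: 'I_n] :\: S) looped E i j)).
    rewrite /cut -sum1_card natr_sum pair_big_dep /= big_mkcond [leRHS]big_mkcond.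
    apply: ler_sum => -[i j] _; rewrite !inE /= andbT.
    case: (i \in S) => /=; last by rewrite andbF.
    case: (j \in S) => /=; first by rewrite andbF.
    by rewrite andbT /looped; case: ((i, j) \in E); rewrite ?orbT ?ler0n.
  apply: ler_sum => i _; apply: ler_sum => j _.
  rewrite /a (big_rem E) //= lerDl; apply: sumr_ge0 => F _; exact: looped_ge0.
have [c hc] := cheeger a_sym a_ge0 a_row h0 Dg0 expansion (fun i => x i 0).
have dirE : \sum_(i in [set: 'I_n]) \sum_(j in [set: 'I_n]) a i j * (x i 0 - x j 0) ^+ 2
    = \sum_(E <- l) dirichlet E x.
  rewrite /dirichlet [RHS]exchange_big; apply: eq_bigr => i _ /=.
  by rewrite [RHS]exchange_big; apply: eq_bigr => j _ /=; rewrite /a mulr_suml.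
rewrite dirE in hc; have bd := block_dirichlet x lO.
have vm : gvar x <= dR * \sum_(i in [set: 'I_n]) (x i 0 - c) ^+ 2.
  by rewrite mulr_sumr; exact: (var_le_moment (fun=> d_ge1)).
have h2 : 0 < h ^+ 2 by rewrite exprn_gt0.
set W : R := (size l)%:R * dR ^+ 3 * 16 ^+ size l.
have W0 : 0 < W by rewrite !mulr_gt0 ?exprn_gt0.
have main : h ^+ 2 * gvar x <= W * (gvar x - gvar (run l x)).
  apply: le_trans (ler_wpM2l (ltW h2) vm) _; rewrite mulrCA.
  apply: le_trans (ler_wpM2l (ltW d_gt0) hc) _.
  apply: le_trans (ler_wpM2l (ltW d_gt0) (ler_wpM2l (ltW Dg0) bd)) _.
  by rewrite le_eqVlt; apply/orP; left; apply/eqP; rewrite /W /k; ring.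
have -> : (J%:R ^+ 2 * W)^-1 = h ^+ 2 / W by rewrite invfM /h exprVn.
have : h ^+ 2 / W * gvar x <= gvar x - gvar (run l x).
  by rewrite mulrAC ler_pdivrMr // [leRHS]mulrC.
by rewrite mulrBl mul1r; lra.
Qed.

(** * The expected number of active times *)

Section Counting.
Variable eps : R.
Hypothesis eps_gt0 : 0 < eps.

Definition step_active E x : bool :=
  [exists i : 'I_n, exists j : 'I_n,
     (ran_mat R d E i j != 0) && (eps <= `|x i 0 - x j 0|)].

Fixpoint list_count l x : nat :=
  if l is E :: l' then (step_active E x + list_count l' (ran_mat R d E *m x))%N else 0%N.

Lemma list_count_size l x : (list_count l x <= size l)%N.
Proof.
elim: l x => //= E l IH x.
by apply: (@leq_add _ _ 1); [case: (step_active _ _) | exact: IH].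
Qed.

Lemma list_count_cat l1 l2 x :
  list_count (l1 ++ l2) x = (list_count l1 x + list_count l2 (run l1 x))%N.
Proof. by elim: l1 x => //= E l1 IH x; rewrite IH addnA. Qed.

Lemma list_count_quiet l x : all (mem Om) l -> 2 * gvar x / eps ^+ 2 < 1 ->
  list_count l x = 0%N.
Proof.
have e2 : 0 < eps ^+ 2 by rewrite exprn_gt0.
elim: l x => //= E l IH x /andP[EO lO]; rewrite ltr_pdivrMr // mul1r => small.
rewrite IH //; last first.
  by rewrite ltr_pdivrMr // mul1r; have := gvar_noninc x EO; lra.
rewrite addn0; apply/eqP; rewrite eqb0; apply/existsP => -[i /existsP[j /andP[_ far]]].
have := @var_ge_pair _ _ (fun=> dR) (fun=> d_ge1) setT (fun i => x i 0) i j.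
rewrite !inE -/(gvar x) => /(_ isT isT).
have : eps ^+ 2 <= (x i 0 - x j 0) ^+ 2.
  by rewrite -[leRHS]real_normK ?num_real // ler_sqr ?nnegrE // ltW.
by move: small; lra.
Qed.

Definition max_count v l : nat :=
  \max_(k < (size l).+1 | `[< exists x, gvar x <= v /\ list_count l x = k >]) k.

Lemma max_count_le v l B :
  (forall x, gvar x <= v -> (list_count l x <= B)%N) -> (max_count v l <= B)%N.
Proof. by move=> h; apply/bigmax_leqP => k /asboolP[x [xv <-]]; apply: h. Qed.

Lemma le_max_count v l x : gvar x <= v -> (list_count l x <= max_count v l)%N.
Proof.
move=> xv; have lt : (list_count l x < (size l).+1)%N by rewrite ltnS list_count_size.
apply: (@leq_bigmax_cond _ _ (fun k : 'I_(size l).+1 => nat_of_ord k) (Ordinal lt)).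
by apply/asboolP; exists x.
Qed.

Variables (s delta : R) (J k : nat).
Hypothesis s01 : 0 < s <= 1.
Hypothesis J_gt0 : (0 < J)%N.
Hypothesis k_gt0 : (0 < k)%N.
Hypothesis Om_gt0 : (0 < #|Om|)%N.
Hypothesis deltaE : delta = (J%:R ^+ 2 * (k%:R * dR ^+ 3 * 16 ^+ k))^-1.
Hypothesis bad_rare : avg Om k (fun l => (bad_block J l)%:R) <= 2^-1 :> R.

Let delta01 : 0 < delta <= 1.
Proof.
have kR : 1 <= k%:R :> R by rewrite ler1n.
have JR : 1 <= J%:R :> R by rewrite ler1n.
have p : 1 <= J%:R ^+ 2 * (k%:R * dR ^+ 3 * 16 ^+ k).
  by rewrite !mulr_ege1 // ?exprn_ege1 // ler1n.
by rewrite deltaE invr_gt0 invf_le1 (lt_le_trans ltr01 p) ?p.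
Qed.

Let Bc : R := 4 * k%:R / (s * delta).

(** With probability at least one half a block lowers the energy [u] by the fraction
    [s * delta / 2], so [Bc * u] loses on average at least [k * u >= k], which pays for the at most
    [k] active times of the block. *)
Lemma avg_max_count N v : 0 <= v ->
  avg Om N (fun l => (max_count v l)%:R) <= Bc * (2 * v / eps ^+ 2) `^ s.
Proof.
have e2 : 0 < eps ^+ 2 by rewrite exprn_gt0.
have /andP[s0 s1] := s01; have /andP[d0 d1] := delta01.
have sd : 0 < s * delta by rewrite mulr_gt0.
have sd1 : s * delta <= 1 by rewrite -[leRHS]mulr1; apply: ler_pM => //; apply: ltW.
have kR : 1 <= k%:R :> R by rewrite ler1n.
have Bk : k%:R <= Bc by rewrite /Bc ler_pdivlMr //; nra.
have B0 : 0 <= Bc by apply: le_trans Bk; apply: le_trans ler01 kR.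
elim/ltn_ind: N v => N IH v v0; set u := (2 * v / eps ^+ 2) `^ s.
have [small|big] := ltP (2 * v / eps ^+ 2) 1.
  apply: (@le_trans _ _ (avg Om N (fun=> 0))); last by rewrite avg_const // mulr_ge0 ?powR_ge0.
  apply: avg_le => // l _ lO; rewrite lern0 -leqn0; apply: max_count_le => x xv.
  rewrite list_count_quiet //; apply: le_lt_trans small.
  by rewrite ler_pM2r ?invr_gt0 // ler_pM2l.
have u1 : 1 <= u by rewrite -(powRr0 (2 * v / eps ^+ 2)); apply: ler_powR => //; apply: ltW.
have [Nk|kN] := ltnP N k.
  apply: (@le_trans _ _ (avg Om N (fun=> k%:R))).
    apply: avg_le => // l sl _; rewrite ler_nat; apply: max_count_le => x _.
    by apply: leq_trans (list_count_size _ _) _; rewrite sl ltnW.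
  by rewrite avg_const //; apply: le_trans Bk _; rewrite ler_peMr.
have -> : N = (k + (N - k))%N by rewrite subnKC.
rewrite avg_cat; set N' := (N - k)%N.
have N'N : (N' < N)%N by rewrite /N'; nat_lia.
apply: (@le_trans _ _ (avg Om k (fun l1 =>
   (k%:R + Bc * u * (1 - s * delta / 2)) + Bc * u * (s * delta / 2) * (bad_block J l1)%:R))).
  (* [v1] bounds the variance after the block for every starting state at once, so the later graphs
     see only this number. *)
  apply: avg_le => // l1 sl1 l1O; pose v1 := if bad_block J l1 then v else (1 - delta) * v.
  have v10 : 0 <= v1 by rewrite /v1; case: ifP => // _; rewrite mulr_ge0 //; lra.
  apply: (@le_trans _ _ (avg Om N' (fun l2 => k%:R + 1 * (max_count v1 l2)%:R))).
    apply: avg_le => // l2 _ _; rewrite mul1r -natrD ler_nat; apply: max_count_le => x xv.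
    rewrite list_count_cat; apply: leq_add.
      by rewrite -sl1 list_count_size.
    apply: le_max_count; rewrite /v1; case: ifP => [_|/negbT good].
      by apply: le_trans (gvar_run _ l1O) xv.
    have sz : (0 < size l1)%N by rewrite sl1.
    have := good_block_contracts x J_gt0 sz l1O good; rewrite sl1 -deltaE => h.
    by apply: le_trans h _; apply: ler_wpM2l => //; lra.
  rewrite avg_lin avg_const // mul1r -addrA lerD2l.
  apply: le_trans (IH _ N'N v1 v10) _; rewrite -/u.
  have arg0 w : 0 <= w -> 0 <= 2 * w / eps ^+ 2.
    by move=> w0; rewrite divr_ge0 ?mulr_ge0 // ltW.
  have -> (b : R) : Bc * u * (1 - s * delta / 2) + Bc * u * (s * delta / 2) * b
      = Bc * ((1 - s * delta / 2 + s * delta / 2 * b) * u) by ring.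
  apply: ler_wpM2l => //; rewrite /v1; case: ifP => _.
    by rewrite mulr1 subrK mul1r.
  rewrite mulr0 addr0.
  apply: powR_drop => //; rewrite ?arg0 //; first by rewrite (ltW d0).
    by rewrite mulr_ge0 //; lra.
  by rewrite le_eqVlt; apply/orP; left; apply/eqP; ring.
rewrite avg_lin avg_const //.
have Bu : Bc * (s * delta) = 4 * k%:R by rewrite /Bc; field; rewrite !gt_eqF.
have u0 : 0 <= Bc * u * (s * delta / 2).
  by apply: mulr_ge0; [apply: mulr_ge0 => //; apply: powR_ge0 | rewrite divr_ge0 ?(ltW sd)].
have := ler_wpM2l u0 bad_rare.
have -> : Bc * u * (s * delta / 2) = 2 * k%:R * u.
  have -> : Bc * u * (s * delta / 2) = Bc * (s * delta) * u / 2 by ring.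
  by rewrite Bu; lra.
have -> : Bc * u * (1 - s * delta / 2) = Bc * u - 2 * k%:R * u.
  have -> : Bc * u * (1 - s * delta / 2) = Bc * u - Bc * (s * delta) * u / 2 by ring.
  by rewrite Bu; lra.
have ku : k%:R <= k%:R * u by rewrite ler_peMr // (le_trans ler01 kR).
by lra.
Qed.

End Counting.

End RandomGraphs.

(** * From lists of graphs to trajectories, and the final bounds *)

Lemma traj_shift (R : realType) n (P : nat -> 'M[R]_n) x t :
  traj P x t.+1 = traj (fun u => P u.+1) (P 0%N *m x) t.
Proof. by elim: t => //= t <-. Qed.

Lemma count_activeS (R : realType) (eps : R) n (P : nat -> 'M[R]_n) x N :
  count_active eps P x N.+1 =
  (active eps P x 0 + count_active eps (fun u => P u.+1) (P 0%N *m x) N)%N.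
Proof.
rewrite /count_active big_ord_recl; congr addn; apply: eq_bigr => t _.
by rewrite /active lift0 traj_shift.
Qed.

Lemma count_active_list (R : realType) (eps : R) n d l (P : nat -> 'M[R]_n) x :
  (forall t, (t < size l)%N -> P t = ran_mat R d (nth set0 l t)) ->
  count_active eps P x (size l) = list_count d eps l x.
Proof.
elim: l P x => [|E l IH] P x h; first by rewrite /count_active big_ord0.
rewrite count_activeS /= -(h 0%N) //; congr addn.
  by rewrite /active /step_active -(h 0%N).
by apply: IH => t tl; apply: (h t.+1).
Qed.

Lemma ran_Tmax_le (R : realType) (eps : R) n d N (g : {ffun 'I_N -> {set 'I_n * 'I_n}}) :
  (ran_Tmax d eps g <= max_count d eps (1 : R)%R [seq g i | i <- enum 'I_N])%N.
Proof.
apply/bigmax_leqP => k /asboolP[x [xv <-]].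
have sz : size [seq g i | i <- enum 'I_N] = N by rewrite size_map size_enum_ord.
rewrite -[X in count_active _ _ _ X]sz (@count_active_list _ _ _ d) => [|t]; last first.
  rewrite sz => tN; rewrite /ran_seq insubT (nth_map (Ordinal tN)) ?size_enum_ord //.
  by rewrite (nth_ord_enum (Ordinal tN) (Ordinal tN)).
by apply: le_max_count; apply: wvarE.
Qed.

Theorem ran_bound (R : realType) d : (3 < d)%N ->
  exists c : R, 0 < c /\ exists eps0 : R, 0 < eps0 /\
  forall eps : R, 0 < eps -> eps < eps0 ->
  forall n, (0 < #|reg_graphs n d|)%N ->
  forall N, @ran_expect R n d eps N <= c * ln eps^-1.
Proof.
move=> d3; have d1 : (1 < d)%N by apply: leq_trans d3.
(* A single number serves as the size threshold and as [J]; neither it nor the block length [k]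
   depends on [n] or [eps]. *)
have [n0 hn0] : exists n0 : nat, 256 * 17 ^+ 8 <= n0%:R :> R.
  exists (Num.bound (256 * 17 ^+ 8 : R)); apply: ltW; apply: archi_boundP.
  by rewrite mulr_ge0 ?exprn_ge0.
have n0_ge1 : 1 <= n0%:R :> R by apply: le_trans hn0; lra.
have hn3 : 256 * 17 ^+ 8 <= n0%:R ^+ 3 :> R.
  apply: le_trans hn0 _; rewrite -[leLHS]expr1; exact: ler_weXn2l.
have hJ : 4032 <= n0%:R :> R by apply: le_trans hn0; lra.
have n0_gt0 : (0 < n0)%N by rewrite -(ler1n R).
have [k [k12 kbig]] : exists k, (12 <= k)%N /\ (n0 * 2 * (2 ^ n0 * 2 ^ n0) <= k)%N.
  by exists (12 + n0 * 2 * (2 ^ n0 * 2 ^ n0))%N; rewrite leq_addr leq_addl.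
have k_gt0 : (0 < k)%N by apply: leq_trans k12.
pose delta : R := (n0%:R ^+ 2 * (k%:R * d%:R ^+ 3 * 16 ^+ k))^-1.
have delta_gt0 : 0 < delta.
  by rewrite invr_gt0 !mulr_gt0 ?exprn_gt0 ?ltr0n // ltnW.
exists (4 * k%:R / delta * expR 3); split.
  by rewrite mulr_gt0 ?expR_gt0 // divr_gt0 // mulr_gt0 ?ltr0n.
exists (expR (-1)); split=> [|eps e0 e1 n Om0 N]; first exact: expR_gt0.
set l := ln eps^-1.
have l1 : 1 <= l.
  rewrite /l -[leLHS]expRK ler_ln ?posrE ?expR_gt0 ?invr_gt0 //.
  by rewrite -[expR 1]invrK -expRN lef_pV2 ?posrE ?expR_gt0 // ltW.
have l0 : 0 < l by apply: lt_le_trans l1.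
have s01 : 0 < l^-1 <= 1 by rewrite invr_gt0 l0 invf_le1.
have bad : avg (reg_graphs n d) k (fun b => (bad_block n0 b)%:R) <= 2^-1 :> R.
  apply: (@avg_bad_block_le_half _ _ _ _ _ _ _ _ n0 n0 k) => //.
  - by move=> u v E; apply: reg_graphs_relabel.
  - by move=> E u /reg_graphsP[].
  - by move=> E u v /reg_graphsP[].
  - by move=> E u; apply: reg_graphs_nbr.
have h := avg_max_count d1 e0 s01 n0_gt0 k_gt0 Om0 erefl bad N ler01.
have le1 : @ran_expect R n d eps N
    <= avg (reg_graphs n d) N (fun b => (max_count d eps (1 : R) b)%:R).
  rewrite -avg_family //; apply: ler_wpM2r; first by rewrite invr_ge0 ler0n.
  by apply: ler_sum => g _; rewrite ler_nat ran_Tmax_le.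
apply: le_trans le1 (le_trans h _).
have ie : eps^-1 = expR l by rewrite lnK // posrE invr_gt0.
have ie2 : 2 <= eps^-1 by rewrite ie; apply: le_trans (expR_ge1Dx _); lra.
have en : (2 * 1 / eps ^+ 2) `^ l^-1 <= expR 3.
  have -> : expR 3 = ((eps^-1) ^+ 3) `^ l^-1 :> R.
    by rewrite ie -expRM_natl -expRM; congr expR; field; rewrite gt_eqF.
  have eV : 0 <= eps^-1 by rewrite invr_ge0 ltW.
  apply: ge0_ler_powR; rewrite ?nnegrE ?exprn_ge0 //; first by rewrite invr_ge0 ltW.
    by rewrite mulr1 divr_ge0 // exprn_ge0 // ltW.
  by rewrite mulr1 -exprVn [leRHS]exprS; apply: ler_wpM2r => //; rewrite exprn_ge0.
rewrite -/delta.
have -> : 4 * k%:R / (l^-1 * delta) = 4 * k%:R / delta * l.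
  by field; rewrite !gt_eqF.
rewrite [leRHS]mulrAC; apply: ler_wpM2l en; rewrite mulr_ge0 ?(ltW l0) //.
by rewrite divr_ge0 ?(ltW delta_gt0) // mulr_ge0 ?ler0n.
Qed.

Theorem theorem2 (R : realType) :
  (exists c : R, 0 < c /\ exists eps0 : R, 0 < eps0 /\
   forall eps : R, 0 < eps -> eps < eps0 ->
   (* general case: T_{m,eps} <= c (1/rho)^(n-1) (m n log(1/eps))^m *)
   (forall (n m : nat) (rho : R) (P : nat -> 'M[R]_n) (x0 : 'cV[R]_n),
      0 < rho -> rho <= 2^-1 ->
      (forall t, admissible rho (P t)) ->
      (forall t, (ncomp (P t) <= m)%N) ->
      (forall i, 0 <= x0 i 0 <= 1) ->
      forall N : nat,
        (count_active eps P x0 N)%:R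
          <= c * rho^-1 ^+ n.-1 * ((m * n)%:R * ln eps^-1) ^+ m)
   (* REV: T^REV_{m,eps} <= c (n^2/rho log(1/eps))^m *)
   /\ (forall (n m : nat) (rho : R) (q : 'I_n -> R) (P : nat -> 'M[R]_n)
          (x0 : 'cV[R]_n),
      0 < rho -> rho <= 2^-1 ->
      (forall t, admissible rho (P t)) ->
      (forall t, exists M : 'M[R]_n, rev_mat rho q M (P t)) ->
      (forall t, (ncomp (P t) <= m)%N) ->
      wvar_le1 q x0 ->
      forall N : nat,
        (count_active eps P x0 N)%:R
          <= c * ((n ^ 2)%:R / rho * ln eps^-1) ^+ m)
   (* EXP: T^EXP_{m,eps} <= c (d^3 m n / h^2 log(1/eps))^m and
           T^EXP_{1,eps} <= c d^3 / h^2 log(1/eps) *)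
   /\ (forall (n m d : nat) (rho h : R) (P : nat -> 'M[R]_n) (x0 : 'cV[R]_n),
      0 < rho -> rho <= 2^-1 -> 0 < h ->
      (forall t, admissible rho (P t)) ->
      (forall t, exists M : 'M[R]_n,
          rev_mat rho (fun _ => d%:R) M (P t) /\
          (forall i j, M i j = 0 \/ M i j = 1)) ->
      (forall t, cheeger_ge h (P t)) ->
      (forall t, (ncomp (P t) <= m)%N) ->
      wvar_le1 (fun _ => d%:R) x0 ->
      forall N : nat,
        (count_active eps P x0 N)%:R
          <= c * ((d ^ 3 * m * n)%:R / h ^+ 2 * ln eps^-1) ^+ m
        /\ ((m <= 1)%N ->
            (count_active eps P x0 N)%:R
              <= c * (d ^ 3)%:R / h ^+ 2 * ln eps^-1)))
  /\
  (* RAN: E T^RAN_{1,eps} <= c log(1/eps), for each fixed d > 3 *)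
  (forall d : nat, (3 < d)%N ->
   exists c : R, 0 < c /\ exists eps0 : R, 0 < eps0 /\
   forall eps : R, 0 < eps -> eps < eps0 ->
   forall n : nat, (0 < #|reg_graphs n d|)%N ->
   forall N : nat, @ran_expect R n d eps N <= c * ln eps^-1).
Proof.
split; last by move=> d d3; apply: ran_bound.
exists (expR 576); split; first exact: expR_gt0.
(* This threshold makes the exponents [192 / ln eps^-1] and [160 / ln eps^-1] at most [1]. *)
exists (expR (- 192)); split=> [|eps e0 e1]; first exact: expR_gt0.
have L : 192 <= ln eps^-1.
  rewrite lnV ?posrE // lerNr -[leRHS]expRK ler_ln ?posrE ?expR_gt0 //.
  exact: ltW.
split; last split.
- move=> n m rho P x0 rho0 rho12 adm comps x01 N.
  exact: gen_bound adm comps x01.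
- move=> n m rho q P x0 rho0 rho12 adm rev comps wv N.
  exact: rev_count adm rev comps wv.
- move=> n m d rho h P x0 rho0 rho12 h0 adm rev chg comps wv N.
  exact: exp_bound adm rev chg comps wv.
Qed.
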